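(* Let $\Xi$ be the class of switched systems $\dot x=u(t)Ax+(1-u(t))Bx$, $x\in\mathbb{R}^2$, $u(\cdot):[0,\infty[\to[0,1]$ measurable, where $A,B$ are $2\times2$ real Hurwitz matrices. (a) $\Xi$ admits a 5-parameters finite set of functions sufficient to check GUES (finite-SSF). (b) In the case described next, common Lyapunov functions forming a 5-parameters finite-SSF are given explicitly as follows. Let $E>1$, $\rho_A,\rho_B>0$, $\mathcal{K}=\frac12(E+\frac1E)$, $$A=\begin{pmatrix}-\rho_A & -1/E \\ E & -\rho_A\end{pmatrix},\qquad B=\begin{pmatrix}-\rho_B & -1 \\ 1 & -\rho_B\end{pmatrix},$$ and suppose $\mathcal{D}(\rho_A,\rho_B)>0$ and $\rho_{CC}(\rho_A,\rho_B)<1$. Then there exists $\zeta\in(0,1)$ such that, with $\tilde\rho_A=\zeta\rho_A$, $\tilde\rho_B=\zeta\rho_B$ and $$\tilde A=\begin{pmatrix}-\tilde\rho_A & -1/E \\ E & -\tilde\rho_A\end{pmatrix},\qquad \tilde B=\begin{pmatrix}-\tilde\rho_B & -1 \\ 1 & -\tilde\rho_B\end{pmatrix},$$ one has $\mathcal{D}(\tilde\rho_A,\tilde\rho_B)>0$ and $\rho_{CC}(\tilde\rho_A,\tilde\rho_B)=1$, the worst trajectories of the system associated to $(\tilde A,\tilde B)$ are closed curves, and, if $r=\tilde r(\alpha)$ is the equation in polar coordinates $(r,\alpha)$ of one fixed such worst trajectory, the function $$V(r,\alpha)=\frac{r}{\tilde r(\alpha)}$$ (with $V(0)=0$) is a common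 Lyapunov function for the system associated to $(A,B)$. The functions obtained from these $V$ by linear changes of coordinates form a family depending on five parameters, namely $\mathcal{K}$, the ratio $\rho_B/\rho_A$, and the three parameters of the change of coordinates bringing a pair to the normal form of $(A,B)$ displayed in (b) (up to multiplication of each matrix by a positive constant); this family is a finite-SSF for the class of those systems of $\Xi$ whose pair of matrices can be brought, by a linear change of coordinates and multiplication of each matrix by a positive constant, to the form of $(A,B)$ displayed in (b) with $E>1$, $\rho_A,\rho_B>0$ and $\mathcal{D}>0$.
   Context: A real matrix is Hurwitz if all its eigenvalues have strictly negative real part. GUES (globally uniformly exponentially stable): there exist $M,\lambda>0$ such that every solution of the system, for every measurable $u(\cdot)$ and every $x(0)=x_0$, satisfies $\|x(t)\|\le Me^{-\lambda t}\|x_0\|$ for all $t>0$. Common Lyapunov function (CLF): a continuous function $V:\mathbb{R}^2\to\mathbb{R}^+$, positive definite ($V(0)=0$, $V(x)>0$ for $x\ne0$) and strictly decreasing along every nonconstant trajectory of the system (for every $u(\cdot)$). $m$-parameters finite-SSF for a class $C$ of systems: a subset $\mathcal{S}\subset C^0(\mathbb{R}^2,\mathbb{R})$ such that (i) there are $\Omega\subseteq\mathbb{R}^m$ and a bijective map $\Psi:\Omega\to\mathcal{S}$, and (ii) every GUES system of $C$ admits a CLF belonging to $\mathcal{S}$. With $\mathcal{K}=\frac12(E+\frac1E)>1$ fixed, for $\rho_A,\rho_B>0$ put $$\mathcal{D}(\rho_A,\rho_B)=\mathcal{K}^2+2\rho_A\rho_B\mathcal{K}-(1+\rho_A^2+\rho_B^2),$$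 and, when $\mathcal{D}>0$, $$\rho_{CC}(\rho_A,\rho_B)=\exp\Big[-\rho_A\arctan\Big(\tfrac{-\rho_A\mathcal{K}+\rho_B}{\sqrt{\mathcal{D}}}\Big)-\rho_B\arctan\Big(\tfrac{\rho_A-\rho_B\mathcal{K}}{\sqrt{\mathcal{D}}}\Big)-\tfrac{\pi}{2}(\rho_A+\rho_B)\Big]\sqrt{\frac{(\rho_A\rho_B+\mathcal{K})+\sqrt{\mathcal{D}}}{(\rho_A\rho_B+\mathcal{K})-\sqrt{\mathcal{D}}}}.$$ It is known that, for a pair of the form $A=\begin{pmatrix}-\rho_A & -1/E \\ E & -\rho_A\end{pmatrix}$, $B=\begin{pmatrix}-\rho_B & -1 \\ 1 & -\rho_B\end{pmatrix}$ with $\rho_A,\rho_B>0$, $E>1$ and $\mathcal{D}>0$, the system is GUES if and only if $\rho_{CC}<1$. Worst trajectory of a pair $\tilde A=\begin{pmatrix}-\tilde\rho_A & -1/E \\ E & -\tilde\rho_A\end{pmatrix}$, $\tilde B=\begin{pmatrix}-\tilde\rho_B & -1 \\ 1 & -\tilde\rho_B\end{pmatrix}$ (with $\tilde\rho_A,\tilde\rho_B>0$, $E>1$ and $\mathcal{D}(\tilde\rho_A,\tilde\rho_B)>0$), starting at $x_0\neq0$: the trajectory $\gamma$ of the switched system such that at each time $\dot\gamma(t)$ is that vector among $\tilde A\gamma(t),\tilde B\gamma(t)$ forming the smallest angle (in absolute value) with the exiting radial direction $\gamma(t)$; switchings occur on the two lines $\{x:\det(\tilde Ax,\tilde Bx)=0\}$,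 where the two vectors are parallel with the same direction. *)

(* Defs.v *)
From HB Require Import structures.
From mathcomp Require Import all_boot all_order all_algebra.
From mathcomp.real_closed Require Import complex.
From mathcomp Require Import all_classical all_reals all_analysis.
Set Implicit Arguments.
Unset Strict Implicit.
Unset Printing Implicit Defensive.
Import Order.TTheory GRing.Theory Num.Theory.
Import numFieldNormedType.Exports.
Local Open Scope classical_set_scope.
Local Open Scope ring_scope.

Section Defs.
Variable R : realType.

Definition mx2 (a b c d : R) : 'M[R]_2 :=
  \matrix_(i, j) if i == 0 then (if j == 0 then a else b)
                 else (if j == 0 then c else d).

Definition vec2 (a b : R) : 'cV[R]_2 := \col_i (if i == 0 then a else b).

Definition dotv (v w : 'cV[R]_2) : R := v 0 0 * w 0 0 + v 1 0 * w 1 0.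

(* The norm the library puts on matrices is the sup norm; this one is the
   Euclidean norm, as needed for angles and polar coordinates. *)
Definition enorm (v : 'cV[R]_2) : R := Num.sqrt (dotv v v).

(* Absolute value, in [0, pi], of the angle between two nonzero vectors. *)
Definition abs_angle (v w : 'cV[R]_2) : R :=
  acos (dotv v w / (enorm v * enorm w)).

Definition hurwitz (A : 'M[R]_2) : Prop :=
  forall z : R[i], eigenvalue (map_mx (real_complex R) A) z ->
  complex.Re z < 0.

Definition system : Type := ('M[R]_2 * 'M[R]_2)%type.

Definition Xi : set system := [set S | hurwitz S.1 /\ hurwitz S.2].

(* Borel measurability. A Lebesgue measurable u with values in [0, 1] agrees
   almost everywhere with a Borel one, which has the same trajectories. *)
Definition switching_signal (u : R -> R) : Prop :=
  measurable_fun (`[0, +oo[ : set R) u /\ forall t, 0 <= t -> 0 <= u t <= 1.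

(* Caratheodory solutions on [0, +oo[ of x' = u(t) A x + (1 - u(t)) B x, in
   integral form. Only the values of u and x on [0, +oo[ matter. *)
Definition trajectory (S : system) (u : R -> R) (x : R -> 'cV[R]_2) : Prop :=
  {within `[0, +oo[, continuous x} /\
  forall t i, 0 <= t ->
    x t i 0 = x 0 i 0 + \int[lebesgue_measure]_(s in `[0, t])
      (u s *: (S.1 *m x s) + (1 - u s) *: (S.2 *m x s)) i 0.

Definition gues (S : system) : Prop :=
  exists M lambda : R, [/\ 0 < M, 0 < lambda &
    forall u x, switching_signal u -> trajectory S u x ->
    forall t, 0 < t -> enorm (x t) <= M * expR (- lambda * t) * enorm (x 0)].

Definition clf (S : system) (V : 'cV[R]_2 -> R) : Prop :=
  [/\ continuous V, V 0 = 0, (forall x, x != 0 -> 0 < V x) &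
    forall u x, switching_signal u -> trajectory S u x ->
    (exists2 t, 0 <= t & x t != x 0) ->
    forall s t, 0 <= s -> s < t -> V (x t) < V (x s)].

Definition finite_ssf (m : nat) (C : set system)
    (F : set ('cV[R]_2 -> R)) : Prop :=
  [/\ (forall V, F V -> continuous V),
      (exists (Omega : set 'rV[R]_m) (Psi : 'rV[R]_m -> ('cV[R]_2 -> R)),
         set_bij Omega F Psi) &
      (forall S, C S -> gues S -> exists2 V, F V & clf S V)].

Definition kappa (E : R) : R := (E + E^-1) / 2.

Definition calD (K rA rB : R) : R :=
  K ^+ 2 + 2 * rA * rB * K - (1 + rA ^+ 2 + rB ^+ 2).

Definition rhoCC (K rA rB : R) : R :=
  let d := Num.sqrt (calD K rA rB) in
  expR (- rA * atan ((- rA * K + rB) / d)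
        - rB * atan ((rA - rB * K) / d)
        - pi / 2 * (rA + rB))
  * Num.sqrt (((rA * rB + K) + d) / ((rA * rB + K) - d)).

Definition nfA (E rA : R) : 'M[R]_2 := mx2 (- rA) (- E^-1) E (- rA).
Definition nfB (rB : R) : 'M[R]_2 := mx2 (- rB) (- 1) 1 (- rB).
Definition nf (E rA rB : R) : system := (nfA E rA, nfB rB).

Definition nf_params (E rA rB : R) : Prop :=
  [/\ 1 < E, 0 < rA, 0 < rB & 0 < calD (kappa E) rA rB].

(* A trajectory whose velocity at time t is A gamma(t) (when u t = 1) or
   B gamma(t) (when u t = 0), whichever makes the smallest absolute angle with
   gamma(t). The choice is free only where the angles are equal; for the pairs
   considered both vectors turn counterclockwise, so these are the points of
   the lines det(Ax, Bx) = 0, where the two vectors are parallel with the same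
   direction. *)
Definition worst_trajectory (S : system) (gamma : R -> 'cV[R]_2) : Prop :=
  gamma 0 != 0 /\
  exists u, [/\ switching_signal u, trajectory S u gamma &
    forall t, 0 <= t ->
      let angleA := abs_angle (S.1 *m gamma t) (gamma t) in
      let angleB := abs_angle (S.2 *m gamma t) (gamma t) in
      (u t = 1 /\ angleA <= angleB) \/ (u t = 0 /\ angleB <= angleA)].

Definition closed_trajectory (gamma : R -> 'cV[R]_2) : Prop :=
  exists2 T, 0 < T & forall t, 0 <= t -> gamma (t + T) = gamma t.

Definition polar (r alpha : R) : 'cV[R]_2 :=
  vec2 (r * cos alpha) (r * sin alpha).

(* r = rt alpha is the equation in polar coordinates of the curve gamma. *)
Definition polar_equation (gamma : R -> 'cV[R]_2) (rt : R -> R) : Prop :=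
  forall alpha, 0 < rt alpha /\
    forall r, 0 < r ->
      ((exists2 t, 0 <= t & gamma t = polar r alpha) <-> r = rt alpha).

(* The angular polar coordinate in [-pi, pi]. *)
Definition polar_arg (x : 'cV[R]_2) : R :=
  if 0 <= x 1 0 then acos (x 0 0 / enorm x) else - acos (x 0 0 / enorm x).

(* The function r / rt alpha in polar coordinates, with value 0 at 0. *)
Definition polar_ratio (rt : R -> R) (x : 'cV[R]_2) : R :=
  enorm x / rt (polar_arg x).

(* V is the function built from some worst trajectory for some normal form
   with kappa E = K and rB / rA = q. *)
Definition explicit_clf (K q : R) (V : 'cV[R]_2 -> R) : Prop :=
  exists (E rA rB zeta : R) (gamma : R -> 'cV[R]_2) (rt : R -> R),
    [/\ nf_params E rA rB, rhoCC (kappa E) rA rB < 1,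
        kappa E = K & rB / rA = q] /\
    [/\ 0 < zeta < 1,
        0 < calD (kappa E) (zeta * rA) (zeta * rB) /\
        rhoCC (kappa E) (zeta * rA) (zeta * rB) = 1,
        worst_trajectory (nf E (zeta * rA) (zeta * rB)) gamma,
        polar_equation gamma rt & V = polar_ratio rt].

(* P is a linear change of coordinates y = P x which, up to multiplication of
   each matrix by a positive constant, brings S to nf E rA rB. *)
Definition brings_to_nf (S : system) (P : 'M[R]_2) (E rA rB : R) : Prop :=
  P \in unitmx /\
  exists a b : R, [/\ 0 < a, 0 < b,
    a *: (P *m S.1 *m invmx P) = nfA E rA &
    b *: (P *m S.2 *m invmx P) = nfB rB].

Definition nf_class : set system :=
  [set S | Xi S /\
     exists P E rA rB, nf_params E rA rB /\ brings_to_nf S P E rA rB].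

(* Multiplying P by a scalar changes neither P A P^-1 nor, up to a constant
   factor, a positively homogeneous V o P. Every invertible matrix is a
   positive multiple of coord_change theta a b for some theta, b and some
   a != 0 (QR decomposition), whence three parameters. *)
Definition coord_change (theta a b : R) : 'M[R]_2 :=
  mx2 (cos theta) (- sin theta) (sin theta) (cos theta) *m mx2 1 b 0 a.

(* In the next three definitions w = (K, rB / rA, theta, a, b), and V K q is
   one fixed function with explicit_clf K q (V K q). *)
Definition clf_of_params (V : R -> R -> 'cV[R]_2 -> R) (w : 'rV[R]_5) :
    'cV[R]_2 -> R :=
  fun x => V (w 0 0) (w 0 1)
             (coord_change (w 0 (inord 2)) (w 0 (inord 3)) (w 0 (inord 4))
              *m x).

Definition clf_params : set 'rV[R]_5 :=
  [set w | w 0 (inord 3) != 0 /\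
     exists E rA rB, [/\ nf_params E rA rB, rhoCC (kappa E) rA rB < 1,
       w 0 0 = kappa E & w 0 1 = rB / rA]].

Definition clf_family (V : R -> R -> 'cV[R]_2 -> R) : set ('cV[R]_2 -> R) :=
  clf_of_params V @` clf_params.

End Defs.

(* Main.v *)
Require Import Defs.
From HB Require Import structures.
From mathcomp Require Import all_boot all_order all_algebra.
From mathcomp.real_closed Require Import complex.
From mathcomp Require Import all_classical all_reals all_analysis.
From mathcomp Require Import measurable_realfun.
From mathcomp Require Import ring lra.
Import Order.TTheory GRing.Theory Num.Theory.
Import numFieldNormedType.Exports.
Local Open Scope classical_set_scope.
Local Open Scope ring_scope.
Set Implicit Arguments.
Unset Strict Implicit.
Unset Printing Implicit Defensive.

(** Part (a) is a matter of cardinality. A GUES system has a common Lyapunov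
    function, the supremum of exp(l t) |(Phi x)_i| over the transition matrices
    Phi of piecewise constant signals of duration t, and R^5 has room for one
    such function per system.

    For a pair in normal form, let p1 and p2 span the two lines on which A x and
    B x are parallel. The flow of A rotates p1 to p2 in the rescaled angle TA,
    then the flow of B rotates p2 to - k p1 in the angle TB, and
    rhoCC = exp(- (rA TA + rB TB)) k is the factor by which this half turn
    scales p1. On the sector of A, respectively B, the gauge is the homogeneous
    function constant along the arc of A, respectively B; the two pieces agree
    when rhoCC = 1, and following the other matrix decreases the gauge, as does
    any increase of the damping. Scaling the radii by zeta moves rhoCC
    continuously from a value > 1 at zeta = 0 to a value < 1 at zeta = 1, which
    gives the critical level. Its worst trajectories are level sets of the
    gauge, so r / rt alpha is a multiple of the gauge. Repeating the half turn
    shows conversely that rhoCC < 1 for a GUES pair, and that at a fixed ratio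
    rB / rA the radii of a GUES pair exceed those of the critical level. *)

(** * Real functions *)

(** The signal is only measurable, so a trajectory satisfies an integral equation and need not be
    differentiable at a given time. Estimates are therefore made on the increment of a linear
    functional over a short interval: the velocity is a convex combination of [S.1 *m x] and
    [S.2 *m x], so a bound at these two vectors bounds the increment, and an upper right Dini
    estimate makes local bounds global.

    [nfB r] is [nfA 1 r], so one family of rotations [jrot e] and of quadratic forms [Jdot e] serves
    both matrices, with e = E and e = 1.

    In the five-parameter family the function attached to K and q = rB / rA comes from some pair
    with these invariants, not from the pair under study. Injectivity of [kappa] on ]1, +oo[
    recovers E, but the critical radii have to be compared with those of the GUES pair by a separate
    argument, which runs the rotation angles of the critical pair with the damping of the given
    one. *)

Lemma real_induction (R : realType) (P : R -> Prop) (a b : R) :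
  (forall t : R, a <= t <= b -> (forall s : R, a <= s -> s < t -> P s) -> P t) ->
  (forall t : R, a <= t -> t < b -> (forall s : R, a <= s <= t -> P s) ->
     exists2 d : R, 0 < d & forall s, t < s < t + d -> P s) ->
  forall t : R, a <= t <= b -> P t.
Proof.
move=> Pleft Pright t0 /andP[at0 t0b]; apply: contrapT => nPt0.
pose A := [set s : R | a <= s <= b /\ ~ P s].
have lbA : has_lbound A by exists a => s [] /andP[].
have At0 : A t0 by split => //; rewrite at0 t0b.
(* The infimum of the failures satisfies P by the left hypothesis, and the right one then keeps
   failures away from it. *)
pose c := inf A.
have ac : a <= c by apply: lb_le_inf => [|s [] /andP[] //]; exists t0.
have ct0 : c <= t0 by exact: ge_inf.
have Pc s : a <= s -> s < c -> P s.
  move=> as_ sc; apply: contrapT => nPs.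
  have : c <= s by apply: ge_inf => //; split => //; lra.
  by rewrite leNgt sc.
have Pcc : P c by apply: Pleft => //; lra.
have ct0' : c < t0.
  by rewrite lt_neqAle ct0 andbT; apply/eqP => E; apply: nPt0; rewrite -E.
have [||s sc|d d0 Pd] := Pright c => //; first by lra.
  have [->//|nsc] := eqVneq s c; apply: Pc; lra.
have : c + d <= c.
  apply: lb_le_inf; first by exists t0.
  move=> s [] /andP[as_ sb] nPs; rewrite leNgt; apply/negP => scd.
  have cs : c <= s by apply: ge_inf => //; split => //; lra.
  apply: nPs; have [->//|nsc] := eqVneq s c; apply: Pd.
  by rewrite scd andbT lt_neqAle eq_sym nsc.
lra.
Qed.

(** Real induction against a line of arbitrarily small slope: semicontinuity from the left carries
    the bound to limits, and the nonpositive upper right Dini derivative carries it past each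
    point. *)
Lemma dini_le (R : realType) (f : R -> R) (a b : R) : a <= b ->
  (forall t : R, a < t <= b -> forall e : R, 0 < e ->
     exists2 d : R, 0 < d & forall s : R, a <= s < t -> t - d < s -> f t <= f s + e) ->
  (forall t : R, a <= t < b -> forall e : R, 0 < e ->
     exists2 d : R, 0 < d & forall h : R, 0 < h < d -> t + h <= b ->
       f (t + h) <= f t + e * h) ->
  f b <= f a.
Proof.
move=> ab lc rd; apply/ler_addgt0Pr => e e0.
(* The 1 keeps the slope defined when a = b; the total slack k (b - a) stays below e. *)
pose k := e / (b - a + 1).
have k0 : 0 < k by rewrite divr_gt0//; lra.
suff H : f b <= f a + k * (b - a).
  apply: (le_trans H); rewrite lerD2l /k mulrAC ler_pdivrMr; last by lra.
  by rewrite ler_pM2l//; lra.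
pose P t := t <= b -> f t <= f a + k * (t - a).
suff : P b by apply.
apply: (@real_induction R P a b); last by lra.
- move=> t /andP[at_ tb] IH _; have [->|nta] := eqVneq t a.
    by rewrite subrr mulr0 addr0.
  have {nta}at' : a < t by rewrite lt_neqAle eq_sym nta.
  apply/ler_addgt0Pr => g g0.
  have [|d d0 Hd] := lc t _ g g0; first by rewrite at'.
  pose s := Num.max a (t - d / 2).
  have as_ : a <= s by rewrite le_max lexx.
  have st : s < t by rewrite gt_max at'/=; lra.
  have sd : t - d < s by rewrite lt_max; apply/orP; right; lra.
  have := Hd s; rewrite as_ st => /(_ isT sd) H1.
  have := IH s as_ st (ltW (lt_le_trans st tb)).
  have : k * (s - a) <= k * (t - a) by rewrite ler_pM2l//; lra.
  lra.
- move=> t at_ tb IH; have [|d d0 Hd] := rd t _ k k0; first by rewrite at_ tb.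
  exists d => // s /andP[ts sd] sb.
  have := Hd (s - t); rewrite subrKC => /(_ _ sb) H1.
  have := IH t; rewrite at_ lexx => /(_ isT (ltW tb)).
  have : f s <= f t + k * (s - t) by apply: H1; lra.
  rewrite !mulrBr; lra.
Qed.

Lemma ord2P (i : 'I_2) : i = 0 \/ i = 1.
Proof. by case: i => -[|[|//]] ?; [left|right]; apply/val_inj. Qed.

Lemma mulmx2E (R : realType) (M : 'M[R]_2) (x : 'cV[R]_2) i :
  (M *m x) i 0 = M i 0 * x 0 0 + M i 1 * x 1 0.
Proof.
rewrite mxE !big_ord_recl big_ord0 addr0; congr (_ * _ + _ i _ * x _ _);
  exact/val_inj.
Qed.

Lemma cV2P (R : realType) (x y : 'cV[R]_2) :
  x 0 0 = y 0 0 -> x 1 0 = y 1 0 -> x = y.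
Proof.
by move=> e0 e1; apply/matrixP => i j; rewrite (ord1 j); case: (ord2P i) => ->.
Qed.

(** * Absolutely continuous functions and their increments *)

Definition velocity (R : realType) (S : system R) (u : R -> R)
    (x : R -> 'cV[R]_2) (s : R) : 'cV[R]_2 :=
  u s *: (S.1 *m x s) + (1 - u s) *: (S.2 *m x s).

(** Absolute continuity with density v. Integrability is part of the predicate so that linear
    combinations of the coordinates of a trajectory are again of this form. *)
Definition primitive_on (R : realType) (f v : R -> R) : Prop :=
  forall t : R, 0 <= t ->
    lebesgue_measure.-integrable `[0, t] (EFin \o v) /\
    f t = f 0 + \int[lebesgue_measure]_(s in `[0, t]) v s.

Lemma primitive_lin (R : realType) (f g v w : R -> R) (p q : R) :
  primitive_on f v -> primitive_on g w ->
  primitive_on (fun t => p * f t + q * g t) (fun t => p * v t + q * w t).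
Proof.
move=> fv gw t t0; have [iv ef] := fv t t0; have [iw eg] := gw t t0.
have Iv : lebesgue_measure.-integrable `[0, t] (EFin \o (fun t => p * v t)).
  by rewrite (_ : _ \o _ = (fun x => (p%:E * (v x)%:E)%E))//; exact: integrableZl.
have Iw : lebesgue_measure.-integrable `[0, t] (EFin \o (fun t => q * w t)).
  by rewrite (_ : _ \o _ = (fun x => (q%:E * (w x)%:E)%E))//; exact: integrableZl.
split.
  rewrite (_ : _ \o _ = (fun x => ((p * v x)%:E + (q * w x)%:E)%E))//.
  exact: integrableD.
rewrite RintegralD// !RintegralZl// ef eg; ring.
Qed.

(** The bound is asked on ]s, t] only: the velocity may be under control just after a time at which
    the value of the signal is arbitrary. *)
Lemma primitive_le (R : realType) (f v : R -> R) (c s t : R) :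
  primitive_on f v -> 0 <= s <= t ->
  (forall z, s < z <= t -> v z <= c) -> f t - f s <= c * (t - s).
Proof.
move=> fv /andP[s0 st] vc; have t0 := le_trans s0 st.
have [iv ef] := fv t t0; have [_ eg] := fv s s0.
rewrite ef eg.
have -> : f 0 + \int[lebesgue_measure]_(x in `[0, t]) v x -
  (f 0 + \int[lebesgue_measure]_(x in `[0, s]) v x) =
  \int[lebesgue_measure]_(x in `]s, t]) v x.
  by rewrite -(Rintegral_itvB iv) ?bnd_simp//; ring.
have sub : `]s, t] `<=` `[0, t].
  by move=> x/=; rewrite !in_itv/= => /andP[/ltW sx ->]; rewrite (le_trans s0 sx).
have fin : lebesgue_measure `]s, t]%classic = (t - s)%:E.
  rewrite lebesgue_measure_itv/= lte_fin.
  case: ltP => [_|ts]; first by rewrite -EFinB.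
  by congr EFin; lra.
apply: (@le_trans _ _ (\int[lebesgue_measure]_(x in `]s, t]) (cst c x))).
  apply: le_Rintegral => //.
  - exact: integrableS iv.
  - apply: measurable_bounded_integrable => //; first by rewrite /= fin ltry.
    exists `|c|; split; first exact: num_real.
    by move=> x cx y _ /=; exact: ltW.
rewrite Rintegral_cst// -[X in fine X]/(lebesgue_measure `]s, t]%classic) fin.
by rewrite lexx.
Qed.

Lemma primitive_ge (R : realType) (f v : R -> R) (c s t : R) :
  primitive_on f v -> 0 <= s <= t ->
  (forall z, s < z <= t -> c <= v z) -> c * (t - s) <= f t - f s.
Proof.
move=> fv st vc; have := primitive_le (primitive_lin (-1) 0 fv fv) st.
move=> /(_ (- c)) H; suff : -1 * f t + 0 * f t - (-1 * f s + 0 * f s) <= - c * (t - s) by lra.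
by apply: H => z /vc; lra.
Qed.

(** An epsilon-delta form of continuity on [0, +oo[, convenient for piecewise formulas and changes
    of time. *)
Definition cont_ge0 (R : realType) (f : R -> R) : Prop :=
  forall t : R, 0 <= t -> forall e : R, 0 < e -> exists2 d : R, 0 < d &
    forall s : R, 0 <= s -> `|s - t| < d -> `|f s - f t| < e.

Lemma within_ge0P (R : realType) (f : R -> R) :
  {within `[0, +oo[, continuous f} <-> cont_ge0 f.
Proof.
split=> cf.
- move=> t t0 e e0; have := (continuous_within_itvcyP 0 f).1 cf.
  move=> [c1 c2]; have [t_0|tn0] := eqVneq t 0.
    move/cvgrPdist_lt : c2 => /(_ e e0) [d /= d0 Hd].
    exists d => // s s0; rewrite t_0 => sd.
    rewrite distrC; have [->|sn0] := eqVneq s 0; first by rewrite subrr normr0.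
    apply: Hd; first by rewrite /= distrC.
    by rewrite lt_neqAle eq_sym sn0.
  have tp : 0 < t by rewrite lt_neqAle eq_sym tn0.
  have := c1 t; rewrite in_itv/= andbT => /(_ tp) /cvgrPdist_lt /(_ e e0).
  move=> [d /= d0 Hd]; exists d => // s s0 sd.
  by rewrite distrC; apply: Hd; rewrite /= distrC.
- apply/(continuous_within_itvcyP 0 f); split.
    move=> t; rewrite in_itv/= andbT => t0.
    apply/cvgrPdist_lt => e e0; have [d d0 Hd] := cf t (ltW t0) e e0.
    near=> s; rewrite distrC; apply: Hd.
      near: s; exists t => // y /=; rewrite ltr_distl => /andP[]; lra.
    near: s; exists d => // y /=; by rewrite distrC.
  apply/cvgrPdist_lt => e e0; have [d d0 Hd] := cf 0 (lexx _) e e0.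
  exists d => //= s sd s0; rewrite distrC; apply: Hd; first exact: ltW.
  by rewrite distrC.
Unshelve. all: by end_near. Qed.

(** * Trajectories *)

Lemma cvg_lin2 (R : realType) (T : Type) (F : set_system T) {FF : Filter F}
    (f g : T -> R) (p q a b : R) : f @ F --> a -> g @ F --> b ->
  (fun z => p * f z + q * g z) @ F --> p * a + q * b.
Proof. by move=> fa gb; apply: cvgD; apply: cvgM => //; exact: cvg_cst. Qed.

Lemma continuous_lin2 (R : realType) (p q : R) :
  continuous (fun z : 'cV[R]_2 => p * z 0 0 + q * z 1 0).
Proof.
by move=> z; apply: (cvg_lin2 (F := nbhs z)); exact: coord_continuous.
Qed.

Lemma within_comp (R : realType) (A : set R) (x : R -> 'cV[R]_2)
    (g : 'cV[R]_2 -> R) : continuous g -> {within A, continuous x} ->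
  {within A, continuous (fun s => g (x s))}.
Proof. move=> cg cx s; exact: (continuous_comp (cx s) (cg (x s))). Qed.

Lemma velocityE (R : realType) (S : system R) u x s i :
  velocity S u x s i 0 =
  u s * (S.1 i 0 * x s 0 0 + S.1 i 1 * x s 1 0) +
  (1 - u s) * (S.2 i 0 * x s 0 0 + S.2 i 1 * x s 1 0).
Proof. by rewrite -!mulmx2E /velocity !mxE. Qed.

Lemma integrable_switched (R : realType) (u f g : R -> R) (t : R) :
  switching_signal u -> 
  {within `[0, +oo[, continuous f} -> {within `[0, +oo[, continuous g} ->
  lebesgue_measure.-integrable `[0, t]
    (EFin \o (fun s => u s * f s + (1 - u s) * g s)).
Proof.
move=> [mu u01] cf cg.
have [t0|t0] := ltP t 0.
  rewrite set_itv_ge; last by rewrite bnd_simp -ltNge.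
  exact: integrable_set0.
have sub : `[0, t] `<=` (`[0, +oo[ : set R).
  by move=> s /=; rewrite !in_itv/= andbT => /andP[].
have bnd (h : R -> R) : {within `[0, +oo[, continuous h} ->
    exists M : R, forall s : R, 0 <= s <= t -> `|h s| <= M.
  move=> ch; have ch' : {within `[0, t], continuous (fun s => `|h s|)}.
    apply: continuous_subspaceW sub _ => s.
    by apply: continuous_comp; [exact: ch|exact: norm_continuous].
  have [c _ Hc] := EVT_max t0 ch'; exists (`|h c|) => s st.
  by apply: Hc; rewrite in_itv.
have [Mf Hf] := bnd _ cf; have [Mg Hg] := bnd _ cg.
have mc (h : R -> R) : {within `[0, +oo[, continuous h} ->
    measurable_fun `[0, t] h.
  move=> ch; apply: subspace_continuous_measurable_fun => //.
  exact: continuous_subspaceW sub _.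
have mu' : measurable_fun `[0, t] u by apply: measurable_funS mu.
apply: measurable_bounded_integrable => //.
- rewrite [X in (X < _)%E](_ : _ = lebesgue_measure `[0, t]%classic)//.
  by rewrite lebesgue_measure_itv/=; case: ifP => _; rewrite ?ltry// -EFinB ltry.
- apply: measurable_funD; apply: measurable_funM => //; try exact: mc.
  exact: measurable_funB.
exists (Mf + Mg); split; first exact: num_real.
move=> M ltM s /=; rewrite in_itv/= => st.
have [s0 _] := andP st; have /andP[us0 us1] := u01 s s0.
apply: le_trans (ltW ltM); apply: (le_trans (ler_normD _ _)).
rewrite !normrM (ger0_norm us0) (@ger0_norm _ (1 - u s)) ?subr_ge0//.
have := Hf s st; have := Hg s st.
have := normr_ge0 (f s); have := normr_ge0 (g s).
by move=> *; apply: lerD; rewrite -[leRHS]mul1r; apply: ler_pM => //; lra.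
Qed.

Lemma trajectory_primitive (R : realType) (S : system R) u x i :
  switching_signal u -> trajectory S u x ->
  primitive_on (fun t => x t i 0) (fun s => velocity S u x s i 0).
Proof.
move=> su [cx ix] t t0; split; last exact: ix.
rewrite (_ : (fun s => _) = (fun s => u s *
  (S.1 i 0 * x s 0 0 + S.1 i 1 * x s 1 0) + (1 - u s) *
  (S.2 i 0 * x s 0 0 + S.2 i 1 * x s 1 0))); last first.
  by apply/funext => s; rewrite velocityE.
apply: integrable_switched => //.
- exact: (within_comp (@continuous_lin2 R (S.1 i 0) (S.1 i 1)) cx).
- exact: (within_comp (@continuous_lin2 R (S.2 i 0) (S.2 i 1)) cx).
Qed.

Lemma within_coord (R : realType) (x : R -> 'cV[R]_2) :
  {within `[0, +oo[, continuous x} -> forall i, cont_ge0 (fun t => x t i 0).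
Proof.
move=> cx i; apply/within_ge0P.
exact: (within_comp (@coord_continuous _ _ _ i 0) cx).
Qed.

Definition norm1 (R : realType) (x : 'cV[R]_2) : R := `|x 0 0| + `|x 1 0|.

Lemma norm1_ge0 (R : realType) (x : 'cV[R]_2) : 0 <= norm1 x.
Proof. exact: addr_ge0. Qed.

Lemma norm1_eq0 (R : realType) (x : 'cV[R]_2) : norm1 x <= 0 -> x = 0.
Proof.
rewrite /norm1 => h; have := normr_ge0 (x 0 0); have := normr_ge0 (x 1 0) => h1 h0.
by apply: cV2P; rewrite mxE; apply/eqP; rewrite -normr_le0; lra.
Qed.

Definition entry_sum (R : realType) (S : system R) : R :=
  \sum_i \sum_j (`|S.1 i j| + `|S.2 i j|).

Lemma entry_sum_ge (R : realType) (S : system R) i j :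
  `|S.1 i j| <= entry_sum S /\ `|S.2 i j| <= entry_sum S.
Proof.
have H : `|S.1 i j| + `|S.2 i j| <= entry_sum S.
  rewrite /entry_sum (bigD1 i)//= (bigD1 j)//= -addrA lerDl.
  by apply: addr_ge0; apply: sumr_ge0 => k _; rewrite ?addr_ge0//;
    apply: sumr_ge0 => l _; rewrite addr_ge0.
by have := normr_ge0 (S.1 i j); have := normr_ge0 (S.2 i j); split; lra.
Qed.

Lemma velocity_le (R : realType) (S : system R) (u : R -> R) x (s : R) i : 0 <= u s <= 1 ->
  `|velocity S u x s i 0| <= entry_sum S * norm1 (x s).
Proof.
move=> /andP[u0 u1]; rewrite velocityE.
have H (M : 'M[R]_2) : (forall j, `|M i j| <= entry_sum S) ->
    `|M i 0 * x s 0 0 + M i 1 * x s 1 0| <= entry_sum S * norm1 (x s).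
  move=> HM; apply: (le_trans (ler_normD _ _)).
  by rewrite !normrM /norm1 mulrDr lerD// ler_wpM2r.
apply: (le_trans (ler_normD _ _)).
rewrite !normrM (ger0_norm u0) (@ger0_norm _ (1 - u s)) ?subr_ge0//.
have := H S.1 (fun j => (entry_sum_ge S i j).1).
have := H S.2 (fun j => (entry_sum_ge S i j).2).
set a := `|_|; set b := `|_|; set c := _ * _ => Ha Hb.
have : u s * b <= u s * c by rewrite ler_wpM2l.
have : (1 - u s) * a <= (1 - u s) * c by rewrite ler_wpM2l// subr_ge0.
lra.
Qed.

Lemma primitive_norm (R : realType) (f v : R -> R) (c s t : R) :
  primitive_on f v -> 0 <= s <= t ->
  (forall z, s < z <= t -> `|v z| <= c) -> `|f t - f s| <= c * (t - s).
Proof.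
move=> fv st vc; rewrite ler_norml; apply/andP; split.
  rewrite -mulNr; apply: primitive_ge fv st _ => z /vc; rewrite ler_norml.
  by move=> /andP[].
by apply: primitive_le fv st _ => z /vc; rewrite ler_norml => /andP[].
Qed.

Lemma cont_ge0_norm1 (R : realType) (z : R -> 'cV[R]_2) :
  (forall i, cont_ge0 (fun t => z t i 0)) -> cont_ge0 (fun t => norm1 (z t)).
Proof.
move=> cz t t0 e e0; have e20 : 0 < e / 2 by lra.
have [d d0 Hd] := cz 0 t t0 _ e20; have [d' d0' Hd'] := cz 1 t t0 _ e20.
exists (Num.min d d'); first by rewrite lt_min d0.
move=> s s0; rewrite lt_min => /andP[/(Hd s s0) h /(Hd' s s0) h'].
have := ler_dist_dist (z s 0 0) (z t 0 0); have := ler_dist_dist (z s 1 0) (z t 1 0).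
rewrite /norm1 => h1 h2.
have := ler_normD (`|z s 0 0| - `|z t 0 0|) (`|z s 1 0| - `|z t 1 0|).
rewrite [X in `|X| <= _](_ : _ = `|z s 0 0| + `|z s 1 0| -
  (`|z t 0 0| + `|z t 1 0|)); last by ring.
lra.
Qed.

Lemma trajectory_norm1 (R : realType) (S : system R) u x (t e : R) :
  trajectory S u x -> 0 <= t -> 0 < e -> exists2 d : R, 0 < d &
    forall s : R, 0 <= s -> `|s - t| < d -> norm1 (x s - x t) < e.
Proof.
move=> [cx _] t0 e0; have e20 : 0 < e / 2 by lra.
have [d d0 Hd] := within_coord cx 0 t0 e20.
have [d' d0' Hd'] := within_coord cx 1 t0 e20.
exists (Num.min d d'); first by rewrite lt_min d0.
move=> s s0; rewrite lt_min => /andP[/(Hd s s0) h /(Hd' s s0) h'].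
by rewrite /norm1 !mxE; lra.
Qed.

(* Gronwall on an interval so short that the Lipschitz constant of the
   integral operator is at most 1/2. *)
Lemma gronwall_zero (R : realType) (z v : R -> 'cV[R]_2) (L a b c : R) :
  (forall i, primitive_on (fun t => z t i 0) (fun t => v t i 0)) ->
  (forall i, cont_ge0 (fun t => z t i 0)) ->
  0 <= a -> a <= c <= b -> 0 <= L -> 4 * L * (b - a) <= 1 ->
  (forall (t : R) i, a < t <= b -> `|v t i 0| <= L * norm1 (z t)) ->
  z c = 0 -> forall t : R, a <= t <= b -> z t = 0.
Proof.
move=> zv cz a0 /andP[ac cb] L0 small vL zc.
have ab := le_trans ac cb.
have cn : {within `[a, b], continuous (fun t => norm1 (z t))}.
  have sub : `[a, b] `<=` (`[0, +oo[ : set R).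
    by move=> s /=; rewrite !in_itv/= andbT => /andP[/(le_trans a0)].
  apply: (continuous_subspaceW sub); apply/within_ge0P.
  exact: cont_ge0_norm1.
(* Integrating from the zero c to the maximum m of [norm1 (z t)] gives norm1 (z m) <= 2 L (b - a)
   norm1 (z m) <= norm1 (z m) / 2. *)
have [m mab Hm] := EVT_max ab cn.
move: mab; rewrite in_itv/= => /andP[am mb].
have bound i : `|z m i 0| <= L * norm1 (z m) * (b - a).
  have zci : z c i 0 = 0 by rewrite zc mxE.
  have Hv t : a < t <= b -> `|v t i 0| <= L * norm1 (z m).
    move=> /andP[at_ tb]; apply: (le_trans (vL t i _)); first by rewrite at_ tb.
    by rewrite ler_wpM2l//; apply: Hm; rewrite in_itv/= (ltW at_) tb.
  have nn : 0 <= L * norm1 (z m) by rewrite mulr_ge0 ?norm1_ge0.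
  have [cm|mc] := leP c m.
    have := primitive_norm (zv i) _ (c := L * norm1 (z m)) (s := c) (t := m).
    rewrite (le_trans a0 ac) cm zci subr0 => /(_ isT) H.
    apply: le_trans (H _) _; last by rewrite ler_wpM2l//; lra.
    by move=> t ct; apply: Hv; lra.
  have := primitive_norm (zv i) _ (c := L * norm1 (z m)) (s := m) (t := c).
  rewrite (le_trans a0 am) (ltW mc) zci sub0r normrN => /(_ isT) H.
  apply: le_trans (H _) _; last by rewrite ler_wpM2l//; lra.
  by move=> t ct; apply: Hv; lra.
have nm0 : norm1 (z m) <= 0.
  have := bound 0; have := bound 1; have := norm1_ge0 (z m).
  have : 4 * L * (b - a) * norm1 (z m) <= 1 * norm1 (z m).
    by rewrite ler_wpM2r ?norm1_ge0.
  have : norm1 (z m) = `|z m 0 0| + `|z m 1 0| by [].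
  move: (norm1 _) (`|z m 0 0|) (`|z m 1 0|) => N p q -> *; lra.
move=> t tab; apply: norm1_eq0; apply: le_trans nm0; apply: Hm.
by rewrite in_itv.
Qed.

(** The zero propagates forwards and backwards from c, in steps of the length eta at which
    [gronwall_zero] applies. *)
Lemma trajectory_zero (R : realType) (S : system R) u x (c t : R) :
  switching_signal u -> trajectory S u x -> 0 <= c -> x c = 0 ->
  0 <= t -> x t = 0.
Proof.
move=> su tx c0 xc t0.
pose L := entry_sum S + 1.
have L0 : 0 < L.
  rewrite /L ltr_wpDl// /entry_sum; apply: sumr_ge0 => i _; apply: sumr_ge0 => j _.
  exact: addr_ge0.
pose eta := (4 * L)^-1.
have eta0 : 0 < eta by rewrite invr_gt0; lra.
have step a b s : 0 <= a -> a <= s <= b -> b - a <= eta -> x s = 0 ->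
    forall r, a <= r <= b -> x r = 0.
  move=> a0 asb ba xs; apply: (@gronwall_zero _ x (velocity S u x) L a b s) => //.
  - by move=> i; exact: trajectory_primitive.
  - by apply: within_coord; case: tx.
  - exact: ltW.
  - have : 4 * L * (b - a) <= 4 * L * eta by rewrite ler_wpM2l//; lra.
    by rewrite /eta divff// gt_eqF//; lra.
  - move=> r i /andP[ar _]; apply: (le_trans (velocity_le _ _ _ _)).
      by apply: su.2; lra.
    by rewrite ler_wpM2r ?norm1_ge0// /L; lra.
suff H n : forall r, 0 <= r -> `|r - c| <= n%:R * eta -> x r = 0.
  apply: (H (Num.Def.trunc (`|t - c| / eta)).+1) => //.
  by rewrite -ler_pdivrMr//; apply/ltW/truncnS_gt.
elim: n => [|n IH] r r0.
  rewrite mul0r normr_le0 subr_eq0 => /eqP ->; exact: xc.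
rewrite -natr1 mulrDl mul1r => rc.
have [rc'|cr] := leP r c.
  pose s := Num.min c (r + eta).
  apply: (@step r (r + eta) s) => //; [|lra| |lra].
    by rewrite le_min ge_min rc' lexx orbT andbT/=; lra.
  apply: IH; first by rewrite le_min c0/=; lra.
  have : 0 <= n%:R * eta by rewrite mulr_ge0//; lra.
  move: rc; rewrite /s distrC ger0_norm ?subr_ge0// => rc.
  by case: (leP c (r + eta)) => h; rewrite distrC ger0_norm; lra.
pose s := Num.max c (r - eta).
have s0 : 0 <= s by rewrite le_max c0.
apply: (@step s r s) => //; [| |  |].
- by rewrite lexx/= ge_max (ltW cr)/=; lra.
- by rewrite /s; case: (leP c (r - eta)) => h; lra.
- apply: IH => //.
  have : 0 <= n%:R * eta by rewrite mulr_ge0//; lra.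
  move: rc; rewrite /s ger0_norm; last by rewrite subr_ge0 ltW.
  by move=> rc; case: (leP c (r - eta)) => h; rewrite ger0_norm; lra.
- by rewrite lexx andbT ge_max (ltW cr)/=; lra.
Qed.

(** * One-sided derivatives and piecewise constant signals *)

Definition right_der (R : realType) (f : R -> R) (t l : R) : Prop :=
  forall e : R, 0 < e -> exists2 d : R, 0 < d &
    forall h : R, 0 < h < d -> `|f (t + h) - f t - h * l| <= e * h.

Lemma is_derive_right_der (R : realType) (f : R -> R) (t l : R) :
  is_derive t 1 f l -> right_der f t l.
Proof.
move=> [df dl] e e0; have : (fun h => h^-1 *: (f (h *: 1 + t) - f t)) @ 0^' --> l.
  by rewrite -dl; exact: df.
move=> /cvgrPdist_le /(_ e e0) [d /= d0 Hd].
exists d => // h /andP[h0 hd].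
have := Hd h; rewrite /= sub0r normrN gtr0_norm// => /(_ hd) /(_ (lt0r_neq0 h0)).
rewrite /GRing.scale/= mulr1 (addrC h) => H.
have hn0 : h != 0 by rewrite gt_eqF.
rewrite (_ : f (t + h) - f t - h * l = - (h * (l - h^-1 * (f (t + h) - f t)))).
  by rewrite normrN normrM gtr0_norm// mulrC ler_wpM2r// ltW.
rewrite mulrBr mulVKf//; ring.
Qed.

Lemma cont_ge0D (R : realType) (f g : R -> R) :
  cont_ge0 f -> cont_ge0 g -> cont_ge0 (fun t => f t + g t).
Proof.
move=> cf cg t t0 e e0; have e20 : 0 < e / 2 by lra.
have [d d0 Hd] := cf t t0 _ e20; have [d' d0' Hd'] := cg t t0 _ e20.
exists (Num.min d d'); first by rewrite lt_min d0.
move=> s s0; rewrite lt_min => /andP[/(Hd s s0) h /(Hd' s s0) h'].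
have := ler_normD (f s - f t) (g s - g t).
rewrite [X in `|X| <= _](_ : _ = f s + g s - (f t + g t)); last by ring.
lra.
Qed.

Lemma cont_ge0N (R : realType) (f : R -> R) :
  cont_ge0 f -> cont_ge0 (fun t => - f t).
Proof.
move=> cf t t0 e e0; have [d d0 Hd] := cf t t0 _ e0; exists d => // s s0 sd.
by rewrite -opprD normrN Hd.
Qed.

Lemma cont_ge0_comp (R : realType) (f p : R -> R) :
  (forall t, 0 <= t -> 0 <= p t) -> (forall s t, `|p s - p t| <= `|s - t|) ->
  cont_ge0 f -> cont_ge0 (fun t => f (p t)).
Proof.
move=> p0 pl cf t t0 e e0; have [d d0 Hd] := cf (p t) (p0 t t0) _ e0.
by exists d => // s s0 sd; apply: Hd; [exact: p0|exact: le_lt_trans (pl s t) sd].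
Qed.

Lemma is_derive_cont_ge0 (R : realType) (f df : R -> R) :
  (forall t : R, is_derive t 1 f (df t)) -> cont_ge0 f.
Proof.
move=> fd; apply/within_ge0P; apply: continuous_subspaceT => t.
by apply: differentiable_continuous; apply/derivable1_diffP; case: (fd t).
Qed.

Lemma cvg_cV2 (R : realType) (T : Type) (F : set_system T) {FF : Filter F}
    (x : T -> 'cV[R]_2) (y : 'cV[R]_2) :
  (fun t => x t 0 0) @ F --> y 0 0 -> (fun t => x t 1 0) @ F --> y 1 0 ->
  x @ F --> y.
Proof.
move=> x0 x1.
have dec (z : 'cV[R]_2) : z = z 0 0 *: delta_mx 0 0 + z 1 0 *: delta_mx 1 0.
  by apply: cV2P; rewrite !mxE/= ?mulr1 ?mulr0 ?addr0 ?add0r.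
rewrite (dec y) (_ : x = fun t => x t 0 0 *: delta_mx 0 0 + x t 1 0 *: delta_mx 1 0).
  by apply: cvgD; apply: cvgZr_tmp.
by apply/funext => t; rewrite -dec.
Qed.

Lemma within_cV2 (R : realType) (x : R -> 'cV[R]_2) :
  (forall i, cont_ge0 (fun t => x t i 0)) -> {within `[0, +oo[, continuous x}.
Proof.
move=> cx s; apply: (@cvg_cV2 _ _ (nbhs s)).
  exact: ((within_ge0P (fun t => x t 0 0)).2 (cx 0)).
exact: ((within_ge0P (fun t => x t 1 0)).2 (cx 1)).
Qed.

(* Signals and curves for which the integral equation reduces to a one-sided
   differential equation. *)
Definition nice_trajectory (R : realType) (S : system R) (u : R -> R)
    (y : R -> 'cV[R]_2) : Prop :=
  [/\ measurable_fun setT u, (forall t : R, 0 <= t -> 0 <= u t <= 1),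
      (forall t : R, 0 <= t -> exists2 d : R, 0 < d & forall h : R, 0 < h < d -> u (t + h) = u t),
      (forall i, cont_ge0 (fun t => y t i 0)) &
      (forall (t : R) i, 0 <= t ->
         right_der (fun t => y t i 0) t (velocity S u y t i 0))].

Lemma nice_switching (R : realType) (S : system R) u y :
  nice_trajectory S u y -> switching_signal u.
Proof. by case=> mu u01 _ _ _; split => //; exact: measurable_funTS. Qed.

Lemma velocityB (R : realType) (S : system R) (u : R -> R) y z s i :
  velocity S u (fun r => y r - z r) s i 0 =
  velocity S u y s i 0 - velocity S u z s i 0.
Proof. by rewrite !velocityE !mxE; ring. Qed.

(** The integral I of the velocity has the velocity as right derivative at every time, because u is
    constant just after it. Hence y - I is continuous with zero right derivative, and the Dini lemma
    applied to it and to its opposite makes it constant. *)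
Lemma nice_trajectoryP (R : realType) (S : system R) u y :
  nice_trajectory S u y -> trajectory S u y.
Proof.
move=> ny; have su := nice_switching ny; case: ny => mu u01 ru cy dy.
have cy' := within_cV2 cy; split => // t i t0.
pose v s := velocity S u y s i 0.
pose I t := \int[lebesgue_measure]_(s in `[0, t]) v s.
have I0 : I 0 = 0 by rewrite /I set_itv1 Rintegral_set1.
have pI : primitive_on I v.
  move=> s s0; split; last by rewrite I0 add0r.
  rewrite (_ : v = fun s => u s * (S.1 i 0 * y s 0 0 + S.1 i 1 * y s 1 0) +
    (1 - u s) * (S.2 i 0 * y s 0 0 + S.2 i 1 * y s 1 0)); last first.
    by apply/funext => r; rewrite /v velocityE.
  apply: integrable_switched => //.
  - exact: (within_comp (@continuous_lin2 R (S.1 i 0) (S.1 i 1)) cy').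
  - exact: (within_comp (@continuous_lin2 R (S.2 i 0) (S.2 i 1)) cy').
have L0 : 0 <= entry_sum S.
  by apply: sumr_ge0 => k _; apply: sumr_ge0 => l _; exact: addr_ge0.
have cI : cont_ge0 I.
  move=> s s0 e e0; pose c := entry_sum S * (norm1 (y s) + 1) + 1.
  have c0 : 0 < c.
    have n0 := norm1_ge0 (y s).
    by rewrite /c ltr_wpDl// mulr_ge0//; lra.
  have [d d0 Hd] := cont_ge0_norm1 cy s0 ltr01.
  exists (Num.min d (e / c)); first by rewrite lt_min d0 divr_gt0.
  move=> r r0; rewrite lt_min => /andP[rd re].
  have Hv z : 0 <= z -> `|z - s| < d -> `|v z| <= c.
    move=> z0 zd; apply: (le_trans (velocity_le _ _ _ (u01 z z0))).
    have := Hd z z0 zd; rewrite ltr_distl => /andP[_ h].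
    have : entry_sum S * norm1 (y z) <= entry_sum S * (norm1 (y s) + 1).
      by rewrite ler_wpM2l//; lra.
    rewrite /c; lra.
  apply: (@le_lt_trans _ _ (c * `|r - s|)); last first.
    by rewrite mulrC -ltr_pdivlMr.
  move: rd; rewrite ltr_distl => /andP[rd1 rd2].
  have [rs|sr] := leP r s.
    rewrite distrC (distrC r) (ger0_norm (x := s - r)) ?subr_ge0//.
    apply: (primitive_norm pI); first by rewrite r0.
    by move=> z /andP[rz zs]; apply: Hv; [lra|rewrite ltr_distl; apply/andP; split; lra].
  rewrite (ger0_norm (x := r - s)) ?subr_ge0 ?(ltW sr)//.
  apply: (primitive_norm pI); first by rewrite s0 ltW.
  by move=> z /andP[rz zs]; apply: Hv; [lra|rewrite ltr_distl; apply/andP; split; lra].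
have rI s : 0 <= s -> right_der I s (v s).
  move=> s0 e e0; pose c := entry_sum S + 1.
  have c0 : 0 < c by rewrite /c; lra.
  have ec : 0 < e / (2 * c) by rewrite divr_gt0//; lra.
  have [d1 d10 H1] := cy 0 s s0 _ ec; have [d2 d20 H2] := cy 1 s s0 _ ec.
  have [d3 d30 H3] := ru s s0.
  exists (Num.min d1 (Num.min d2 d3)); first by rewrite !lt_min d10 d20.
  move=> h; rewrite !lt_min => /and4P[h0 hd1 hd2 hd3].
  have vz z : s < z <= s + h -> `|v z - v s| <= e.
    move=> /andP[sz zh].
    have uz : u z = u s by rewrite -(H3 (z - s)) ?subrKC//; lra.
    have -> : v z - v s = velocity S u (fun r => y r - y s) z i 0.
      by rewrite velocityB /v !velocityE uz.
    apply: (le_trans (velocity_le _ _ _ (u01 z _))); first lra.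
    have zs : `|z - s| = z - s by rewrite ger0_norm//; lra.
    have h1 : `|y z 0 0 - y s 0 0| < e / (2 * c) by apply: H1; rewrite ?zs; lra.
    have h2 : `|y z 1 0 - y s 1 0| < e / (2 * c) by apply: H2; rewrite ?zs; lra.
    have hn : norm1 (y z - y s) <= e / c.
      rewrite /norm1 !mxE (_ : e / c = e / (2 * c) + e / (2 * c)); first by lra.
      by field; rewrite gt_eqF.
    apply: (@le_trans _ _ (c * (e / c))); last by rewrite mulrC divfK// gt_eqF.
    by apply: ler_pM => //; [exact: norm1_ge0|rewrite /c; lra].
  have hs : 0 <= s <= s + h by lra.
  have U := @primitive_le _ _ _ (v s + e) _ _ pI hs.
  have D := @primitive_ge _ _ _ (v s - e) _ _ pI hs.
  have {}U : I (s + h) - I s <= (v s + e) * (s + h - s).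
    by apply: U => z /vz; rewrite ler_distl; lra.
  have {}D : (v s - e) * (s + h - s) <= I (s + h) - I s.
    by apply: D => z /vz; rewrite ler_distl; lra.
  rewrite ler_norml; apply/andP; split; lra.
have key (f : R -> R) : cont_ge0 f -> (forall s : R, 0 <= s -> right_der f s 0) ->
    f t <= f 0.
  move=> cf df; apply: dini_le => //.
  - move=> s /andP[s0 st] e e0; have [d d0 Hd] := cf s (ltW s0) e e0.
    exists d => // r /andP[r0 rs] sd.
    have := Hd r r0; rewrite ltr_distl => H.
    suff : `|f r - f s| < e by rewrite ltr_distl; lra.
    by apply: Hd => //; rewrite ltr_distl; lra.
  - move=> s /andP[s0 st] e e0; have [d d0 Hd] := df s s0 e e0.
    by exists d => // h /Hd + _; rewrite mulr0 subr0 ler_distl; lra.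
have rD s : 0 <= s -> right_der (fun t => y t i 0 - I t) s 0.
  move=> s0 e e0; have e20 : 0 < e / 2 by lra.
  have [d d0 Hd] := dy s i s0 _ e20; have [d' d0' Hd'] := rI s s0 _ e20.
  exists (Num.min d d'); first by rewrite lt_min d0.
  move=> h; rewrite lt_min => /and3P[h0 hd hd'].
  have := Hd h; have := Hd' h; rewrite h0 hd hd' => /(_ isT) a1 /(_ isT) a2.
  have := ler_normB (y (s + h) i 0 - y s i 0 - h * velocity S u y s i 0)
     (I (s + h) - I s - h * v s).
  rewrite [X in `|X| <= _](_ : _ = (y (s + h) i 0 - I (s + h)) - (y s i 0 - I s) - h * 0).
    lra.
  rewrite /v; ring.
have := key (fun t => y t i 0 - I t) (cont_ge0D (cy i) (cont_ge0N cI)) rD.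
have := key (fun t => - (y t i 0 - I t)) (cont_ge0N (cont_ge0D (cy i) (cont_ge0N cI))).
have rD' s : 0 <= s -> right_der (fun t => - (y t i 0 - I t)) s 0.
  move=> s0 e e0; have [d d0 Hd] := rD s s0 e e0; exists d => // h /Hd.
  by rewrite !mulr0 !subr0 -opprD normrN.
move=> /(_ rD'); rewrite I0.
rewrite -[X in _ = _ + X]/(I t); lra.
Qed.

(** * Flows and products of flows *)

(** The matrix exponential of t M, described by its initial value and its differential equation,
    entry by entry. *)
Definition is_flow (R : realType) (M : 'M[R]_2) (F : R -> 'M[R]_2) : Prop :=
  F 0 = 1%:M /\
  forall (t : R) i j, is_derive t 1 (fun t => F t i j) ((M *m F t) i j).

Lemma mulmx22E (R : realType) (M N : 'M[R]_2) i j :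
  (M *m N) i j = M i 0 * N 0 j + M i 1 * N 1 j.
Proof.
rewrite mxE !big_ord_recl big_ord0 addr0; congr (_ * _ + _ i _ * N _ _);
  exact/val_inj.
Qed.

Lemma flow_is_derive (R : realType) (M : 'M[R]_2) F (x : 'cV[R]_2) (t : R) i :
  is_flow M F ->
  is_derive t 1 (fun t => (F t *m x) i 0) ((M *m (F t *m x)) i 0).
Proof.
move=> [_ dF].
have d0 := dF t i 0; have d1 := dF t i 1.
rewrite (_ : (fun t => _) = (fun t => x 0 0 * F t i 0 + x 1 0 * F t i 1)); last first.
  by apply/funext => s; rewrite mulmx2E; ring.
apply: is_derive_eq; rewrite !mulmx22E !mulmx2E /GRing.scale/=.
case: (ord2P i) => ->; ring.
Qed.

(** With w ^ 2 = |dl|, the pair is cos(w t) and sin(w t) / w, or cosh(w t) and sinh(w t) / w, or 1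
    and t, according to the sign of dl. *)
Lemma cosh_sinh_exists (R : realType) (dl : R) :
  exists c s : R -> R, [/\ c 0 = 1, s 0 = 0,
    (forall t : R, is_derive t 1 c (dl * s t)) &
    (forall t : R, is_derive t 1 s (c t))].
Proof.
case: (ltgtP dl 0) => [dn|dp|->].
- pose w := Num.sqrt (- dl).
  have w0 : 0 < w by rewrite sqrtr_gt0; lra.
  have ww : w ^+ 2 = - dl by rewrite sqr_sqrtr//; lra.
  have wn0 : w != 0 by rewrite gt_eqF.
  exists (fun t => cos (w * t)), (fun t => w^-1 * sin (w * t)); split.
  + by rewrite mulr0 cos0.
  + by rewrite mulr0 sin0 mulr0.
  + move=> t.
    have dw : is_derive t 1 (fun t => w * t) w.
      by apply: is_derive_eq; rewrite /GRing.scale/= mulr1.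
    apply: is_derive_eq (is_derive1_comp (is_derive_cos (w * t)) dw) _.
    have dlE : dl = - w ^+ 2 by rewrite ww opprK.
    by rewrite {1}dlE; field.
  + move=> t.
    have dw : is_derive t 1 (fun t => w * t) w.
      by apply: is_derive_eq; rewrite /GRing.scale/= mulr1.
    have ds := is_derive1_comp (is_derive_sin (w * t)) dw.
    apply: is_derive_eq (is_deriveZ w^-1 ds) _.
    by rewrite /GRing.scale/=; field.
- pose w := Num.sqrt dl.
  have w0 : 0 < w by rewrite sqrtr_gt0; lra.
  have ww : w ^+ 2 = dl by rewrite sqr_sqrtr//; lra.
  have wn0 : w != 0 by rewrite gt_eqF.
  have de (k t : R) : is_derive t 1 (fun t => expR (k * t)) (expR (k * t) * k).
    have dw : is_derive t 1 (fun t => k * t) k.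
      by apply: is_derive_eq; rewrite /GRing.scale/= mulr1.
    exact: is_derive1_comp (is_derive_expR (k * t)) dw.
  exists (fun t => 2^-1 * expR (w * t) + 2^-1 * expR (- w * t)),
    (fun t => (2 * w)^-1 * expR (w * t) + - (2 * w)^-1 * expR (- w * t)); split.
  + by rewrite !mulr0 expR0; field.
  + by rewrite !mulr0 expR0; ring.
  + move=> t; have d1 := de w t; have d2 := de (- w) t.
    apply: is_derive_eq; rewrite /GRing.scale/= -ww; field.
    by rewrite wn0.
  + move=> t; have d1 := de w t; have d2 := de (- w) t.
    by apply: is_derive_eq; rewrite /GRing.scale/=; field.
- exists (fun=> 1), id; split => // t; last exact: is_derive_id.
  by rewrite mul0r; exact: is_derive_cst.
Qed.

(* With [N] the traceless part of [M], [N ^ 2] is scalar, so the exponential of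
   [t N] is a combination of 1 and [N]. *)
Lemma flow_exists (R : realType) (M : 'M[R]_2) : exists F, is_flow M F.
Proof.
pose tau := (M 0 0 + M 1 1) / 2.
pose dl := ((M 0 0 - M 1 1) / 2) ^+ 2 + M 0 1 * M 1 0.
have [c [s [c0 s0 dc ds]]] := cosh_sinh_exists dl.
pose F (t : R) := expR (tau * t) *: (c t *: 1%:M + s t *: (M - tau%:M)).
exists F; split.
  by rewrite /F mulr0 expR0 scale1r c0 s0 scale1r scale0r addr0.
move=> t i j.
have dw : is_derive t 1 (fun t => tau * t) tau.
  by apply: is_derive_eq; rewrite /GRing.scale/= mulr1.
have de : is_derive t 1 (fun t => expR (tau * t)) (expR (tau * t) * tau).
  exact: is_derive1_comp (is_derive_expR (tau * t)) dw.
have dct := dc t; have dst := ds t.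
rewrite (_ : (fun t => F t i j) = (fun t => expR (tau * t) *
  (c t * (i == j)%:R + s t * (M i j - tau *+ (i == j))))); last first.
  by apply/funext => r; rewrite /F !mxE.
apply: is_derive_eq; rewrite mulmx22E /F !mxE /GRing.scale/= /dl /tau.
by case: (ord2P i) => ->; case: (ord2P j) => ->; rewrite /= ?mulr1n ?mulr0n; field.
Qed.

Lemma velocity_cst (R : realType) (S : system R) (b : bool) y (t : R) i u :
  u t = b%:R ->
  velocity S u y t i 0 = ((if b then S.1 else S.2) *m y t) i 0.
Proof. by move=> ut; rewrite velocityE mulmx2E ut; case: b {ut}; rewrite /= ?mulr1n ?mulr0n; ring. Qed.

Lemma nice_flow (R : realType) (S : system R) (b : bool) F (x : 'cV[R]_2) :
  is_flow (if b then S.1 else S.2) F ->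
  nice_trajectory S (fun=> b%:R) (fun t => F t *m x).
Proof.
move=> fF; split.
- exact: measurable_cst.
- by move=> t _; case: b {fF}; rewrite ?lexx ?ler01.
- by move=> t _; exists 1.
- by move=> i; apply: is_derive_cont_ge0 => t; exact: flow_is_derive fF.
- move=> t i _; rewrite (@velocity_cst _ _ b)//.
  by apply: is_derive_right_der; exact: flow_is_derive fF.
Qed.

Lemma nice_prepend (R : realType) (S : system R) (b : bool) F (T : R)
    (x : 'cV[R]_2) u y :
  is_flow (if b then S.1 else S.2) F -> 0 <= T -> nice_trajectory S u y ->
  y 0 = F T *m x ->
  nice_trajectory S (fun t => if t < T then b%:R else u (t - T))
    (fun t => if t < T then F t *m x else y (t - T)).
Proof.
move=> fF T0 [mu u01 ru cy dy] y0.
set u' := fun t => _; set y' := fun t => _.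
have early (t h : R) : t < T -> 0 < h < T - t -> t + h < T by lra.
split.
- apply: measurable_fun_ifT; first exact: measurable_fun_ltr.
    exact: measurable_cst.
  by apply: (measurableT_comp mu); exact: measurable_funB.
- move=> t t0; rewrite /u'; case: (ltP t T) => tT.
    by case: b {fF u'}; rewrite ?lexx ?ler01.
  by apply: u01; lra.
- move=> t t0; case: (ltP t T) => tT.
    exists (T - t); first lra.
    by move=> h hT; rewrite /u' tT early.
  have tT0 : 0 <= t - T by lra.
  have [d d0 Hd] := ru _ tT0; exists d => // h hd.
  have := Hd h hd; rewrite /u' !ltNge tT/= (_ : T <= t + h) /=; last by lra.
  by rewrite addrAC.
- move=> i.
  (* Clamping time by min and max writes y' as a sum of continuous functions composed with
     1-Lipschitz changes of time; the clamped parts cancel because y 0 = F T x. *)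
  have -> : (fun t => y' t i 0) = (fun t => (F (Num.min t T) *m x) i 0 +
      (y (Num.max (t - T) 0) i 0 + - y 0 i 0)).
    apply/funext => t; rewrite /y'; case: (ltP t T) => tT.
      by rewrite (max_idPr _) ?addrN ?addr0//; lra.
    by rewrite (max_idPl _) -?y0 ?subr_ge0//; ring.
  apply: cont_ge0D.
    apply: (@cont_ge0_comp _ (fun t => (F t *m x) i 0)).
    + by move=> t t0; rewrite le_min t0.
    + move=> s t; case: (leP s T) => sT; case: (leP t T) => tT; rewrite ?subrr ?normr0//.
        by rewrite !ler0_norm ?subr_le0//; lra.
      by rewrite !ger0_norm ?subr_ge0//; lra.
    + by apply: is_derive_cont_ge0 => t; exact: flow_is_derive fF.
  apply: (@cont_ge0D _ (fun t => y (Num.max (t - T) 0) i 0) (fun=> - y 0 i 0)).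
    apply: (@cont_ge0_comp _ (fun t => y t i 0)); last exact: cy.
    + by move=> t t0; rewrite le_max lexx orbT.
    + move=> s t; case: (leP (s - T) 0) => sT; case: (leP (t - T) 0) => tT;
        rewrite ?subrr ?normr0//.
      * by rewrite !ler0_norm ?subr_le0//; lra.
      * by rewrite !ger0_norm ?subr_ge0//; lra.
      * by rewrite (_ : s - T - (t - T) = s - t)//; ring.
  by move=> t t0 e e0; exists 1 => // s _ _; rewrite subrr normr0.
- move=> t i t0; case: (ltP t T) => tT.
    have ut : u' t = b%:R by rewrite /u' tT.
    rewrite (velocity_cst _ _ _ ut) {2}/y' tT => e e0.
    have [d d0 Hd] := is_derive_right_der (flow_is_derive x t i fF) e0.
    exists (Num.min d (T - t)); first by rewrite lt_min d0 subr_gt0.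
    move=> h; rewrite lt_min => /and3P[h0 hd hT].
    by rewrite /y' tT early ?h0//; apply: Hd; rewrite h0.
  have tT0 : 0 <= t - T by lra.
  move=> e e0; have [d d0 Hd] := dy _ i tT0 e e0; exists d => // h hd.
  have := Hd h hd; rewrite !velocityE /u' /y' !ltNge tT/= (_ : T <= t + h)/=; last by lra.
  by rewrite (addrAC t).
Qed.

(** Transition matrices of piecewise constant signals of total duration t. A new arc is composed on
    the right, hence run before the others; this makes the decay of the supremum along an arc a mere
    reindexing. *)
Inductive reach (R : realType) (S : system R) : R -> 'M[R]_2 -> Prop :=
| reach0 : reach S 0 1%:M
| reachS t Phi b F s : is_flow (if b then S.1 else S.2) F -> 0 <= s ->
    reach S t Phi -> reach S (s + t) (Phi *m F s).

Lemma reach_ge0 (R : realType) (S : system R) t Phi :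
  reach S t Phi -> 0 <= t /\ (t = 0 -> Phi = 1%:M).
Proof.
elim=> [//|{}t {}Phi b F s fF s0 _ [t0 IH]]; split; first exact: addr_ge0.
move=> st; have s_0 : s = 0 by lra.
by rewrite IH ?s_0 ?fF.1 ?mulmx1//; lra.
Qed.

Lemma reach_nice (R : realType) (S : system R) t Phi (x : 'cV[R]_2) :
  reach S t Phi -> exists u y,
    [/\ nice_trajectory S u y, y 0 = x & y t = Phi *m x].
Proof.
move=> r; elim: r x => [|{}t {}Phi b F s fF s0 rt IH] x.
  have [F fF] := flow_exists S.1.
  exists (fun=> true%:R), (fun t => F t *m x); split; first exact: nice_flow.
    by rewrite fF.1 mul1mx.
  by rewrite fF.1.
have [u [y [ny y0 yt]]] := IH (F s *m x).
exists (fun t => if t < s then b%:R else u (t - s)),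
  (fun t => if t < s then F t *m x else y (t - s)); split.
- exact: nice_prepend.
- case: (ltP 0 s) => [_|s_0]; first by rewrite fF.1 mul1mx.
  have -> : s = 0 by lra.
  by rewrite subr0 y0 (_ : s = 0) ?fF.1 ?mul1mx//; lra.
- have t0 := (reach_ge0 rt).1.
  rewrite ltNge (_ : s <= s + t) /=; last by lra.
  by rewrite addrC addKr yt mulmxA.
Qed.

Lemma enorm_ge0 (R : realType) (x : 'cV[R]_2) : 0 <= enorm x.
Proof. exact: sqrtr_ge0. Qed.

Lemma gues_reach (R : realType) (S : system R) : gues S ->
  exists C lambda : R, [/\ 0 < C, 0 < lambda & forall t Phi (x : 'cV[R]_2),
    reach S t Phi -> enorm (Phi *m x) <= C * expR (- lambda * t) * enorm x].
Proof.
(* The bound in [gues] concerns t > 0 only. At t = 0 the matrix is the identity, which the constant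
   max M 1 covers. *)
move=> [M [l [M0 l0 H]]]; exists (Num.max M 1), l; split => //.
  by rewrite lt_max M0.
move=> t Phi x r; have [t0 tP] := reach_ge0 r.
have [t_0|tn0] := eqVneq t 0.
  rewrite tP// t_0 mulr0 expR0 mulr1 mul1mx ler_peMl ?enorm_ge0//.
  by rewrite le_max lexx orbT.
have [u [y [ny y0 yt]]] := reach_nice x r.
have := H u y (nice_switching ny) (nice_trajectoryP ny) t.
rewrite lt_neqAle eq_sym tn0 t0 y0 yt => /(_ isT) /le_trans; apply.
by rewrite !ler_wpM2r ?enorm_ge0 ?expR_ge0// le_max lexx.
Qed.

(** * A converse Lyapunov theorem *)

Lemma dini_cont (R : realType) (f : R -> R) (a b : R) : 0 <= a -> a <= b ->
  cont_ge0 f ->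
  (forall t : R, a <= t < b -> forall e : R, 0 < e ->
     exists2 d : R, 0 < d & forall h : R, 0 < h < d -> t + h <= b ->
       f (t + h) <= f t + e * h) ->
  f b <= f a.
Proof.
move=> a0 ab cf rd; apply: dini_le => // t /andP[at_ tb] e e0.
have [|d d0 Hd] := cf t _ e e0; first lra.
exists d => // r /andP[ar rt] td.
suff : `|f r - f t| < e by rewrite ltr_distl; lra.
by apply: Hd; [lra|rewrite ltr_distl; lra].
Qed.

(** Multiplication by exp(l t) turns the hypothesis into a nonpositive Dini derivative. The error
    term is then multiplied by at most exp(l t), whence the factor exp(- l t) in the error requested
    from the hypothesis. *)
Lemma exp_decay (R : realType) (f : R -> R) (l : R) : 0 < l -> cont_ge0 f ->
  (forall t : R, 0 <= t -> forall e : R, 0 < e ->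
     exists2 d : R, 0 < d & forall h : R, 0 < h < d ->
       f (t + h) <= expR (- l * h) * f t + e * h) ->
  forall s t : R, 0 <= s <= t -> f t <= expR (- l * (t - s)) * f s.
Proof.
move=> l0 cf rf s t /andP[s0 st].
pose g (r : R) := expR (l * r) * f r.
have cg : cont_ge0 g.
  apply/within_ge0P; have cf' := (within_ge0P f).2 cf => r.
  have ce : {within `[0, +oo[, continuous (fun r : R => expR (l * r))}.
    apply: continuous_subspaceT => z; apply: continuous_comp.
      exact: mulrl_continuous.
    exact: continuous_expR.
  exact: (cvgM (ce r) (cf' r)).
have gst : g t <= g s.
  apply: (dini_cont s0 st cg) => r /andP[sr rt] e e0.
  have e'0 : 0 < e * expR (- l * t) by rewrite mulr_gt0 ?expR_gt0.
  have [|d d0 Hd] := rf r _ _ e'0; first lra.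
  exists d => // h hd ht; have h0 : 0 < h by lra.
  rewrite /g.
  apply: (@le_trans _ _ (expR (l * (r + h)) *
    (expR (- l * h) * f r + e * expR (- l * t) * h))).
    by rewrite ler_wpM2l ?expR_ge0// Hd.
  rewrite mulrDr !mulrA -expRD (_ : l * (r + h) + - l * h = l * r); last ring.
  rewrite lerD2l ler_wpM2r ?(ltW h0)// mulrAC -expRD ler_piMl ?(ltW e0)//.
  rewrite -expR0 ler_expR.
  have : l * (r + h) <= l * t by rewrite ler_wpM2l// ltW.
  lra.
have <- : expR (- l * t) * g t = f t.
  by rewrite /g mulrA -expRD (_ : - l * t + l * t = 0) ?expR0 ?mul1r//; ring.
rewrite (_ : expR (- l * (t - s)) * f s = expR (- l * t) * g s).
  by rewrite ler_wpM2l ?expR_ge0.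
by rewrite /g mulrA -expRD; congr (expR _ * _); ring.
Qed.

Lemma coord_le_enorm (R : realType) (x : 'cV[R]_2) i : `|x i 0| <= enorm x.
Proof.
rewrite -sqrtr_sqr /enorm ler_wsqrtr// /dotv -!expr2.
by case: (ord2P i) => ->; [rewrite lerDl|rewrite lerDr]; exact: sqr_ge0.
Qed.

Lemma enorm_le_norm1 (R : realType) (x : 'cV[R]_2) : enorm x <= norm1 x.
Proof.
rewrite -[leRHS]ger0_norm ?norm1_ge0// -sqrtr_sqr /enorm ler_wsqrtr//.
rewrite /norm1 /dotv sqrrD !real_normK ?num_real// -!expr2.
by rewrite lerD2r lerDl mulrn_wge0// mulr_ge0.
Qed.

Lemma norm1_mulmx (R : realType) (S : system R) (M : 'M[R]_2) (x : 'cV[R]_2) :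
  M = S.1 \/ M = S.2 -> norm1 (M *m x) <= 2 * entry_sum S * norm1 x.
Proof.
move=> MS.
have HM i j : `|M i j| <= entry_sum S.
  by have [h1 h2] := entry_sum_ge S i j; case: MS => ->.
have H i : `|(M *m x) i 0| <= entry_sum S * norm1 x.
  rewrite mulmx2E; apply: (le_trans (ler_normD _ _)).
  by rewrite !normrM /norm1 mulrDr lerD// ler_wpM2r.
by have := H 0; have := H 1; rewrite {3}/norm1; lra.
Qed.

Lemma entry_sum_ge0 (R : realType) (S : system R) : 0 <= entry_sum S.
Proof. by apply: sumr_ge0 => k _; apply: sumr_ge0 => l _; exact: addr_ge0. Qed.

Lemma trajectory_nonzero (R : realType) (S : system R) u x :
  switching_signal u -> trajectory S u x ->
  (exists2 t, 0 <= t & x t != x 0) -> forall s : R, 0 <= s -> x s != 0.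
Proof.
move=> su tx [t t0 xt] s s0; apply/eqP => xs; move/eqP: xt; apply.
by rewrite !(trajectory_zero su tx s0 xs).
Qed.

Lemma nbhs_norm1 (R : realType) (x : 'cV[R]_2) (e : R) : 0 < e ->
  \forall y \near x, norm1 (x - y) < e.
Proof.
move=> e0; have e20 : 0 < e / 2 by lra.
have FF := nbhs_filter x.
have c0 := (@cvgrPdist_lt _ _ _ (nbhs x) _ _ _).1 (@coord_continuous R 2 1 0 0 x) _ e20.
have c1 := (@cvgrPdist_lt _ _ _ (nbhs x) _ _ _).1 (@coord_continuous R 2 1 1 0 x) _ e20.
apply: (@filterS2 _ _ FF _ _ _ _ (c0 FF) (c1 FF)) => y h0 h1.
by rewrite /norm1 !mxE; lra.
Qed.

Lemma continuous_norm1 (R : realType) (f : 'cV[R]_2 -> R) :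
  (forall x (e : R), 0 < e -> exists2 d : R, 0 < d &
     forall y, norm1 (x - y) < d -> `|f x - f y| < e) -> continuous f.
Proof.
move=> H x; have FF := nbhs_filter x.
apply/(@cvgrPdist_lt _ _ _ (nbhs x)) => e e0; have [d d0 Hd] := H x e e0.
by apply: (@filterS _ _ FF _ _ _ (nbhs_norm1 x d0)) => y /Hd.
Qed.

Section ConverseLyapunov.
Variables (R : realType) (S : system R) (C l : R).
Hypotheses (C0 : 0 < C) (l0 : 0 < l).
Hypothesis reachC : forall t Phi (x : 'cV[R]_2), reach S t Phi ->
  enorm (Phi *m x) <= C * expR (- l * t) * enorm x.

(** The weight exp(l t) keeps each value below C |x| and gives the supremum the decay rate l. Taking
    coordinates instead of a norm makes it a supremum of linear functionals up to sign. *)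
Definition reach_values (x : 'cV[R]_2) : set R :=
  [set r | exists t Phi i,
     reach S t Phi /\ r = expR (l * t) * `|(Phi *m x) i 0|].

Definition reach_sup (x : 'cV[R]_2) : R := sup (reach_values x).

Lemma reach_values_le x r : reach_values x r -> r <= C * enorm x.
Proof.
move=> [t [Phi [i [rt ->]]]].
apply: (@le_trans _ _ (expR (l * t) * (C * expR (- l * t) * enorm x))).
  rewrite ler_wpM2l ?expR_ge0//; exact: le_trans (coord_le_enorm _ _) (reachC _ rt).
rewrite (_ : _ * _ = expR (l * t) * expR (- l * t) * (C * enorm x)); last by ring.
by rewrite -expRD (_ : l * t + - l * t = 0) ?expR0 ?mul1r//; ring.
Qed.

Lemma reach_values_sup x : has_sup (reach_values x).
Proof.
split; last by exists (C * enorm x) => r /reach_values_le.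
by exists (expR (l * 0) * `|(1%:M *m x) 0 0|), 0, 1%:M, 0; split => //; exact: reach0.
Qed.

Lemma reach_sup_ge (x : 'cV[R]_2) t Phi i :
  reach S t Phi -> expR (l * t) * `|(Phi *m x) i 0| <= reach_sup x.
Proof.
move=> rt; apply: ub_le_sup; first by case: (reach_values_sup x).
by exists t, Phi, i.
Qed.

Lemma reach_sup_le x c : (forall t Phi i, reach S t Phi ->
  expR (l * t) * `|(Phi *m x) i 0| <= c) -> reach_sup x <= c.
Proof.
move=> H; apply: ge_sup; first by case: (reach_values_sup x).
by move=> _ [t [Phi [i [rt ->]]]]; exact: H.
Qed.

Lemma reach_sup_coord (x : 'cV[R]_2) i : `|x i 0| <= reach_sup x.
Proof.
by have := reach_sup_ge x i (reach0 S); rewrite mulr0 expR0 mul1r mul1mx.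
Qed.

Lemma reach_sup_bound x : reach_sup x <= C * enorm x.
Proof.
by apply: reach_sup_le => t Phi i rt; apply: reach_values_le; exists t, Phi, i.
Qed.

Lemma reach_supD x y : reach_sup x <= reach_sup y + C * norm1 (x - y).
Proof.
apply: reach_sup_le => t Phi i rt.
apply: (@le_trans _ _ (expR (l * t) * `|(Phi *m y) i 0| +
    expR (l * t) * `|(Phi *m (x - y)) i 0|)).
  rewrite -mulrDr ler_wpM2l ?expR_ge0// mulmxBr !mxE.
  by apply: le_trans (ler_normD _ _); rewrite subrKC.
apply: lerD; first exact: reach_sup_ge.
apply: le_trans (reach_sup_ge _ _ rt) _; apply: le_trans (reach_sup_bound _) _.
by rewrite ler_wpM2l ?(ltW C0)// enorm_le_norm1.
Qed.

Lemma reach_sup_flow (b : bool) F x s :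
  is_flow (if b then S.1 else S.2) F -> 0 <= s ->
  reach_sup (F s *m x) <= expR (- l * s) * reach_sup x.
Proof.
move=> fF s0; apply: reach_sup_le => t Phi i rt.
have := reach_sup_ge x i (reachS fF s0 rt); rewrite mulmxA => H.
rewrite (_ : expR (l * t) = expR (- l * s) * expR (l * (s + t))).
  by rewrite -mulrA ler_wpM2l ?expR_ge0.
by rewrite -expRD; congr expR; ring.
Qed.

Lemma reach_sup_continuous : continuous reach_sup.
Proof.
apply: continuous_norm1 => x e e0; exists (e / C); first exact: divr_gt0.
move=> y; rewrite ltr_pdivlMr// mulrC => hn.
have hs : norm1 (y - x) = norm1 (x - y) by rewrite /norm1 !mxE distrC (distrC (y 1 0)).
have := reach_supD x y; have := reach_supD y x; rewrite hs => h2 h3.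
by rewrite ltr_distl; lra.
Qed.

(** The supremum runs over piecewise constant signals, but its decrease is needed along a measurable
    one. Each signed functional g in it is linear, so over [t, t + h] its increment is at most h
    times its larger value on the two velocities frozen at x t, up to o(h). The point x t + h M x t
    is o(h) away from the end of the flow of M, where the supremum has already decayed by exp(- l
    h). All the g have Lipschitz constant C, so the o(h) is uniform. *)
Lemma reach_sup_local u x (t : R) : switching_signal u -> trajectory S u x ->
  0 <= t -> forall e : R, 0 < e -> exists2 d : R, 0 < d &
    forall h : R, 0 < h < d ->
      reach_sup (x (t + h)) <= expR (- l * h) * reach_sup (x t) + e * h.
Proof.
move=> su tx t0 e e0.
have [F1 fF1] := flow_exists S.1; have [F2 fF2] := flow_exists S.2.
have L0 := entry_sum_ge0 S; set L := entry_sum S in L0.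
have D0 : 0 < 2 * C * L + 1 by rewrite ltr_wpDl// mulr_ge0// mulr_ge0// ltW.
(* Radius within which replacing x z by x t changes a functional g of a velocity by at most e /
   2. *)
have k0 : 0 < e / 2 / (2 * C * L + 1) by rewrite !divr_gt0.
have [d2 d20 H2] := trajectory_norm1 tx t0 k0.
(* Two coordinates with error e / (4 C) each, times the Lipschitz constant C, give the other e /
   2. *)
have k'0 : 0 < e / (4 * C) by rewrite divr_gt0// mulr_gt0.
have FR F M (fF : is_flow M F) : exists2 d : R, 0 < d & forall h : R, 0 < h < d ->
    C * norm1 (F h *m x t - (x t + h *: (M *m x t))) <= e / 2 * h.
  have R0 := is_derive_right_der (flow_is_derive (x t) 0 0 fF) k'0.
  have R1 := is_derive_right_der (flow_is_derive (x t) 0 1 fF) k'0.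
  case: R0 => g0 g00 G0; case: R1 => g1 g10 G1.
  exists (Num.min g0 g1); first by rewrite lt_min g00.
  move=> h; rewrite lt_min => /and3P[h0 hg0 hg1].
  have := G0 h; have := G1 h; rewrite h0 hg0 hg1 !add0r => /(_ isT) b1 /(_ isT) b0.
  move: b0 b1; rewrite fF.1 !mul1mx.
  have E i : (F h *m x t) i 0 - x t i 0 - h * (M *m x t) i 0 =
      (F h *m x t - (x t + h *: (M *m x t))) i 0.
    by rewrite !mxE opprD addrA.
  rewrite !E => b0 b1.
  apply: (@le_trans _ _ (C * (e / (2 * C) * h))).
    rewrite ler_wpM2l ?(ltW C0)// /norm1.
    rewrite (_ : e / (2 * C) = e / (4 * C) + e / (4 * C)); first lra.
    by field; rewrite gt_eqF.
  by rewrite le_eqVlt; apply/orP; left; apply/eqP; field; rewrite gt_eqF.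
have [d3 d30 H3] := FR F1 S.1 fF1; have [d4 d40 H4] := FR F2 S.2 fF2.
exists (Num.min d2 (Num.min d3 d4)); first by rewrite !lt_min d20 d30.
move=> h; rewrite !lt_min => /and4P[h0 hd2 hd3 hd4].
apply: reach_sup_le => tau Phi i rt.
pose a := expR (l * tau) * Phi i 0; pose b := expR (l * tau) * Phi i 1.
(* The sign sg = 1 or -1 stands for the absolute value and leaves a linear function of z. *)
pose g (sg : R) (z : 'cV[R]_2) := sg * a * z 0 0 + sg * b * z 1 0.
have gE sg z : g sg z = sg * (expR (l * tau) * (Phi *m z) i 0).
  by rewrite /g mulmx2E /a /b; ring.
have gV sg z : `|sg| = 1 -> g sg z <= reach_sup z.
  move=> s1; rewrite gE; apply: le_trans (ler_norm _) _.
  rewrite normrM s1 mul1r normrM ger0_norm ?expR_ge0//; exact: reach_sup_ge.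
have gn sg z : `|sg| = 1 -> g sg z <= C * norm1 z.
  move=> s1; apply: le_trans (gV _ _ s1) _; apply: le_trans (reach_sup_bound _) _.
  by rewrite ler_wpM2l ?(ltW C0)// enorm_le_norm1.
have gB sg y z : g sg y = g sg z + g sg (y - z) by rewrite /g !mxE; ring.
suff key sg : `|sg| = 1 -> g sg (x (t + h)) <=
    expR (- l * h) * reach_sup (x t) + e * h.
  have := key 1 (normr1 _); have := key (-1); rewrite normrN1 => /(_ erefl).
  rewrite !gE !mul1r mulN1r => k1 k2.
  by rewrite -[X in X * _](ger0_norm (expR_ge0 (l * tau))) -normrM ler_norml; lra.
move=> s1.
pose m := Num.max (g sg (S.1 *m x t)) (g sg (S.2 *m x t)).
have pg := primitive_lin (sg * a) (sg * b) (trajectory_primitive 0 su tx)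
  (trajectory_primitive 1 su tx).
have step : g sg (x (t + h)) - g sg (x t) <= (m + e / 2) * (t + h - t).
  apply: (primitive_le pg); first lra.
  move=> z /andP[tz zh]; rewrite -/(g sg (velocity S u x z)).
  have /andP[u0 u1] : 0 <= u z <= 1 by apply: su.2; lra.
  have gM M : M = S.1 \/ M = S.2 -> g sg (M *m x t) <= m ->
      g sg (M *m x z) <= m + e / 2.
    move=> MS Mm; rewrite (gB _ (M *m x z) (M *m x t)) lerD// -mulmxBr.
    apply: le_trans (gn _ _ s1) _.
    have n1 := norm1_mulmx (x z - x t) MS.
    have n2 : norm1 (x z - x t) <= e / 2 / (2 * C * L + 1).
      by apply/ltW/H2; [lra|rewrite ger0_norm; lra].
    apply: (@le_trans _ _ (C * (2 * L * (e / 2 / (2 * C * L + 1))))).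
      rewrite ler_wpM2l ?(ltW C0)//; apply: le_trans n1 _.
      by rewrite ler_wpM2l// mulr_ge0.
    rewrite (_ : C * _ = e / 2 * ((2 * C * L) / (2 * C * L + 1))); last first.
      by field; rewrite gt_eqF.
    rewrite ler_piMr//; first lra.
    by rewrite ler_pdivrMr// mul1r lerDl.
  have g1 := gM S.1 (or_introl erefl); have g2 := gM S.2 (or_intror erefl).
  have {}g1 : g sg (S.1 *m x z) <= m + e / 2 by apply: g1; rewrite le_max lexx.
  have {}g2 : g sg (S.2 *m x z) <= m + e / 2 by apply: g2; rewrite le_max lexx orbT.
  have -> : g sg (velocity S u x z) =
     u z * g sg (S.1 *m x z) + (1 - u z) * g sg (S.2 *m x z).
    by rewrite /g !velocityE !mulmx2E; ring.
  have : u z * g sg (S.1 *m x z) <= u z * (m + e / 2) by rewrite ler_wpM2l.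
  have : (1 - u z) * g sg (S.2 *m x z) <= (1 - u z) * (m + e / 2).
    by rewrite ler_wpM2l// subr_ge0.
  lra.
have fin (bb : bool) F : is_flow (if bb then S.1 else S.2) F ->
    C * norm1 (F h *m x t - (x t + h *: ((if bb then S.1 else S.2) *m x t))) <= e / 2 * h ->
    g sg (x t) + h * g sg ((if bb then S.1 else S.2) *m x t) <=
    expR (- l * h) * reach_sup (x t) + e / 2 * h.
  move=> fF Hn.
  have -> : g sg (x t) + h * g sg ((if bb then S.1 else S.2) *m x t) =
      g sg (x t + h *: ((if bb then S.1 else S.2) *m x t)).
    by rewrite /g !mxE; ring.
  rewrite (gB _ _ (F h *m x t)) lerD//.
    by apply: le_trans (gV _ _ s1) _; apply: reach_sup_flow fF _; exact: ltW.
  apply: le_trans (gn _ _ s1) _; apply: le_trans Hn.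
  by rewrite /norm1 !mxE distrC [X in _ * (_ + X) <= _]distrC.
have f1 := fin true F1 fF1 (H3 h _); have f2 := fin false F2 fF2 (H4 h _).
rewrite h0 hd3 in f1; rewrite h0 hd4 in f2.
have {}f1 := f1 isT; have {}f2 := f2 isT; rewrite /= in f1 f2.
have hm : g sg (x t) + h * m <= expR (- l * h) * reach_sup (x t) + e / 2 * h.
  by rewrite /m; case: (leP (g sg (S.1 *m x t))).
lra.
Qed.

Lemma reach_sup_clf : clf S reach_sup.
Proof.
split.
- exact: reach_sup_continuous.
- apply/eqP; rewrite eq_le; apply/andP; split.
    apply: le_trans (reach_sup_bound _) _.
    by rewrite /enorm /dotv !mxE mulr0 addr0 sqrtr0 mulr0.
  exact: le_trans (reach_sup_coord _ 0).
- move=> x x0; rewrite lt_neqAle; apply/andP; split; last first.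
    exact: le_trans (reach_sup_coord _ 0).
  apply/eqP => V0; move/eqP: x0; apply; apply: norm1_eq0; rewrite /norm1.
  by have := reach_sup_coord x 0; have := reach_sup_coord x 1; rewrite -V0; lra.
- move=> u x su tx nc s t s0 st.
  have Vs : 0 < reach_sup (x s).
    have := trajectory_nonzero su tx nc s0 => xs.
    rewrite lt_neqAle; apply/andP; split; last exact: le_trans (reach_sup_coord _ 0).
    apply/eqP => V0; move/eqP: xs; apply; apply: norm1_eq0; rewrite /norm1.
    by have := reach_sup_coord (x s) 0; have := reach_sup_coord (x s) 1; rewrite -V0; lra.
  have cV : cont_ge0 (fun r => reach_sup (x r)).
    by apply/within_ge0P; exact: within_comp reach_sup_continuous tx.1.
  have := exp_decay l0 cV (fun r r0 => reach_sup_local su tx r0) (s := s) (t := t).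
  rewrite s0 (ltW st) => /(_ isT) /le_lt_trans; apply.
  rewrite gtr_pMl// -expR0 ltr_expR mulNr oppr_lt0 mulr_gt0// subr_gt0//.
Qed.

End ConverseLyapunov.

Lemma gues_clf (R : realType) (S : system R) : gues S -> exists V, clf S V.
Proof.
move=> /gues_reach [C [l [C0 l0 H]]]; exists (reach_sup S l).
exact: reach_sup_clf C0 l0 H.
Qed.

(** * Cardinality *)

(** Choosing one preimage for each value turns any parametrization into the bijective one that a
    finite-SSF asks for. *)
Lemma image_section (T U : Type) (x0 : T) (f : T -> U) (A : set T) :
  exists2 B : set T, B `<=` A & set_bij B (f @` A) f.
Proof.
have [g gP] : exists g : U -> T, forall y, (f @` A) y -> A (g y) /\ f (g y) = y.
  have /choice[g gP] : forall y, exists x, (f @` A) y -> A x /\ f x = y.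
    move=> y; have [[x Ax fx]|nAy] := pselect ((f @` A) y); first by exists x.
    by exists x0.
  by exists g.
exists (g @` (f @` A)); first by move=> _ [y Ay <-]; exact: (gP y Ay).1.
split.
- by move=> _ [y Ay <-]; rewrite (gP y Ay).2.
- move=> _ _ /set_mem[y Ay <-] /set_mem[z Az <-].
  by rewrite (gP y Ay).2 (gP z Az).2 => ->.
- by move=> y Ay; exists (g y); [exists y|exact: (gP y Ay).2].
Qed.

(** * An injection of binary sequences into the reals *)

Section Ternary.
Variable R : realType.

Definition ternary_sum (b : nat -> bool) (n : nat) : R :=
  \sum_(k < n) (b k)%:R * 3^-1 ^+ k.

Lemma ternary_sumS b n :
  ternary_sum b n.+1 = ternary_sum b n + (b n)%:R * 3^-1 ^+ n.
Proof. by rewrite /ternary_sum big_ord_recr. Qed.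

Lemma ternary_sum_le b n j : ternary_sum b (n + j) <=
  ternary_sum b n + 3 / 2 * (3^-1 ^+ n - 3^-1 ^+ (n + j)).
Proof.
elim: j => [|j IH]; first by rewrite addn0 subrr mulr0 addr0.
rewrite addnS ternary_sumS exprS.
have p0 : 0 <= (3^-1 : R) ^+ (n + j) by rewrite exprn_ge0// invr_ge0.
have : (b (n + j)%N)%:R * 3^-1 ^+ (n + j) <= (3^-1 : R) ^+ (n + j).
  by rewrite ler_piMl// lern1 leq_b1.
move: IH p0; move: (ternary_sum b (n + j)) (ternary_sum b n) (3^-1 ^+ (n + j)) => u v w.
move: (3^-1 ^+ n) (_ * w) => p q; lra.
Qed.

Lemma ternary_sum_homo b m n : (m <= n)%N -> ternary_sum b m <= ternary_sum b n.
Proof.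
move=> /subnKC <-; elim: (n - m)%N => [|j IH]; first by rewrite addn0.
rewrite addnS ternary_sumS; apply: le_trans IH _.
by rewrite lerDl mulr_ge0// exprn_ge0// invr_ge0.
Qed.

Lemma ternary_sum_ub b n m :
  ternary_sum b m <= ternary_sum b n + 3 / 2 * 3^-1 ^+ n.
Proof.
have [mn|/ltnW nm] := leqP m n.
  apply: le_trans (ternary_sum_homo b mn) _.
  by rewrite lerDl mulr_ge0// ?exprn_ge0// ?invr_ge0// divr_ge0.
rewrite -(subnKC nm); apply: le_trans (ternary_sum_le _ _ _) _.
rewrite lerD2l ler_wpM2l ?divr_ge0//.
by rewrite gerBl exprn_ge0// invr_ge0.
Qed.

Definition ternary (b : nat -> bool) : R := sup (range (ternary_sum b)).

Lemma ternary_has_sup b : has_sup (range (ternary_sum b)).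
Proof.
split; first by exists (ternary_sum b 0), 0%N.
exists (ternary_sum b 0 + 3 / 2 * 3^-1 ^+ 0) => _ [m _ <-].
exact: ternary_sum_ub.
Qed.

(** Base 3 with digits 0 and 1 has no double expansions: at the first difference n one sum gains 3 ^
    (- n), while the whole later tail of the other is at most half of that. *)
Lemma ternary_inj : injective ternary.
Proof.
have lt (a b : nat -> bool) n : (forall k, (k < n)%N -> a k = b k) -> a n -> ~~ b n ->
    ternary b < ternary a.
  move=> ab an bn.
  have E : ternary_sum a n = ternary_sum b n by apply: eq_bigr => k _; rewrite ab.
  have p0 : 0 < (3^-1 : R) ^+ n by rewrite exprn_gt0// invr_gt0.
  have ha : ternary_sum a n.+1 <= ternary a.
    by apply: ub_le_sup; [case: (ternary_has_sup a)|exists n.+1].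
  have hb : ternary b <= ternary_sum b n.+1 + 3 / 2 * 3^-1 ^+ n.+1.
    apply: ge_sup; first by case: (ternary_has_sup b).
    by move=> _ [m _ <-]; exact: ternary_sum_ub.
  move: ha hb p0; rewrite !ternary_sumS an (negbTE bn) E exprS mul1r mul0r.
  by move: (ternary_sum b n) (3^-1 ^+ n) => u p; lra.
move=> a b; apply: contra_eq => /eqP ab; have : exists n, a n != b n.
  apply: contrapT => H; apply: ab; apply/funext => n; apply/eqP.
  by apply: contrapT => /negP abn; apply: H; exists n.
move=> ex; case: (ex_minnP ex) => n abn nmin.
have abk k : (k < n)%N -> a k = b k.
  by move=> kn; apply/eqP; apply: contraTT kn => /nmin; rewrite -leqNgt.
case an : (a n); case bn : (b n); move: abn; rewrite an bn // => _.
- by rewrite gt_eqF//; apply: lt abk _ _; rewrite ?an ?bn.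
- rewrite lt_eqF//; by apply: (@lt b a n); rewrite ?an ?bn// => k /abk.
Qed.

(* A system is determined by the rationals below each entry of its matrices. *)
Definition system_code (S : system R) (n : nat) : bool :=
  if @unpickle (bool * 'I_2 * 'I_2 * rat)%type n is Some (m, i, j, q) then
    ratr q < (if m then S.1 else S.2) i j
  else false.

Lemma system_code_inj : injective system_code.
Proof.
have real_code (x y : R) : (forall q : rat, (ratr q < x) = (ratr q < y)) -> x = y.
  have H (z w : R) : z < w -> (forall q : rat, (ratr q < z) = (ratr q < w)) -> False.
    move=> zw E; have [q] := rat_in_itvoo zw.
    rewrite in_itv/= => /andP[zq qw]; move: (E q); rewrite qw => qz.
    by move: (lt_trans zq qz); rewrite ltxx.
  by move=> E; case: (ltgtP x y) => // xy; exfalso; [exact: (H x y)|exact: (H y x)].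
move=> S T ST.
have E m i j : (if m then S.1 else S.2) i j = (if m then T.1 else T.2) i j.
  apply: real_code => q; have := congr1 (fun f => f (pickle (m, i, j, q))) ST.
  by rewrite /system_code pickleK.
rewrite (surjective_pairing S) (surjective_pairing T); congr pair.
  by apply/matrixP => i j; exact: (E true).
by apply/matrixP => i j; exact: (E false).
Qed.

End Ternary.

(* The continuum many systems inject into R^5, so any choice of one common
   Lyapunov function for each of them is a five-parameter family. *)
Lemma Xi_finite_ssf (R : realType) :
  exists F : set ('cV[R]_2 -> R), finite_ssf 5 (@Xi R) F.
Proof.
(* One real already encodes the system; all five entries are that real. *)
pose enc (S : system R) : 'rV[R]_5 := const_mx (ternary R (system_code S)).
have enc_inj : injective enc.
  move=> S T /matrixP /(_ 0 0); rewrite !mxE => /ternary_inj.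
  exact: system_code_inj.
have [V VP] : exists V : system R -> 'cV[R]_2 -> R, forall S, gues S -> clf S (V S).
  have /choice[V VP] : forall S : system R, exists V, gues S -> clf S V.
    move=> S; have [/gues_clf[V VS]|ng] := pselect (gues S); first by exists V.
    by exists (fun=> 0).
  by exists V.
have [dec decK] : exists dec : 'rV[R]_5 -> system R, cancel enc dec.
  have /choice[dec decP] : forall w : 'rV[R]_5, exists S, forall S', enc S' = w -> S' = S.
    move=> w; have [[S Sw]|nS] := pselect (exists S, enc S = w).
      by exists S => S' S'w; apply: enc_inj; rewrite S'w.
    (* The pair (0, 0) is a default for rows that encode no system. *)
    by exists (0, 0) => S' S'w; exfalso; apply: nS; exists S'.
  by exists dec => S; rewrite -(decP (enc S) S).
pose f w := V (dec w); pose A := enc @` [set S | gues S].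
have [B _ Bf] := image_section 0 f A.
exists (f @` A); split.
- by move=> _ [_ [S gS <-] <-]; rewrite /f decK; case: (VP S gS).
- by exists B, f.
- move=> S _ gS; exists (V S); last exact: VP.
  by exists (enc S); [exists S|rewrite /f decK].
Qed.

(** * Switching lines of a pair in normal form *)

Definition cross (R : realType) (v w : 'cV[R]_2) : R :=
  v 0 0 * w 1 0 - v 1 0 * w 0 0.

(** The scalar product invariant under [jrot e]. It also measures how fast the flow of [nfA e r]
    turns, whatever the damping r, since cross y (nfA e r y) = Jdot e y y. *)
Definition Jdot (R : realType) (e : R) (v w : 'cV[R]_2) : R :=
  e * (v 0 0 * w 0 0) + v 1 0 * w 1 0 / e.

(* exp(t J) for J = [[0, -1/e], [e, 0]], the rotation preserving Jdot e. *)
Definition jrot (R : realType) (e t : R) : 'M[R]_2 :=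
  mx2 (cos t) (- (sin t / e)) (e * sin t) (cos t).

Lemma nfBE (R : realType) (r : R) : nfB r = nfA 1 r.
Proof. by rewrite /nfA invr1. Qed.

(** [jrot] carries no damping, so among the fields the radii occur only in [frame_rho] and
    [frame_cross]. The latter factors the quadratic form det(Ax, Bx); the sign of c decides which
    matrix governs which sector. *)
Record frame (R : realType) (E rA rB TA TB : R) (p1 p2 : 'cV[R]_2) (k : R) :
    Prop := Frame {
  frame_E : 1 < E;
  frame_TA : 0 < TA < pi;
  frame_TB : 0 < TB < pi;
  frame_k : 0 < k;
  frame_p1 : p1 != 0;
  frame_rotA : p2 = jrot E TA *m p1;
  frame_rotB : jrot 1 TB *m p2 = - k *: p1;
  frame_rho : rhoCC (kappa E) rA rB = expR (- (rA * TA + rB * TB)) * k;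
  frame_cross : exists2 c : R, 0 < c & forall x : 'cV[R]_2,
    cross (nfA E rA *m x) (nfA 1 rB *m x) = c * (cross x p2 * cross p1 x) }.

(** Here p1 = (X, Y) satisfies A p1 = mu B p1, that is, e1 = E X and e2 = Y / E, and En stands for E
    |p1| ^ 2. Expressing K and d by mu removes the square root, and e1, e2, En absorb E, which
    leaves rational identities modulo the single relation between X and Y. The first two compute the
    rotation of p2 by B; the other three factor the coefficients of det(Ax, Bx). *)
Lemma frame_identities (R : realType) (K rA rB mu d X Y e1 e2 : R) :
  mu != 0 -> K = (mu ^+ 2 * (1 + rB ^+ 2) + 1 + rA ^+ 2) / (2 * mu) - rA * rB ->
  d = mu * (1 + rB ^+ 2) - rA * rB - K ->
  e1 = rA * Y + mu * (X - rB * Y) -> e2 = mu * (rB * X + Y) - rA * X ->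
  (rA - mu * rB) * (Y ^+ 2 - X ^+ 2) - 2 * (K - mu) * (X * Y) = 0 ->
  let a := rB - K * rA in let b := rA - K * rB in
  let v0 := - a * X - d * e2 in let v1 := - a * Y + d * e1 in
  let n2 := X ^+ 2 + Y ^+ 2 in
  let En := X * e1 + 2 * K * Y ^+ 2 - Y * e2 in
  [/\ - b * v0 - d * v1 = - ((K ^+ 2 - 1) * (rA * rB + K + d)) * X,
      - b * v1 + d * v0 = - ((K ^+ 2 - 1) * (rA * rB + K + d)) * Y &
   [/\ (En * rB - rA * n2) * mu = - 2 * Y * v1,
      ((2 * K * n2 - En) * rB - rA * n2) * mu = - 2 * X * v0 &
      (En - (2 * K * n2 - En)) * mu = 2 * (X * v1 + Y * v0)]].
Proof.
move=> mu0 -> -> -> -> rel a b v0 v1 n2 En.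
have sub0 (x y c : R) : x - y = c * 0 -> x = y by rewrite mulr0 => /subr0_eq.
rewrite /v0 /v1 /n2 /En /a /b; split; [by field|by field|split].
- by apply: (sub0 _ _ mu); rewrite -rel; field.
- by apply: (sub0 _ _ (- mu)); rewrite -rel; field.
- by apply: (sub0 _ _ (- 2 * mu * rB)); rewrite -rel; field.
Qed.

Lemma sin_atanE (R : realType) (z : R) : sin (atan z) = z * cos (atan z).
Proof.
rewrite -{2}(atanK z) /tan divfK// gt_eqF//; apply: cos_gt0_pihalf.
by rewrite atan_gtNpi2 atan_ltpi2.
Qed.

Lemma quarter_turn_bounds (R : realType) (z : R) : 0 < pi / 2 + atan z < pi.
Proof.
have := atan_gtNpi2 z; have := atan_ltpi2 z => h1 h2.
apply/andP; split; lra.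
Qed.

Lemma frame_exists (R : realType) (E rA rB : R) : nf_params E rA rB ->
  exists TA TB p1 p2 k, frame E rA rB TA TB p1 p2 k.
Proof.
move=> [E1 rA0 rB0 D0]; have E0 : 0 < E by lra.
have En0 : E != 0 by rewrite gt_eqF.
pose K := kappa E; pose D := calD K rA rB; pose d := Num.sqrt D.
have d0 : 0 < d by rewrite sqrtr_gt0.
have dd : d ^+ 2 = D by rewrite sqr_sqrtr// ltW.
have K1 : 1 < K.
  rewrite /K /kappa ltr_pdivlMr// mul1r -subr_gt0.
  rewrite (_ : E + E^-1 - 2 = (E - 1) ^+ 2 / E); last by field.
  by rewrite divr_gt0// exprn_gt0// subr_gt0.
pose s := rA * rB + K.
have rr : 0 < rA * rB by exact: mulr_gt0.
have s0 : 0 < s by rewrite /s; lra.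
have B0 : 0 < 1 + rB ^+ 2 by rewrite ltr_pwDl// sqr_ge0.
have A0 : 0 < 1 + rA ^+ 2 by rewrite ltr_pwDl// sqr_ge0.
(* The larger root of det(A - mu B) = 0; the kernel of A - mu B is the line of p1. *)
pose mu := (s + d) / (1 + rB ^+ 2).
have mu0 : 0 < mu by rewrite divr_gt0// addr_gt0.
have mun0 : mu != 0 by rewrite gt_eqF.
have dE : d = mu * (1 + rB ^+ 2) - rA * rB - K.
  by rewrite /mu divfK ?gt_eqF// /s; ring.
have sdE : (s + d) * (s - d) = (1 + rA ^+ 2) * (1 + rB ^+ 2).
  by rewrite mulrC -subr_sqr dd /D /calD /s; ring.
have R0 : mu ^+ 2 * (1 + rB ^+ 2) - 2 * s * mu + (1 + rA ^+ 2) = 0.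
  have -> : 1 + rA ^+ 2 = (s + d) * (s - d) / (1 + rB ^+ 2).
    by rewrite sdE mulfK// gt_eqF.
  by rewrite /mu; field; rewrite gt_eqF.
have KE : K = (mu ^+ 2 * (1 + rB ^+ 2) + 1 + rA ^+ 2) / (2 * mu) - rA * rB.
  rewrite (_ : mu ^+ 2 * (1 + rB ^+ 2) + 1 + rA ^+ 2 = 2 * s * mu); last by lra.
  by rewrite /s; field.
have det : (E - mu) * (mu - E^-1) = (rA - mu * rB) ^+ 2.
  have -> : (E - mu) * (mu - E^-1) = 2 * K * mu - 1 - mu ^+ 2.
    by rewrite /K /kappa; field.
  move: R0; rewrite /s; lra.
(* A kernel vector of A - mu B, read off one row. If that row vanishes the other one does not, since
   E and 1 / E differ. *)
have [X [Y [XY0 H1 H2]]] : exists X Y : R, [/\ X ^+ 2 + Y ^+ 2 != 0,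
    (E - mu) * X = (rA - mu * rB) * Y & (mu - E^-1) * Y = (rA - mu * rB) * X].
  have sq (x y : R) : x ^+ 2 + y ^+ 2 = 0 -> x = 0.
    move=> xy; have := sqr_ge0 x; have := sqr_ge0 y => h1 h2.
    by apply/eqP; rewrite -sqrf_eq0; apply/eqP; lra.
  have [Z|NZ] := eqVneq ((mu - E^-1) ^+ 2 + (rA - mu * rB) ^+ 2) 0; last first.
    by exists (mu - E^-1), (rA - mu * rB); split; [exact: NZ|rewrite det; ring|ring].
  exists (rA - mu * rB), (E - mu); split; [|ring|rewrite mulrC det; ring].
  apply/eqP => W; have h1 := sq _ _ Z.
  have h2 : E - mu = 0 by apply: (sq _ (rA - mu * rB)); rewrite addrC.
  have EE : E^-1 = E by lra.
  have : E^-1 < 1 by rewrite invf_lt1.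
  by rewrite EE; lra.
pose e1 := rA * Y + mu * (X - rB * Y); pose e2 := mu * (rB * X + Y) - rA * X.
have e1E : e1 = E * X by rewrite /e1; lra.
have e2E : e2 = Y / E by rewrite /e2 (mulrC Y); lra.
have rel : (rA - mu * rB) * (Y ^+ 2 - X ^+ 2) - 2 * (K - mu) * (X * Y) = 0.
  rewrite mulrBr [in X in X - _]expr2 [in X in _ - X - _]expr2 !mulrA -H1 -H2.
  by rewrite /K /kappa; field.
have := @frame_identities _ K rA rB mu d X Y e1 e2 mun0 KE dE erefl erefl rel.
cbv zeta; set a := rB - K * rA; set b := rA - K * rB.
set v0 := - a * X - d * e2; set v1 := - a * Y + d * e1.
set n2 := X ^+ 2 + Y ^+ 2 in XY0 *; set En := (X * e1 + 2 * K * Y ^+ 2 - Y * e2).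
move=> [I1 I2 [Q1 Q2 Q3]].
have n20 : 0 < n2 by rewrite lt_neqAle eq_sym XY0 addr_ge0// sqr_ge0.
have EnE : En = E * n2 by rewrite /En e1E e2E /n2 /K /kappa; field.
pose SA := cos (atan (a / d)); pose SB := cos (atan (b / d)).
have SA0 : 0 < SA by apply: cos_gt0_pihalf; rewrite atan_gtNpi2 atan_ltpi2.
have SB0 : 0 < SB by apply: cos_gt0_pihalf; rewrite atan_gtNpi2 atan_ltpi2.
(* The angles with cotangents - a / d and - b / d; the exponent in [rhoCC] is - (rA TA + rB TB). *)
pose TA := pi / 2 + atan (a / d); pose TB := pi / 2 + atan (b / d).
have dn0 : d != 0 by rewrite gt_eqF.
have sTA : sin TA = SA by rewrite /TA addrC sinDpihalf.
have cTA : cos TA = - (a / d * SA) by rewrite /TA addrC cosDpihalf sin_atanE.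
have sTB : sin TB = SB by rewrite /TB addrC sinDpihalf.
have cTB : cos TB = - (b / d * SB) by rewrite /TB addrC cosDpihalf sin_atanE.
(* The factor that [I1] and [I2] produce once the sines SA and SB of the two rotations are
   collected. *)
pose k := SA * SB * (K ^+ 2 - 1) * (s + d) / d ^+ 2.
have K21 : 0 < K ^+ 2 - 1 by rewrite subr_gt0 expr_gt1//; lra.
have k0 : 0 < k by rewrite divr_gt0 ?exprn_gt0// !mulr_gt0// addr_gt0.
pose p1 := vec2 X Y; pose p2 := jrot E TA *m p1.
have p20 : p2 0 0 = SA / d * v0.
  rewrite mulmx2E !mxE/= sTA cTA /v0 e2E; field; by rewrite En0 dn0.
have p21 : p2 1 0 = SA / d * v1.
  by rewrite mulmx2E !mxE/= sTA cTA /v1 e1E; field.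
exists TA, TB, p1, p2, k; split => //.
- exact: quarter_turn_bounds.
- exact: quarter_turn_bounds.
- apply/eqP => p10; move: XY0.
  have X0 : X = 0 by have := congr1 (fun z : 'cV[R]_2 => z 0 0) p10; rewrite !mxE.
  have Y0 : Y = 0 by have := congr1 (fun z : 'cV[R]_2 => z 1 0) p10; rewrite !mxE.
  by rewrite /n2 X0 Y0 expr0n addr0 eqxx.
- apply: cV2P; rewrite mulmx2E p20 p21 !mxE/= sTB cTB.
    rewrite (_ : _ + _ = SA * SB / d ^+ 2 * (- b * v0 - d * v1)); last by field.
    by rewrite I1 /k /s; field.
  rewrite (_ : _ + _ = SA * SB / d ^+ 2 * (- b * v1 + d * v0)); last by field.
  by rewrite I2 /k /s; field.
- rewrite /rhoCC -/K -/D -/d -/s.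
  have ea : - rA * K + rB = a by rewrite /a; ring.
  rewrite ea (_ : rA - rB * K = b); last by rewrite /b; ring.
  congr (expR _ * _); first by rewrite /TA /TB; ring.
  rewrite -[RHS]gtr0_norm// -sqrtr_sqr; congr Num.sqrt.
  (* This rests on d ^ 2 + a ^ 2 = (K ^ 2 - 1) (1 + rA ^ 2). With its analogue for b and rB it
     eliminates SA and SB from k ^ 2, which becomes (s + d) / (s - d). *)
  have SAE : SA ^+ 2 * ((K ^+ 2 - 1) * (1 + rA ^+ 2)) = d ^+ 2.
    have : SA ^+ 2 + (a / d * SA) ^+ 2 = 1.
      by rewrite -[in LHS]sin_atanE cos2Dsin2.
    move=> /(congr1 (fun z => d ^+ 2 * z)); rewrite mulr1 => E2.
    rewrite -[RHS]E2.
    rewrite (_ : (K ^+ 2 - 1) * (1 + rA ^+ 2) = d ^+ 2 + a ^+ 2).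
      by field.
    by rewrite dd /D /calD /a; ring.
  have SBE : SB ^+ 2 * ((K ^+ 2 - 1) * (1 + rB ^+ 2)) = d ^+ 2.
    have : SB ^+ 2 + (b / d * SB) ^+ 2 = 1.
      by rewrite -[in LHS]sin_atanE cos2Dsin2.
    move=> /(congr1 (fun z => d ^+ 2 * z)); rewrite mulr1 => E2.
    rewrite -[RHS]E2.
    rewrite (_ : (K ^+ 2 - 1) * (1 + rB ^+ 2) = d ^+ 2 + b ^+ 2).
      by field.
    by rewrite dd /D /calD /b; ring.
  have sd0 : 0 < s - d.
    have : 0 < (s + d) * (s - d) by rewrite sdE mulr_gt0.
    by rewrite pmulr_rgt0// addr_gt0.
  have -> : (s + d) / (s - d) = (s + d) ^+ 2 / ((1 + rA ^+ 2) * (1 + rB ^+ 2)).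
    rewrite -sdE; field; by rewrite gt_eqF// gt_eqF// addr_gt0.
  have SA2 : SA ^+ 2 = d ^+ 2 / ((K ^+ 2 - 1) * (1 + rA ^+ 2)).
    by rewrite -SAE mulfK// gt_eqF// mulr_gt0.
  have SB2 : SB ^+ 2 = d ^+ 2 / ((K ^+ 2 - 1) * (1 + rB ^+ 2)).
    by rewrite -SBE mulfK// gt_eqF// mulr_gt0.
  have -> : k ^+ 2 = SA ^+ 2 * SB ^+ 2 * ((K ^+ 2 - 1) * (s + d) / d ^+ 2) ^+ 2.
    by rewrite /k; field.
  by rewrite SA2 SB2; field; rewrite dn0 !gt_eqF.
- exists (2 * d / (n2 * mu * SA)).
    have h1 : 0 < 2 * d by rewrite pmulr_rgt0.
    have h2 : 0 < n2 * mu * SA by exact: (mulr_gt0 (mulr_gt0 n20 mu0) SA0).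
    exact: divr_gt0.
  move=> x; rewrite /cross p20 p21 !mulmx2E !mxE/= invr1.
  set x0 := x 0 0; set x1 := x 1 0.
  rewrite EnE in Q1 Q2 Q3.
  have c1 : E * rB - rA = - 2 * Y * v1 / (n2 * mu) by rewrite -Q1; field; rewrite ?mun0 ?XY0.
  have c2 : rB / E - rA = - 2 * X * v0 / (n2 * mu).
    rewrite -Q2; rewrite /K /kappa; field; by rewrite ?XY0 ?mun0 ?En0.
  have c3 : E - E^-1 = 2 * (X * v1 + Y * v0) / (n2 * mu).
    rewrite -Q3; rewrite /K /kappa; field; by rewrite ?XY0 ?mun0 ?En0.
  transitivity ((E * rB - rA) * x0 ^+ 2 + (E - E^-1) * (x0 * x1) +
    (rB / E - rA) * x1 ^+ 2); first ring.
  rewrite c1 c2 c3; field; by rewrite ?XY0 ?mun0 ?dn0 ?gt_eqF.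
Qed.

(** * The gauge of a closed worst trajectory *)

Lemma Jdot_gt0 (R : realType) (e : R) (x : 'cV[R]_2) : 0 < e -> x != 0 ->
  0 < Jdot e x x.
Proof.
move=> e0 x0; rewrite /Jdot -!expr2.
have h0 : 0 <= e * x 0 0 ^+ 2 by rewrite mulr_ge0 ?sqr_ge0// ltW.
have h1 : 0 <= x 1 0 ^+ 2 / e by rewrite divr_ge0 ?sqr_ge0// ltW.
rewrite lt_neqAle addr_ge0// andbT eq_sym; apply: contra_neq x0 => H.
apply: cV2P; rewrite mxE; apply/eqP; rewrite -sqrf_eq0.
  have : e * x 0 0 ^+ 2 = 0 by lra.
  by move/eqP; rewrite mulf_eq0 gt_eqF.
have : x 1 0 ^+ 2 / e = 0 by lra.
by move/eqP; rewrite mulf_eq0 invr_eq0 (gt_eqF e0) orbF.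
Qed.

Lemma rot_coord (R : realType) (e t : R) (p : 'cV[R]_2) :
  (jrot e t *m p) 0 0 = cos t * p 0 0 - sin t * p 1 0 / e /\
  (jrot e t *m p) 1 0 = e * sin t * p 0 0 + cos t * p 1 0.
Proof. by split; rewrite mulmx2E !mxE/=; ring. Qed.

Lemma jrot0 (R : realType) (e : R) (p : 'cV[R]_2) : jrot e 0 *m p = p.
Proof.
have [r0 r1] := rot_coord e 0 p.
by apply: cV2P; rewrite ?r0 ?r1 cos0 sin0; ring.
Qed.

Lemma cross_rot (R : realType) (e a b : R) (p : 'cV[R]_2) : e != 0 ->
  cross (jrot e a *m p) (jrot e b *m p) = sin (b - a) * Jdot e p p.
Proof.
move=> e0; have [a0 a1] := rot_coord e a p; have [b0 b1] := rot_coord e b p.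
by rewrite /cross a0 a1 b0 b1 sinB /Jdot; field.
Qed.

Lemma Jdot_rot (R : realType) (e a b : R) (p : 'cV[R]_2) : e != 0 ->
  Jdot e (jrot e a *m p) (jrot e b *m p) = cos (b - a) * Jdot e p p.
Proof.
move=> e0; have [a0 a1] := rot_coord e a p; have [b0 b1] := rot_coord e b p.
by rewrite /Jdot a0 a1 b0 b1 cosB; field.
Qed.

Lemma crossC (R : realType) (x y : 'cV[R]_2) : cross x y = - cross y x.
Proof. by rewrite /cross; ring. Qed.

Lemma crossZr (R : realType) (c : R) (x y : 'cV[R]_2) :
  cross x (c *: y) = c * cross x y.
Proof. by rewrite /cross !mxE; ring. Qed.

Lemma crossZl (R : realType) (c : R) (x y : 'cV[R]_2) :
  cross (c *: x) y = c * cross x y.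
Proof. by rewrite /cross !mxE; ring. Qed.

Lemma JdotZr (R : realType) (e c : R) (x y : 'cV[R]_2) :
  Jdot e x (c *: y) = c * Jdot e x y.
Proof. by rewrite /Jdot !mxE; ring. Qed.

Lemma JdotZl (R : realType) (e c : R) (x y : 'cV[R]_2) :
  Jdot e (c *: x) y = c * Jdot e x y.
Proof. by rewrite /Jdot !mxE; ring. Qed.

Lemma cross_decomp (R : realType) (p q x : 'cV[R]_2) :
  cross p q *: x = cross x q *: p + cross p x *: q.
Proof. by apply: cV2P; rewrite /cross !mxE; ring. Qed.

(** * Cones swept by a rotation of angle less than pi *)

Section Sector.
Variables (R : realType) (e T : R) (p : 'cV[R]_2).
Hypotheses (e0 : 0 < e) (T0 : 0 < T < pi) (p0 : p != 0).

Let en0 : e != 0. Proof. by rewrite gt_eqF. Qed.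
Let sT : 0 < sin T. Proof. exact: sin_gt0_pi. Qed.
Let Q0 : 0 < Jdot e p p. Proof. exact: Jdot_gt0. Qed.

Lemma cross_rot_gt0 : 0 < cross p (jrot e T *m p).
Proof. by rewrite -{1}(jrot0 e p) cross_rot// subr0 mulr_gt0. Qed.

Lemma cos_gtN1 : 0 < 1 + cos T.
Proof.
have : cos pi < cos T.
  by rewrite ltr_cos ?in_itv/= ?pi_ge0 ?lexx//; case/andP: T0 => h1 h2 //; rewrite !ltW.
by rewrite cospi; lra.
Qed.

(** p and its rotation have the same [Jdot e] norm, so their sum is a bisector. On the double cone
    they span, the two cross products have the same sign and the right side vanishes only at 0; this
    keeps the arctangent in [logN] regular up to both edges. *)
Lemma Jdot_bisector (x : 'cV[R]_2) :
  Jdot e (p + jrot e T *m p) x * sin T =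
  (cross x (jrot e T *m p) + cross p x) * (1 + cos T).
Proof.
have [r0 r1] := rot_coord e T p.
have cs : (1 - cos T) * (1 + cos T) = sin T ^+ 2 by rewrite sin2cos2; ring.
have -> : (cross x (jrot e T *m p) + cross p x) * (1 + cos T) =
   ((1 - cos T) * (1 + cos T)) * cross p x + sin T * (1 + cos T) * Jdot e p x.
  by rewrite /cross /Jdot r0 r1; field.
rewrite cs /Jdot [(p + _) 0 0]mxE [(p + _) 1 0]mxE r0 r1 /cross; field; exact: en0.
Qed.

Lemma Jdot_bisector_neq0 (x : 'cV[R]_2) : x != 0 ->
  0 <= cross x (jrot e T *m p) * cross p x ->
  Jdot e (p + jrot e T *m p) x != 0.
Proof.
move=> x0 ab; apply: contra_neq x0 => J0.
have := Jdot_bisector x; rewrite J0 mul0r => /esym/eqP.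
rewrite mulf_eq0 (gt_eqF cos_gtN1) orbF addr_eq0 => /eqP E.
have b0 : cross p x = 0.
  apply/eqP; rewrite -sqrf_eq0; apply/eqP.
  by move: ab; rewrite E; have := sqr_ge0 (cross p x); rewrite expr2; lra.
have a0 : cross x (jrot e T *m p) = 0 by rewrite E b0 oppr0.
have := cross_decomp p (jrot e T *m p) x; rewrite a0 b0 !scale0r addr0.
by move/eqP; rewrite scaler_eq0 gt_eqF ?cross_rot_gt0//= => /eqP.
Qed.

Lemma sector_rot (x : 'cV[R]_2) : x != 0 ->
  0 <= cross x (jrot e T *m p) -> 0 <= cross p x ->
  exists2 t, 0 <= t <= T & exists2 c, 0 < c & x = c *: (jrot e t *m p).
Proof.
move=> x0 a0 b0; have T0' : 0 <= T by case/andP: T0 => /ltW.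
pose f (t : R) := cross (jrot e t *m p) x.
have fE t : f t = cos t * cross p x - sin t * Jdot e p x.
  have [r0 r1] := rot_coord e t p.
  by rewrite /f /cross /Jdot r0 r1; field.
have [t tT ft] : exists2 t, t \in `[0, T] & f t = 0.
  apply: IVT => //.
    apply: continuous_subspaceT => t.
    rewrite (_ : f = fun t => cos t * cross p x - sin t * Jdot e p x); last first.
      by apply/funext => s; rewrite fE.
    apply: cvgB; apply: cvgMr_tmp.
      exact: continuous_cos.
    exact: continuous_sin.
  rewrite /f jrot0 (crossC (jrot e T *m p)); apply/andP; split.
    by rewrite ge_min oppr_le0 a0 orbT.
  by rewrite le_max b0.
move: tT; rewrite in_itv/= => /andP[t0 tT].
exists t; first by rewrite t0 tT.
set v := jrot e t *m p in ft *.
have vv : Jdot e v v = Jdot e p p by rewrite /v Jdot_rot// subrr cos0 mul1r.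
have xE : x = (Jdot e v x / Jdot e v v) *: v.
  have vvn : Jdot e v v != 0 by rewrite vv gt_eqF.
  have h : cross v x = 0 by exact: ft.
  apply: (scalerI vvn); rewrite scalerA mulrC divfK//.
  apply: cV2P; rewrite [LHS]mxE [RHS]mxE.
    transitivity (Jdot e v x * v 0 0 - cross v x * (v 1 0) / e).
      by rewrite /Jdot /cross; field.
    by rewrite h; ring.
  transitivity (Jdot e v x * v 1 0 + cross v x * (e * v 0 0)).
    by rewrite /Jdot /cross; field.
  by rewrite h; ring.
set c := Jdot e v x / _ in xE; exists c => //.
rewrite ltNge; apply/negP => c0; move/eqP: (x0); apply.
have st : 0 <= sin t by apply: sin_ge0_pi; case/andP: T0; lra.
have sTt : 0 <= sin (T - t) by apply: sin_ge0_pi; case/andP: T0; lra.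
have b1 : cross p x = c * (sin t * Jdot e p p).
  by rewrite xE crossZr -{1}(jrot0 e p) /v cross_rot// subr0.
have a1 : cross x (jrot e T *m p) = c * (sin (T - t) * Jdot e p p).
  by rewrite xE crossZl /v cross_rot.
have a2 : cross x (jrot e T *m p) = 0.
  apply: le_anti; rewrite a0 andbT a1 mulr_le0_ge0// mulr_ge0// ltW//.
have b2 : cross p x = 0.
  apply: le_anti; rewrite b0 andbT b1 mulr_le0_ge0// mulr_ge0// ltW//.
have := cross_decomp p (jrot e T *m p) x; rewrite a2 b2 !scale0r addr0.
by move/eqP; rewrite scaler_eq0 gt_eqF ?cross_rot_gt0//= => /eqP.
Qed.

Lemma rot_sector (t : R) : 0 <= t <= T ->
  0 <= cross (jrot e t *m p) (jrot e T *m p) /\ 0 <= cross p (jrot e t *m p).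
Proof.
move=> /andP[t0 tT]; split; last rewrite -{1}(jrot0 e p).
  by rewrite cross_rot// mulr_ge0 ?(ltW Q0)// sin_ge0_pi//; case/andP: T0; lra.
by rewrite cross_rot// mulr_ge0 ?(ltW Q0)// sin_ge0_pi//; case/andP: T0; lra.
Qed.

End Sector.

(* Logarithm of the gauge that is constant along the flow of nfA e r, normalised
   on the half plane Jdot e m x > 0. *)
Definition logN (R : realType) (e r : R) (m x : 'cV[R]_2) : R :=
  ln (Jdot e x x) / 2 + r * atan (cross m x / Jdot e m x).

(** In the rescaled angle measured from the bisector the arctangent equals t - T / 2. The damping
    exp(- r t) of the flow exactly cancels the growth r t. *)
Lemma logN_rot (R : realType) (e r T t : R) (p : 'cV[R]_2) :
  0 < e -> 0 < T < pi -> p != 0 -> 0 <= t <= T ->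
  logN e r (p + jrot e T *m p) (jrot e t *m p) =
  ln (Jdot e p p) / 2 + r * (t - T / 2).
Proof.
move=> e0 T0 p0 tT; have en0 : e != 0 by rewrite gt_eqF.
have Q0 := Jdot_gt0 e0 p0.
rewrite /logN Jdot_rot// subrr cos0 mul1r; congr (_ + _ * _).
have cT : 0 < cos (T / 2) by apply: cos_gt0_pihalf; case/andP: T0; lra.
have ct : 0 < cos (t - T / 2).
  by apply: cos_gt0_pihalf; case/andP: T0; case/andP: tT; lra.
have E1 : cross (p + jrot e T *m p) (jrot e t *m p) =
    cross p (jrot e t *m p) + cross (jrot e T *m p) (jrot e t *m p).
  by rewrite /cross [(p + _) 0 0]mxE [(p + _) 1 0]mxE; ring.
have E2 : Jdot e (p + jrot e T *m p) (jrot e t *m p) =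
    Jdot e p (jrot e t *m p) + Jdot e (jrot e T *m p) (jrot e t *m p).
  by rewrite /Jdot [(p + _) 0 0]mxE [(p + _) 1 0]mxE; ring.
have c1 : cross p (jrot e t *m p) = sin t * Jdot e p p.
  by rewrite -{1}(jrot0 e p) cross_rot// subr0.
have j1 : Jdot e p (jrot e t *m p) = cos t * Jdot e p p.
  by rewrite -{1}(jrot0 e p) Jdot_rot// subr0.
rewrite E1 E2 c1 j1 cross_rot// Jdot_rot//.
set u := t - T / 2; rewrite -/u in ct.
have tu : t = u + T / 2 by rewrite /u; ring.
have tTu : t - T = u - T / 2 by rewrite /u; field.
rewrite tTu tu sinD cosD sinB cosB.
rewrite (_ : _ / _ = tan u); last first.
  rewrite (_ : (_ + _) / _ = (sin u * (2 * cos (T / 2) * Jdot e p p)) /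
    (cos u * (2 * cos (T / 2) * Jdot e p p))); last by congr (_ / _); ring.
  have nz : 2 * cos (T / 2) * Jdot e p p != 0 by rewrite gt_eqF// !mulr_gt0.
  by rewrite -mulf_div divff// mulr1.
rewrite tanK; first by rewrite /u; ring.
by rewrite in_itv/=; apply/andP; rewrite /u; case/andP: T0; case/andP: tT; split; lra.
Qed.

Lemma logN_scale (R : realType) (e r c : R) (m x : 'cV[R]_2) :
  0 < e -> c != 0 -> x != 0 -> logN e r m (c *: x) = logN e r m x + ln `|c|.
Proof.
move=> e0 c0 x0; have Q0 := Jdot_gt0 e0 x0.
rewrite /logN JdotZr JdotZl crossZr JdotZr invfM mulrACA divff// mul1r.
rewrite mulrA -expr2 -real_normK ?num_real// lnM ?posrE ?exprn_gt0 ?normr_gt0//.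
by rewrite lnXn ?normr_gt0// mulr2n; field.
Qed.

(** The mean value theorem, the derivative of [logN] at y in the direction k being cross(k, nfA e r
    y) / Jdot(y, y). It vanishes when k follows the flow, and it does not involve m, which only
    selects a branch of the angle. *)
Lemma logN_segment (R : realType) (e r : R) (m x k : 'cV[R]_2) :
  0 < e ->
  (forall t : R, 0 <= t <= 1 -> Jdot e m (x + t *: k) != 0) ->
  exists2 t : R, 0 <= t <= 1 &
    logN e r m (x + k) - logN e r m x =
    cross k (nfA e r *m (x + t *: k)) / Jdot e (x + t *: k) (x + t *: k).
Proof.
move=> e0 J0; have en0 : e != 0 by rewrite gt_eqF.
have m0 : m != 0.
  apply/eqP => m_0; have := J0 0; rewrite lexx ler01 => /(_ isT).
  by rewrite m_0 /Jdot !mxE !(mul0r, mulr0) addr0 eqxx.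
have y0 (t : R) : 0 <= t <= 1 -> x + t *: k != 0.
  move=> /J0; apply: contra_neq => ->.
  by rewrite /Jdot !mxE !(mul0r, mulr0) addr0.
have Qm := Jdot_gt0 e0 m0.
pose f (t : R) := logN e r m (x + t *: k).
pose df (t : R) := cross k (nfA e r *m (x + t *: k)) / Jdot e (x + t *: k) (x + t *: k).
have fd (t : R) : 0 <= t <= 1 -> is_derive t 1 f (df t).
  move=> t01; have Jt := J0 t t01; have Qt := Jdot_gt0 e0 (y0 t t01).
  pose a (t : R) := x 0 0 + t * k 0 0; pose b (t : R) := x 1 0 + t * k 1 0.
  have aE s : (x + s *: k) 0 0 = a s by rewrite !mxE.
  have bE s : (x + s *: k) 1 0 = b s by rewrite !mxE.
  have da : is_derive t 1 a (k 0 0).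
    by apply: is_derive_eq; rewrite /GRing.scale/=; ring.
  have db : is_derive t 1 b (k 1 0).
    by apply: is_derive_eq; rewrite /GRing.scale/=; ring.
  pose q (s : R) := e * (a s * a s) + b s * b s * e^-1.
  pose c (s : R) := m 0 0 * b s - m 1 0 * a s.
  pose d (s : R) := e * (m 0 0 * a s) + m 1 0 * b s * e^-1.
  have qE s : Jdot e (x + s *: k) (x + s *: k) = q s by rewrite /Jdot aE bE.
  have cE s : cross m (x + s *: k) = c s by rewrite /cross aE bE.
  have dE s : Jdot e m (x + s *: k) = d s by rewrite /Jdot aE bE.
  rewrite qE in Qt; rewrite dE in Jt.
  have dq : is_derive t 1 q (2 * (e * (a t * k 0 0) + b t * k 1 0 * e^-1)).
    by apply: is_derive_eq; rewrite /GRing.scale/=; ring.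
  have dc : is_derive t 1 c (m 0 0 * k 1 0 - m 1 0 * k 0 0).
    by apply: is_derive_eq; rewrite /GRing.scale/=; ring.
  have dd : is_derive t 1 d (e * (m 0 0 * k 0 0) + m 1 0 * k 1 0 * e^-1).
    by apply: is_derive_eq; rewrite /GRing.scale/=; ring.
  have dV := is_deriveV Jt dd.
  pose w (s : R) := c s * (d s)^-1.
  have dcd : is_derive t 1 w
    ((m 0 0 * k 1 0 - m 1 0 * k 0 0) / d t -
     c t * (e * (m 0 0 * k 0 0) + m 1 0 * k 1 0 * e^-1) / d t ^+ 2).
    by apply: is_derive_eq; rewrite /GRing.scale/=; field; rewrite ?en0 ?Jt.
  have dat := @is_derive1_comp _ (@atan R) w _ _ _ (is_derive1_atan (w t)) dcd.
  have dln := is_derive1_comp (is_derive1_ln Qt) dq.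
  have -> : f = fun s => 2^-1 * (@ln R \o q) s + r * (@atan R \o w) s.
    by apply/funext => s; rewrite /f /logN qE cE dE /= mulrC.
  apply: is_derive_eq; rewrite /GRing.scale/= /df qE /cross !mulmx2E aE bE !mxE/=.
  have E : 1 + w t ^+ 2 = Jdot e m m * q t / d t ^+ 2.
    rewrite /Jdot /w; apply: (mulIf (expf_neq0 2 Jt)); rewrite divfK ?expf_neq0//.
    rewrite mulrDl mul1r expr_div_n divfK ?expf_neq0//.
    by rewrite /c /d /q; field.
  rewrite E; have Qmn : Jdot e m m != 0 by rewrite gt_eqF.
  have Qtn : q t != 0 by rewrite gt_eqF.
  have F : (m 0 0 * k 1 0 - m 1 0 * k 0 0) / d t -
     c t * (e * (m 0 0 * k 0 0) + m 1 0 * k 1 0 * e^-1) / d t ^+ 2 =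
     Jdot e m m * (a t * k 1 0 - b t * k 0 0) / d t ^+ 2.
    apply: (mulIf (expf_neq0 2 Jt)); rewrite divfK ?expf_neq0//.
    have G (u v D : R) : D != 0 -> (u / D - v / D ^+ 2) * D ^+ 2 = u * D - v.
      by move=> D0; field.
    rewrite (G _ _ _ Jt).
    by rewrite /Jdot /c /d; field.
  rewrite F; field; by rewrite Qtn Qmn en0 Jt.
have [t t01 ft] : exists2 t, t \in `]0, 1[ & f 1 - f 0 = df t * (1 - 0).
  apply: MVT => //.
    move=> t; rewrite in_itv/= => /andP[t0 t1]; apply: fd; by rewrite !ltW.
  apply: derivable_within_continuous => t; rewrite in_itv/= => t01.
  by case: (fd t t01).
exists t; first by move: t01; rewrite in_itv/= => /andP[h1 h2]; rewrite !ltW.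
by move: ft; rewrite /f scale1r scale0r addr0 subr0 mulr1.
Qed.

(** * Growth of [logN] along a trajectory *)

Definition ball1 (R : realType) (y : 'cV[R]_2) : set_system 'cV[R]_2 :=
  filter_from [set d : R | 0 < d] (fun d => [set z | norm1 (z - y) < d]).

Instance ball1_filter (R : realType) (y : 'cV[R]_2) : Filter (ball1 y).
Proof.
apply: filter_from_filter; first by exists 1 => /=.
move=> d d' d0 d0'; exists (Num.min d d'); first by rewrite /= lt_min; apply/andP.
by move=> z; rewrite /= lt_min => /andP[].
Qed.

(** Two independent points near y: the velocity is taken at a point of the trajectory, the
    derivative of [logN] at a mean value point of the chord. *)
Definition ball2 (R : realType) (y : 'cV[R]_2) : set_system ('cV[R]_2 * 'cV[R]_2) :=
  filter_from [set d : R | 0 < d]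
    (fun d => [set p | norm1 (p.1 - y) < d /\ norm1 (p.2 - y) < d]).

Instance ball2_filter (R : realType) (y : 'cV[R]_2) : Filter (ball2 y).
Proof.
apply: filter_from_filter; first by exists 1 => /=.
move=> d d' d0 d0'; exists (Num.min d d'); first by rewrite /= lt_min; apply/andP.
by move=> z; rewrite /= !lt_min => -[/andP[? ?] /andP[? ?]].
Qed.

Lemma coord_le_norm1 (R : realType) (x : 'cV[R]_2) i : `|x i 0| <= norm1 x.
Proof. by rewrite /norm1; case: (ord2P i) => ->; rewrite ?lerDl ?lerDr. Qed.

Lemma ball1_coord (R : realType) (y : 'cV[R]_2) i :
  (fun z : 'cV[R]_2 => z i 0) @ ball1 y --> y i 0.
Proof.
apply/cvgrPdist_lt => e e0; exists e => // z /= ze; rewrite distrC.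
by have := coord_le_norm1 (z - y) i; rewrite !mxE => /le_lt_trans; apply.
Qed.

Lemma ball2_coord1 (R : realType) (y : 'cV[R]_2) i :
  (fun z : 'cV[R]_2 * 'cV[R]_2 => z.1 i 0) @ ball2 y --> y i 0.
Proof.
apply/cvgrPdist_lt => e e0; exists e => // z /= [ze _]; rewrite distrC.
by have := coord_le_norm1 (z.1 - y) i; rewrite !mxE => /le_lt_trans; apply.
Qed.

Lemma ball2_coord2 (R : realType) (y : 'cV[R]_2) i :
  (fun z : 'cV[R]_2 * 'cV[R]_2 => z.2 i 0) @ ball2 y --> y i 0.
Proof.
apply/cvgrPdist_lt => e e0; exists e => // z /= [_ ze]; rewrite distrC.
by have := coord_le_norm1 (z.2 - y) i; rewrite !mxE => /le_lt_trans; apply.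
Qed.

Section CvgForms.
Variables (R : realType) (T : Type) (F : set_system T).
Context {FF : Filter F}.
Variables (x y : T -> 'cV[R]_2) (x0 y0 : 'cV[R]_2).
Hypotheses (cx : forall i, (fun t => x t i 0) @ F --> x0 i 0).
Hypotheses (cy : forall i, (fun t => y t i 0) @ F --> y0 i 0).

Lemma cvg_mulmx_coord (M : 'M[R]_2) i :
  (fun t => (M *m x t) i 0) @ F --> (M *m x0) i 0.
Proof.
rewrite mulmx2E (_ : (fun t => _) = fun t => M i 0 * x t 0 0 + M i 1 * x t 1 0).
  by apply: cvg_lin2; exact: cx.
by apply/funext => t; rewrite mulmx2E.
Qed.

Lemma cvg_cross : (fun t => cross (x t) (y t)) @ F --> cross x0 y0.
Proof. by apply: cvgB; apply: cvgM. Qed.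

Lemma cvg_Jdot (e : R) : (fun t => Jdot e (x t) (y t)) @ F --> Jdot e x0 y0.
Proof.
apply: cvgD; first by apply: cvgM; [exact: cvg_cst|exact: cvgM].
by apply: cvgM; [exact: cvgM|exact: cvg_cst].
Qed.

End CvgForms.

Lemma cvg_logN (R : realType) (T : Type) (F : set_system T) (FF : Filter F)
    (x : T -> 'cV[R]_2) (e r : R) (m x0 : 'cV[R]_2) :
  0 < e -> x0 != 0 -> Jdot e m x0 != 0 ->
  (forall i, (fun t => x t i 0) @ F --> x0 i 0) ->
  (fun t => logN e r m (x t)) @ F --> logN e r m x0.
Proof.
move=> e0 xn Jn cx.
have cm i : (fun _ : T => m i 0) @ F --> m i 0 by exact: cvg_cst.
have c1 := @cvg_cross _ _ _ FF (fun _ => m) x m x0 cm cx.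
have c2 := @cvg_Jdot _ _ _ FF (fun _ => m) x m x0 cm cx e.
have c3 := @cvg_Jdot _ _ _ FF x x x0 x0 cx cx e.
have c4 : (fun t => cross m (x t) / Jdot e m (x t)) @ F --> cross m x0 / Jdot e m x0.
  by apply: cvgM c1 _; exact: cvgV.
apply: cvgD; apply: cvgM; try exact: cvg_cst.
  apply: (continuous_cvg _ _ c3); exact: continuous_ln (Jdot_gt0 e0 xn).
apply: (continuous_cvg _ _ c4); exact: continuous_atan.
Qed.

(** Once the mean value theorem has chosen y on the chord, the increment is cross(k, w) / Jdot(y, y)
    with w fixed, a linear functional of the displacement k. It is bounded by integrating the
    velocity, a convex combination of two vectors for which the bound c holds at x t, hence c + g
    nearby. *)
Lemma logN_trajectory (R : realType) (S : system R) u x (t e r c : R) m :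
  switching_signal u -> trajectory S u x -> 0 <= t -> 0 < e -> x t != 0 ->
  Jdot e m (x t) != 0 ->
  cross (S.1 *m x t) (nfA e r *m x t) <= c * Jdot e (x t) (x t) ->
  cross (S.2 *m x t) (nfA e r *m x t) <= c * Jdot e (x t) (x t) ->
  forall g : R, 0 < g -> exists2 d : R, 0 < d & forall h : R, 0 < h < d ->
    logN e r m (x (t + h)) <= logN e r m (x t) + (c + g) * h.
Proof.
move=> su tx t0 e0 xn Jn b1 b2 g g0.
have Q0 := Jdot_gt0 e0 xn.
pose G (M : 'M[R]_2) (p : 'cV[R]_2 * 'cV[R]_2) :=
  (c + g) * Jdot e p.2 p.2 - cross (M *m p.1) (nfA e r *m p.2).
have FF := ball2_filter (x t).
have k1 := @ball2_coord1 R (x t); have k2 := @ball2_coord2 R (x t).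
have GM (M : 'M[R]_2) : cross (M *m x t) (nfA e r *m x t) <= c * Jdot e (x t) (x t) ->
    \forall p \near ball2 (x t), 0 < G M p.
  move=> bM.
  have cG : G M @ ball2 (x t) -->
      (c + g) * Jdot e (x t) (x t) - cross (M *m x t) (nfA e r *m x t).
    apply: cvgB; first by apply: cvgM; [exact: cvg_cst|apply: cvg_Jdot => i; exact: k2].
    by apply: cvg_cross => i; apply: cvg_mulmx_coord => j; [exact: k1|exact: k2].
  apply: (cvgr_gt _ cG); have := mulr_gt0 g0 Q0; lra.
have nJ : \forall p \near ball2 (x t), 0 < Jdot e m p.2 * Jdot e m (x t).
  have cJ : (fun p => Jdot e m p.2 * Jdot e m (x t)) @ ball2 (x t) -->
      Jdot e m (x t) * Jdot e m (x t).
    apply: cvgM; last exact: cvg_cst.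
    apply: (@cvg_Jdot _ _ _ FF (fun _ => m) snd) => i; first exact: cvg_cst.
    exact: k2.
  by apply: (cvgr_gt _ cJ); rewrite -expr2 exprn_even_gt0.
have [d1 d10 H1] := GM _ b1; have [d2 d20 H2] := GM _ b2; have [d3 d30 H3] := nJ.
pose d := Num.min d1 (Num.min d2 d3).
have d0 : 0 < d by rewrite !lt_min; apply/and3P.
have [d' d'0 Hd'] := trajectory_norm1 tx t0 d0.
have near s : t <= s < t + d' -> norm1 (x s - x t) < d.
  by move=> /andP[ts st]; apply: Hd'; [lra|rewrite ger0_norm; lra].
exists d' => // h /andP[h0 hd].
pose k := x (t + h) - x t.
have kd : norm1 k < d by apply: near; lra.
have seg (a : R) : 0 <= a <= 1 -> norm1 (x t + a *: k - x t) < d.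
  move=> /andP[a0 a1]; apply: le_lt_trans kd; rewrite addrAC subrr add0r.
  rewrite /norm1 [(a *: k) 0 0]mxE [(a *: k) 1 0]mxE !normrM ger0_norm// -mulrDr.
  by rewrite ler_piMl// addr_ge0.
have segJ (a : R) : 0 <= a <= 1 -> Jdot e m (x t + a *: k) != 0.
  move=> a01; have := H3 (x t, x t + a *: k); rewrite /= subrr => H.
  have : 0 < Jdot e m (x t + a *: k) * Jdot e m (x t).
    apply: H; split; first by rewrite /norm1 !mxE normr0 addr0.
    by have := seg a a01; rewrite !lt_min => /and3P[].
  by apply: contraTneq => ->; rewrite mul0r ltxx.
have [a a01] := logN_segment r e0 segJ.
rewrite /k subrKC -/k; set y := x t + a *: k => E.
have yJ : Jdot e m y != 0 := segJ a a01; have yd : norm1 (y - x t) < d := seg a a01.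
have yn : y != 0.
  by apply: contra_neq yJ => ->; rewrite /Jdot !mxE !(mulr0, mul0r) addr0.
have Qy := Jdot_gt0 e0 yn.
set w := nfA e r *m y in E.
have pr := primitive_lin (w 1 0) (- w 0 0) (trajectory_primitive 0 su tx)
  (trajectory_primitive 1 su tx).
have : w 1 0 * x (t + h) 0 0 + - w 0 0 * x (t + h) 1 0 -
   (w 1 0 * x t 0 0 + - w 0 0 * x t 1 0) <= (c + g) * Jdot e y y * (t + h - t).
  apply: (primitive_le pr); first lra.
  move=> z /andP[tz zh].
  have /andP[u0 u1] : 0 <= u z <= 1 by apply: su.2; lra.
  have zd : norm1 (x z - x t) < d by apply: near; lra.
  have g1 : 0 < G S.1 (x z, y).
    by apply: H1; split; [move: zd|move: yd]; rewrite !lt_min => /and3P[].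
  have g2 : 0 < G S.2 (x z, y).
    by apply: H2; split; [move: zd|move: yd]; rewrite !lt_min => /and3P[].
  rewrite /G /= -/w in g1 g2.
  have -> : w 1 0 * velocity S u x z 0 0 + - w 0 0 * velocity S u x z 1 0 =
    u z * cross (S.1 *m x z) w + (1 - u z) * cross (S.2 *m x z) w.
    by rewrite !velocityE /cross !(mulmx2E _ (x z)); ring.
  have h1 : u z * cross (S.1 *m x z) w <= u z * ((c + g) * Jdot e y y).
    by rewrite ler_wpM2l//; lra.
  have h2 : (1 - u z) * cross (S.2 *m x z) w <= (1 - u z) * ((c + g) * Jdot e y y).
    by rewrite ler_wpM2l//; lra.
  lra.
have -> : w 1 0 * x (t + h) 0 0 + - w 0 0 * x (t + h) 1 0 -
   (w 1 0 * x t 0 0 + - w 0 0 * x t 1 0) = cross k w.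
  by rewrite /cross /k !mxE; ring.
rewrite (_ : t + h - t = h); last by ring.
move=> B; have {E} -> : logN e r m (x (t + h)) = logN e r m (x t) + cross k w / Jdot e y y.
  by rewrite -E; ring.
by rewrite lerD2l ler_pdivrMr// mulrAC.
Qed.

Lemma cross_nfA (R : realType) (e r : R) (y : 'cV[R]_2) :
  cross y (nfA e r *m y) = Jdot e y y.
Proof. by rewrite /cross /Jdot !mulmx2E !mxE/=; ring. Qed.

(** Extra damping a adds the radial term - a y. With w = nfA e r y it contributes - s a Jdot(y, y),
    the source of the strict decrease of the gauge. *)
Lemma cross_shift (R : realType) (e r a s : R) (y w : 'cV[R]_2) :
  cross ((s *: nfA e (r + a)) *m y) w =
  s * (cross (nfA e r *m y) w - a * cross y w).
Proof. by rewrite /cross !mulmx2E !mxE/=; ring. Qed.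

Lemma Jdot_le (R : realType) (E e : R) (x : 'cV[R]_2) : 1 <= e -> e <= E ->
  Jdot e x x <= (E + 1) * norm1 x ^+ 2.
Proof.
move=> e1 eE; rewrite /Jdot -!expr2 /norm1.
have h0 : x 0 0 ^+ 2 <= (`|x 0 0| + `|x 1 0|) ^+ 2.
  by rewrite -[x 0 0 ^+ 2]real_normK ?num_real// lerXn2r ?nnegrE ?addr_ge0// lerDl.
have h1 : x 1 0 ^+ 2 <= (`|x 0 0| + `|x 1 0|) ^+ 2.
  by rewrite -[x 1 0 ^+ 2]real_normK ?num_real// lerXn2r ?nnegrE ?addr_ge0// lerDr.
have E1 : 1 <= E by exact: le_trans eE.
rewrite mulrDl mul1r lerD//.
  apply: le_trans (ler_wpM2r (sqr_ge0 _) eE) _.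
  by rewrite ler_wpM2l//; lra.
apply: le_trans h1; rewrite ler_piMr ?sqr_ge0// invf_le1//; lra.
Qed.

(** * Gluing the two pieces of the gauge *)

Section Gauge.
Variables (R : realType) (E rA rB TA TB : R) (p1 p2 : 'cV[R]_2) (k : R).

(** Nonnegative on the double cone of A, nonpositive on that of B. Being quadratic it ignores the
    sign of x, as the gauge does. *)
Definition sector_side (x : 'cV[R]_2) : R := cross x p2 * cross p1 x.

Definition log_gaugeA (x : 'cV[R]_2) : R := logN E rA (p1 + p2) x.

(** The vector p2 - k p1 is p2 plus its rotation by TB, the bisector of the cone of B. The added
    constant matches the two pieces at p2. *)
Definition log_gaugeB (x : 'cV[R]_2) : R :=
  logN 1 rB (p2 - k *: p1) x +
  (log_gaugeA p2 - logN 1 rB (p2 - k *: p1) p2).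

Definition log_gauge (x : 'cV[R]_2) : R :=
  if 0 <= sector_side x then log_gaugeA x else log_gaugeB x.

Definition gauge (x : 'cV[R]_2) : R := if x == 0 then 0 else expR (log_gauge x).

Hypotheses (rA0 : 0 < rA) (rB0 : 0 < rB).
Hypothesis Hf : frame E rA rB TA TB p1 p2 k.
Hypothesis Hrho : rhoCC (kappa E) rA rB = 1.

Let E0 : 0 < E. Proof. by have := frame_E Hf; lra. Qed.
Let k0 : 0 < k. Proof. exact: frame_k Hf. Qed.
Let p10 : p1 != 0. Proof. exact: frame_p1 Hf. Qed.
Let p2E : p2 = jrot E TA *m p1. Proof. exact: frame_rotA Hf. Qed.
Let TA0 : 0 < TA < pi. Proof. exact: frame_TA Hf. Qed.
Let TB0 : 0 < TB < pi. Proof. exact: frame_TB Hf. Qed.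
Let one0 : 0 < 1 :> R. Proof. exact: ltr01. Qed.

Let p20 : p2 != 0.
Proof.
apply/eqP => p2_0; have := cross_rot_gt0 E0 TA0 p10.
by rewrite -p2E p2_0 /cross !mxE !mulr0 subrr ltxx.
Qed.

Let rotB : jrot 1 TB *m p2 = - k *: p1. Proof. exact: frame_rotB Hf. Qed.

Let mBE : p2 - k *: p1 = p2 + jrot 1 TB *m p2.
Proof. by rewrite rotB scaleNr. Qed.

Let ln_k : ln k = rA * TA + rB * TB.
Proof.
have := frame_rho Hf; rewrite Hrho expRN => H.
have -> : k = expR (rA * TA + rB * TB).
  by rewrite -[LHS](mulVKf (lt0r_neq0 (expR_gt0 (rA * TA + rB * TB)))) -H mulr1.
by rewrite expRK.
Qed.

Lemma sideA_neq0 x : x != 0 -> 0 <= sector_side x -> Jdot E (p1 + p2) x != 0.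
Proof. by move=> x0 s0; rewrite p2E; apply: Jdot_bisector_neq0 => //; rewrite -p2E. Qed.

Lemma sideB_neq0 x : x != 0 -> sector_side x <= 0 -> Jdot 1 (p2 - k *: p1) x != 0.
Proof.
move=> x0 s0; rewrite mBE; apply: Jdot_bisector_neq0 => //.
rewrite rotB crossZr (crossC x p1) (crossC p2 x).
have -> : - k * - cross p1 x * - cross x p2 = k * - sector_side x by rewrite /sector_side; ring.
by rewrite mulr_ge0 ?(ltW k0)// oppr_ge0.
Qed.

Let w0 : 0 < cross p1 p2.
Proof. by rewrite p2E; exact: cross_rot_gt0. Qed.

Lemma log_gaugeA_scale c x : c != 0 -> x != 0 ->
  log_gaugeA (c *: x) = log_gaugeA x + ln `|c|.
Proof. by move=> c0 x0; rewrite /log_gaugeA logN_scale. Qed.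

Lemma log_gaugeB_scale c x : c != 0 -> x != 0 ->
  log_gaugeB (c *: x) = log_gaugeB x + ln `|c|.
Proof. by move=> c0 x0; rewrite /log_gaugeB logN_scale//; ring. Qed.

Let LA_arc t : 0 <= t <= TA ->
  log_gaugeA (jrot E t *m p1) = ln (Jdot E p1 p1) / 2 + rA * (t - TA / 2).
Proof. by move=> tT; rewrite /log_gaugeA p2E logN_rot. Qed.

Let LB_arc t : 0 <= t <= TB -> logN 1 rB (p2 - k *: p1) (jrot 1 t *m p2) =
  ln (Jdot 1 p2 p2) / 2 + rB * (t - TB / 2).
Proof. by move=> tT; rewrite mBE logN_rot. Qed.

Let TAge0 : 0 <= TA. Proof. by have := TA0; lra. Qed.
Let TBge0 : 0 <= TB. Proof. by have := TB0; lra. Qed.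

Let L0 : log_gaugeA p1 = ln (Jdot E p1 p1) / 2 + rA * (0 - TA / 2).
Proof. by rewrite -LA_arc ?lexx// jrot0. Qed.

Let LT : log_gaugeA p2 = ln (Jdot E p1 p1) / 2 + rA * (TA - TA / 2).
Proof. by rewrite -LA_arc ?lexx ?TAge0// -p2E. Qed.

Let M0 : logN 1 rB (p2 - k *: p1) p2 =
  ln (Jdot 1 p2 p2) / 2 + rB * (0 - TB / 2).
Proof. by rewrite -LB_arc ?lexx// jrot0. Qed.

(* The two pieces agree on the line of p1 because rhoCC = 1. *)
Lemma log_gaugeAB x : x != 0 -> sector_side x = 0 -> log_gaugeA x = log_gaugeB x.
Proof.
move=> x0 /eqP; rewrite mulf_eq0.
have dec := cross_decomp p1 p2 x.
have wn : cross p1 p2 != 0 by rewrite gt_eqF.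
have A1 : log_gaugeA p1 = log_gaugeA p2 - rA * TA.
  by rewrite L0 LT; ring.
have B3 : logN 1 rB (p2 - k *: p1) (- k *: p1) =
    logN 1 rB (p2 - k *: p1) p2 + rB * TB.
  by rewrite -rotB LB_arc ?lexx ?TBge0// M0; ring.
have B1 : log_gaugeB p1 = log_gaugeA p2 - rA * TA.
  have kn : - k != 0 by rewrite oppr_eq0 gt_eqF.
  move: B3; rewrite logN_scale// normrN gtr0_norm// ln_k /log_gaugeB; lra.
have B2 : log_gaugeB p2 = log_gaugeA p2 by rewrite /log_gaugeB; ring.
case/orP => /eqP z; move: dec; rewrite z scale0r ?add0r ?addr0 => dec.
  have xE : x = (cross p1 x / cross p1 p2) *: p2.
    by apply: (scalerI wn); rewrite scalerA mulrC divfK.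
  have cn : cross p1 x / cross p1 p2 != 0.
    by apply: contra_neq x0 => c0; rewrite xE c0 scale0r.
  by rewrite xE log_gaugeA_scale// log_gaugeB_scale// B2.
have xE : x = (cross x p2 / cross p1 p2) *: p1.
  by apply: (scalerI wn); rewrite scalerA mulrC divfK.
have cn : cross x p2 / cross p1 p2 != 0.
  by apply: contra_neq x0 => c0; rewrite xE c0 scale0r.
by rewrite xE log_gaugeA_scale// log_gaugeB_scale// A1 B1.
Qed.

Lemma log_gauge_pos x : 0 <= sector_side x -> log_gauge x = log_gaugeA x.
Proof. by rewrite /log_gauge => ->. Qed.

Lemma log_gauge_neg x : x != 0 -> sector_side x <= 0 -> log_gauge x = log_gaugeB x.
Proof.
move=> x0 sx; rewrite /log_gauge; case: ifP => // s0.
by apply: log_gaugeAB => //; apply: le_anti; rewrite sx s0.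
Qed.

Lemma side_scale c x : sector_side (c *: x) = c ^+ 2 * sector_side x.
Proof. by rewrite /sector_side crossZl crossZr; ring. Qed.

Lemma log_gauge_scale c x : c != 0 -> x != 0 ->
  log_gauge (c *: x) = log_gauge x + ln `|c|.
Proof.
move=> c0 x0; have c20 : 0 < c ^+ 2 by rewrite exprn_even_gt0.
rewrite /log_gauge side_scale pmulr_rge0//; case: ifP => _.
  exact: log_gaugeA_scale.
exact: log_gaugeB_scale.
Qed.

Lemma gauge_scale c x : gauge (c *: x) = `|c| * gauge x.
Proof.
rewrite /gauge scaler_eq0; case: (eqVneq c 0) => [->|c0] /=.
  by rewrite normr0 mul0r.
case: (eqVneq x 0) => [_|x0]; first by rewrite mulr0.
by rewrite log_gauge_scale// expRD lnK ?posrE ?normr_gt0// mulrC.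
Qed.

Lemma gauge_gt0 x : x != 0 -> 0 < gauge x.
Proof. by move=> x0; rewrite /gauge (negbTE x0) expR_gt0. Qed.

Lemma log_gauge_arcA t : 0 <= t <= TA ->
  log_gauge (expR (- rA * t) *: (jrot E t *m p1)) = log_gauge p1.
Proof.
move=> tT.
have [a0 b0] := rot_sector E0 TA0 p10 tT; rewrite -p2E in a0.
have v0 : jrot E t *m p1 != 0.
  apply/eqP => v0; have := Jdot_gt0 E0 p10.
  have := Jdot_rot t t p1 (lt0r_neq0 E0).
  by rewrite v0 subrr cos0 mul1r => <-; rewrite /Jdot !mxE !(mulr0, mul0r) addr0 ltxx.
rewrite log_gauge_scale ?gt_eqF ?expR_gt0// gtr0_norm ?expR_gt0// expRK.
have s1 : 0 <= sector_side (jrot E t *m p1) by exact: mulr_ge0.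
have s0 : 0 <= sector_side p1.
  by rewrite /sector_side [cross p1 p1]/cross mulrC (_ : _ - _ = 0) ?mul0r//; ring.
rewrite !log_gauge_pos//.
by rewrite LA_arc// L0; ring.
Qed.

Lemma log_gauge_arcB t : 0 <= t <= TB ->
  log_gauge (expR (- rB * t) *: (jrot 1 t *m p2)) = log_gauge p2.
Proof.
move=> tT.
have [a0 b0] := rot_sector one0 TB0 p20 tT.
have v0 : jrot 1 t *m p2 != 0.
  apply/eqP => v0; have := Jdot_gt0 one0 p20.
  have := Jdot_rot t t p2 (lt0r_neq0 one0).
  by rewrite v0 subrr cos0 mul1r => <-; rewrite /Jdot !mxE !(mulr0, mul0r) addr0 ltxx.
have s1 : sector_side (jrot 1 t *m p2) <= 0.
  move: a0; rewrite rotB crossZr crossC mulrN mulNr opprK pmulr_rge0// => a0.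
  by rewrite /sector_side crossC mulNr oppr_le0 mulr_ge0.
have s2 : sector_side p2 <= 0.
  by rewrite /sector_side [cross p2 p2]/cross (_ : _ - _ = 0) ?mul0r//; ring.
rewrite log_gauge_scale ?gt_eqF ?expR_gt0// gtr0_norm ?expR_gt0// expRK.
by rewrite !log_gauge_neg// /log_gaugeB LB_arc// M0; ring.
Qed.

Lemma cvg_side (T : Type) (F : set_system T) (FF : Filter F) (x : T -> 'cV[R]_2) (x0 : 'cV[R]_2) :
  (forall i, (fun t => x t i 0) @ F --> x0 i 0) ->
  (fun t => sector_side (x t)) @ F --> sector_side x0.
Proof.
move=> cx; have cc (p : 'cV[R]_2) i : (fun _ : T => p i 0) @ F --> p i 0 by exact: cvg_cst.
apply: cvgM.
  exact: (@cvg_cross _ _ _ FF x (fun _ => p2) x0 p2 cx (cc p2)).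
exact: (@cvg_cross _ _ _ FF (fun _ => p1) x p1 x0 (cc p1) cx).
Qed.

Lemma log_gauge_cvg (x : 'cV[R]_2) : x != 0 -> log_gauge @ ball1 x --> log_gauge x.
Proof.
move=> x0; have FF := ball1_filter x; have cx := @ball1_coord R x.
have nx : \forall y \near ball1 x, y != 0.
  have c0 := @coord_le_norm1 R x.
  have nx0 : 0 < norm1 x.
    rewrite lt_neqAle norm1_ge0 andbT; apply: contra_neq x0 => n0.
    by apply: norm1_eq0; rewrite -n0.
  exists (norm1 x) => // y /=; apply: contraTneq => ->.
  by rewrite /norm1 !mxE !add0r !normrN ltxx.
have cs := cvg_side FF cx.
have cA : 0 <= sector_side x -> log_gaugeA @ ball1 x --> log_gaugeA x.
  by move=> s0; apply: cvg_logN => //; exact: sideA_neq0.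
have cB : sector_side x <= 0 -> log_gaugeB @ ball1 x --> log_gaugeB x.
  move=> s0; apply: cvgD; last exact: cvg_cst.
  by apply: cvg_logN => //; exact: sideB_neq0.
apply/cvgrPdist_lt => e e0; case: (ltgtP (sector_side x) 0) => sx.
- have s_near : \forall y \near ball1 x, sector_side y < 0 by exact: cvgr_lt cs _ sx.
  have := @cvgr_dist_lt _ _ _ _ FF _ _ (cB (ltW sx)) e e0.
  apply: filterS3 nx s_near => y y0 sy.
  by rewrite !log_gauge_neg// ltW.
- have s_near : \forall y \near ball1 x, 0 < sector_side y by exact: cvgr_gt cs _ sx.
  have := @cvgr_dist_lt _ _ _ _ FF _ _ (cA (ltW sx)) e e0.
  by apply: filterS2 s_near => y sy; rewrite !log_gauge_pos// ltW.
- have sxA : 0 <= sector_side x by rewrite sx.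
  have sxB : sector_side x <= 0 by rewrite sx.
  have hA := @cvgr_dist_lt _ _ _ _ FF _ _ (cA sxA) e e0.
  have hB := @cvgr_dist_lt _ _ _ _ FF _ _ (cB sxB) e e0.
  apply: filterS3 nx hA hB => y y0 yA yB.
  case: (leP 0 (sector_side y)) => sy; first by rewrite !log_gauge_pos.
  by rewrite !log_gauge_neg// ltW.
Qed.

Lemma gauge_continuous : continuous gauge.
Proof.
apply: continuous_norm1 => x e e0; have [->|x0] := eqVneq x 0.
  (* M bounds the arctangent terms and the matching constant, so that [Jdot] below eta puts the
     gauge below e. The minimum with 1 in the radius serves to bound norm1 y ^ 2 by norm1 y. *)
  pose M := (rA + rB) * (pi / 2) +
    `|log_gaugeA p2 - logN 1 rB (p2 - k *: p1) p2|.
  pose eta := expR (2 * (ln e - M)).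
  have E1 := frame_E Hf; have E10 : 0 < E + 1 by lra.
  exists (Num.min 1 (eta / (E + 1))).
    by rewrite lt_min ltr01 divr_gt0// expR_gt0.
  move=> y; rewrite lt_min => /andP[y1 ye].
  rewrite {1}/gauge eqxx sub0r normrN ger0_norm; last first.
    by rewrite /gauge; case: ifP => // _; exact: expR_ge0.
  rewrite /gauge; case: (eqVneq y 0) => // y0.
  have yn : norm1 (0 - y) = norm1 y by rewrite /norm1 !mxE !add0r !normrN.
  rewrite yn in y1 ye.
  have q (c : R) : 1 <= c -> c <= E -> ln (Jdot c y y) < 2 * (ln e - M).
    move=> c1 cE; have c0 : 0 < c by lra.
    rewrite -ltr_expR lnK ?posrE ?Jdot_gt0//.
    apply: le_lt_trans (Jdot_le y c1 cE) _; rewrite mulrC -ltr_pdivlMr//.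
    apply: le_lt_trans ye; rewrite expr2 ler_piMl ?norm1_ge0// ltW//.
  have at_ (c z : R) : 0 < c -> c * atan z < c * (pi / 2).
    by move=> c0; rewrite ltr_pM2l// atan_ltpi2.
  have pi2 : 0 < pi / 2 :> R by rewrite divr_gt0// pi_gt0.
  have rAp := mulr_gt0 rA0 pi2; have rBp := mulr_gt0 rB0 pi2.
  have nn := normr_ge0 (log_gaugeA p2 - logN 1 rB (p2 - k *: p1) p2).
  have nl := ler_norm (log_gaugeA p2 - logN 1 rB (p2 - k *: p1) p2).
  rewrite -[ltRHS]lnK ?posrE// ltr_expR /log_gauge; case: ifP => _.
    have q1 := q E (ltW E1) (lexx _).
    have a1 := at_ rA (cross (p1 + p2) y / Jdot E (p1 + p2) y) rA0.
    by rewrite /log_gaugeA /logN; move: q1 a1; rewrite /M; lra.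
  have q1 := q 1 (lexx _) (ltW E1).
  have a1 := at_ rB (cross (p2 - k *: p1) y / Jdot 1 (p2 - k *: p1) y) rB0.
  rewrite /log_gaugeB {1}/logN; move: q1 a1 nl; rewrite /M; lra.
have nx0 : 0 < norm1 x.
  rewrite lt_neqAle norm1_ge0 andbT; apply: contra_neq x0 => n0.
  by apply: norm1_eq0; rewrite -n0.
have FF := ball1_filter x.
have c1 : (fun y => expR (log_gauge y)) @ ball1 x --> expR (log_gauge x).
  by apply: (continuous_cvg _ _ (log_gauge_cvg x0)); exact: continuous_expR.
have [d d0 Hd] := @cvgr_dist_lt _ _ _ _ FF _ _ c1 e e0.
exists (Num.min d (norm1 x)); first by rewrite lt_min; apply/andP.
move=> y; rewrite lt_min => /andP[yd yx].
have y0 : y != 0.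
  apply: contraTneq yx => ->; by rewrite subr0 ltxx.
rewrite /gauge (negbTE x0) (negbTE y0); apply: Hd => /=.
by move: yd; rewrite /norm1 !mxE distrC (distrC (x 1 0)).
Qed.

(** * Decrease of the gauge along all trajectories *)

Section Decay.
Variables (sA sB dA dB c : R).
Hypotheses (sA0 : 0 < sA) (sB0 : 0 < sB).
Hypotheses (cA : c <= sA * dA) (cB : c <= sB * dB).
Let S : system R := (sA *: nfA E (rA + dA), sB *: nfA 1 (rB + dB)).

(** Off the switching lines one formula for the gauge holds on a whole right neighbourhood. On a
    line nothing is known of the side entered next, but both pieces have the same value there and
    both obey the estimate, so either may hold just after. The rate c is a common lower bound of the
    excess dampings dA and dB in the time scales sA and sB. *)
Lemma log_gauge_decay u x : switching_signal u -> trajectory S u x ->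
  (forall s : R, 0 <= s -> x s != 0) ->
  forall s t : R, 0 <= s <= t -> log_gauge (x t) <= log_gauge (x s) - c * (t - s).
Proof.
move=> su tx xn s t /andP[s0 st].
have cl : cont_ge0 (fun r => log_gauge (x r)).
  move=> r r0 e e0; have FF := ball1_filter (x r).
  have [d d0 Hd] := @cvgr_dist_lt _ _ _ _ FF _ _ (log_gauge_cvg (xn r r0)) e e0.
  have [d' d'0 Hd'] := trajectory_norm1 tx r0 d0.
  by exists d' => // q q0 qd; rewrite distrC; apply: Hd => /=; exact: Hd'.
have [c' c'0 fc] := frame_cross Hf.
have bA r : 0 <= r -> 0 <= sector_side (x r) -> forall g : R, 0 < g ->
    exists2 d : R, 0 < d & forall h : R, 0 < h < d ->
    log_gaugeA (x (r + h)) <= log_gaugeA (x r) + (- c + g) * h.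
  move=> r0 sr; have Q0 := Jdot_gt0 E0 (xn r r0).
  have J0 := sideA_neq0 (xn r r0) sr.
  have q0 : 0 <= c' * sector_side (x r) by rewrite mulr_ge0// ltW.
  have cQA : c * Jdot E (x r) (x r) <= sA * dA * Jdot E (x r) (x r).
    by rewrite ler_wpM2r// ltW.
  have cQB : c * Jdot E (x r) (x r) <= sB * dB * Jdot E (x r) (x r).
    by rewrite ler_wpM2r// ltW.
  apply: (logN_trajectory su tx r0 E0 (xn r r0) J0); rewrite /= cross_shift cross_nfA.
    by rewrite [cross (nfA _ _ *m _) _](_ : _ = 0); [lra|rewrite /cross; ring].
  rewrite (crossC (nfA 1 rB *m x r)) fc -/(sector_side (x r)).
  have : 0 <= sB * (c' * sector_side (x r)) by rewrite mulr_ge0// ltW.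
  lra.
have bB r : 0 <= r -> sector_side (x r) <= 0 -> forall g : R, 0 < g ->
    exists2 d : R, 0 < d & forall h : R, 0 < h < d ->
    log_gaugeB (x (r + h)) <= log_gaugeB (x r) + (- c + g) * h.
  move=> r0 sr g g0; have Q0 := Jdot_gt0 one0 (xn r r0).
  have J0 := sideB_neq0 (xn r r0) sr.
  have q0 : c' * sector_side (x r) <= 0 by rewrite mulr_ge0_le0// ltW.
  have cQA : c * Jdot 1 (x r) (x r) <= sA * dA * Jdot 1 (x r) (x r).
    by rewrite ler_wpM2r// ltW.
  have cQB : c * Jdot 1 (x r) (x r) <= sB * dB * Jdot 1 (x r) (x r).
    by rewrite ler_wpM2r// ltW.
  have [||d d0 Hd] := logN_trajectory (r := rB) (c := - c) su tx r0 one0 (xn r r0) J0 _ _ g0.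
  - rewrite /= cross_shift cross_nfA fc -/(sector_side (x r)).
    have : sA * (c' * sector_side (x r)) <= 0 by rewrite mulr_ge0_le0// ltW.
    lra.
  - rewrite /= cross_shift cross_nfA.
    by rewrite [cross (nfA _ _ *m _) _](_ : _ = 0); [lra|rewrite /cross; ring].
  by exists d => // h /Hd; rewrite /log_gaugeB; lra.
pose f (r : R) := log_gauge (x r) + c * r.
suff : f t <= f s by rewrite /f; lra.
apply: dini_cont => //.
  apply: cont_ge0D => //; apply/within_ge0P; apply: continuous_subspaceT.
  exact: mulrl_continuous.
move=> r /andP[sr rt] g g0; have r0 : 0 <= r by exact: le_trans sr.
rewrite /f; case: (ltgtP (sector_side (x r)) 0) => xr.
- have [d d0 Hd] := bB r r0 (ltW xr) g g0.
  have FF := ball1_filter (x r).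
  have [d2 d20 Hd2] : \forall y \near ball1 (x r), sector_side y < 0.
    exact: cvgr_lt (cvg_side FF (@ball1_coord R (x r))) _ xr.
  have [d3 d30 Hd3] := trajectory_norm1 tx r0 d20.
  exists (Num.min d d3); first by rewrite lt_min d0.
  move=> h; rewrite lt_min => /and3P[h0 hd hd3] _.
  have sh : sector_side (x (r + h)) < 0.
    by apply: Hd2; apply: Hd3; [lra|rewrite addrAC subrr add0r gtr0_norm].
  have rh0 : 0 <= r + h by rewrite addr_ge0// ltW.
  rewrite !log_gauge_neg ?xn ?(ltW xr) ?(ltW sh)//.
  by have := Hd h; rewrite h0 hd => /(_ isT); lra.
- have [d d0 Hd] := bA r r0 (ltW xr) g g0.
  have FF := ball1_filter (x r).
  have [d2 d20 Hd2] : \forall y \near ball1 (x r), 0 < sector_side y.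
    exact: cvgr_gt (cvg_side FF (@ball1_coord R (x r))) _ xr.
  have [d3 d30 Hd3] := trajectory_norm1 tx r0 d20.
  exists (Num.min d d3); first by rewrite lt_min d0.
  move=> h; rewrite lt_min => /and3P[h0 hd hd3] _.
  have sh : 0 < sector_side (x (r + h)).
    by apply: Hd2; apply: Hd3; [lra|rewrite addrAC subrr add0r gtr0_norm].
  rewrite !log_gauge_pos ?(ltW xr) ?(ltW sh)//.
  by have := Hd h; rewrite h0 hd => /(_ isT); lra.
- have xr1 : 0 <= sector_side (x r) by rewrite xr.
  have xr2 : sector_side (x r) <= 0 by rewrite xr.
  have [d d0 Hd] := bA r r0 xr1 g g0; have [d2 d20 Hd2] := bB r r0 xr2 g g0.
  exists (Num.min d d2); first by rewrite lt_min d0.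
  move=> h; rewrite lt_min => /and3P[h0 hd hd2] _.
  have rh0 : 0 <= r + h by rewrite addr_ge0// ltW.
  have := Hd h; have := Hd2 h; rewrite h0 hd hd2 => /(_ isT) h1 /(_ isT) h2.
  case: (leP 0 (sector_side (x (r + h)))) => sh.
    by rewrite !log_gauge_pos//; lra.
  by rewrite !log_gauge_neg ?xn ?(ltW sh)//; lra.
Qed.

End Decay.

Lemma gauge_clf (sA sB dA dB : R) : 0 < sA -> 0 < sB -> 0 < dA -> 0 < dB ->
  clf (sA *: nfA E (rA + dA), sB *: nfA 1 (rB + dB)) gauge.
Proof.
move=> sA0 sB0 dA0 dB0; split.
- exact: gauge_continuous.
- by rewrite /gauge eqxx.
- exact: gauge_gt0.
- move=> u x su tx nc s t s0 st.
  have xn := trajectory_nonzero su tx nc.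
  pose c := Num.min (sA * dA) (sB * dB).
  have c0 : 0 < c by rewrite lt_min !mulr_gt0.
  have t0 : 0 <= t by lra.
  rewrite /gauge (negbTE (xn s s0)) (negbTE (xn t t0)) ltr_expR.
  have cA : c <= sA * dA by rewrite ge_min lexx.
  have cB : c <= sB * dB by rewrite ge_min lexx orbT.
  have := log_gauge_decay sA0 sB0 cA cB su tx xn (s := s) (t := t).
  rewrite s0 (ltW st) => /(_ isT).
  have : 0 < c * (t - s) by rewrite mulr_gt0// subr_gt0.
  lra.
Qed.

End Gauge.

(** * Worst trajectories *)

Lemma dotv_gt0 (R : realType) (x : 'cV[R]_2) : x != 0 -> 0 < dotv x x.
Proof.
move=> x0; have := Jdot_gt0 ltr01 x0.
by rewrite /Jdot /dotv mul1r divr1.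
Qed.

Lemma enorm_gt0 (R : realType) (x : 'cV[R]_2) : x != 0 -> 0 < enorm x.
Proof. by move=> x0; rewrite sqrtr_gt0 dotv_gt0. Qed.

Lemma sqr_enorm (R : realType) (x : 'cV[R]_2) : enorm x ^+ 2 = dotv x x.
Proof. by rewrite sqr_sqrtr// /dotv -!expr2 addr_ge0// sqr_ge0. Qed.

(** Lagrange's identity dot ^ 2 + cross ^ 2 = |v| ^ 2 |x| ^ 2 turns the arccosine into the
    arctangent of a cotangent, free of square roots. *)
Lemma abs_angleE (R : realType) (v x : 'cV[R]_2) : x != 0 -> 0 < cross x v ->
  abs_angle v x = pi / 2 - atan (dotv v x / cross x v).
Proof.
move=> x0 c0; set z := dotv v x / cross x v.
have lag : dotv v v * dotv x x = cross x v ^+ 2 * (1 + z ^+ 2).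
  have cn : cross x v != 0 by rewrite gt_eqF.
  have -> : cross x v ^+ 2 * (1 + z ^+ 2) = cross x v ^+ 2 + dotv v x ^+ 2.
    by rewrite /z; field.
  by rewrite /dotv /cross; ring.
have cz : 0 < cos (atan z) by apply: cos_gt0_pihalf; rewrite atan_gtNpi2 atan_ltpi2.
have z1 : 0 < 1 + z ^+ 2 by rewrite ltr_pwDl// sqr_ge0.
have -> : abs_angle v x = acos (sin (atan z)).
  rewrite /abs_angle; congr acos.
  rewrite /enorm -sqrtrM; last by rewrite /dotv -!expr2 addr_ge0// sqr_ge0.
  rewrite lag sqrtrM ?sqr_ge0// sqrtr_sqr gtr0_norm// sin_atanE cos_atan.
  by rewrite invfM mulrA.
rewrite -cosBpihalf -cosN opprB cosK// in_itv/=.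
by have := atan_gtNpi2 z; have := atan_ltpi2 z => h1 h2; apply/andP; split; lra.
Qed.

(** Counterclockwise from x the angle decreases with the cotangent, and the cross-multiplied
    difference of the two cotangents is |x| ^ 2 cross(v, w). *)
Lemma abs_angle_le (R : realType) (v w x : 'cV[R]_2) : x != 0 ->
  0 < cross x v -> 0 < cross x w ->
  (abs_angle v x <= abs_angle w x) = (0 <= cross v w).
Proof.
move=> x0 v0 w0; rewrite !abs_angleE// lerD2l lerN2 -[LHS]negbK -ltNge.
have atanE (a b : R) : (atan a < atan b) = (a < b).
  by apply/idP/idP; [apply: contraTT; rewrite -!leNgt; exact: le_atan|exact: lt_atan].
rewrite atanE -leNgt ler_pdivrMr// mulrAC ler_pdivlMr//.
have X0 := dotv_gt0 x0.
rewrite -(pmulr_rge0 _ X0) -subr_ge0; congr (0 <= _).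
by rewrite /dotv /cross; ring.
Qed.

Lemma polar_scale (R : realType) (r a : R) : polar r a = r *: polar 1 a.
Proof. by apply: cV2P; rewrite !mxE/= !mul1r. Qed.

Lemma polar1_neq0 (R : realType) (a : R) : polar 1 a != 0.
Proof.
apply/eqP => p0; have := cos2Dsin2 a.
have c0 : cos a = 0.
  by have := congr1 (fun z : 'cV[R]_2 => z 0 0) p0; rewrite !mxE/= mul1r.
have s0 : sin a = 0.
  by have := congr1 (fun z : 'cV[R]_2 => z 1 0) p0; rewrite !mxE/= mul1r.
by move/eqP; rewrite c0 s0 expr0n addr0 eq_sym oner_eq0.
Qed.

Lemma polar_argK (R : realType) (x : 'cV[R]_2) : x != 0 ->
  polar (enorm x) (polar_arg x) = x.
Proof.
move=> x0; have n0 := enorm_gt0 x0; have nn0 : enorm x != 0 by rewrite gt_eqF.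
have X : enorm x ^+ 2 = x 0 0 ^+ 2 + x 1 0 ^+ 2 by rewrite sqr_enorm /dotv -!expr2.
have z1 : -1 <= x 0 0 / enorm x <= 1.
  rewrite -ler_norml normrM normfV (gtr0_norm n0) ler_pdivrMr// mul1r.
  exact: coord_le_enorm.
have ca : cos (acos (x 0 0 / enorm x)) = x 0 0 / enorm x by rewrite acosK// in_itv.
have sa : sin (acos (x 0 0 / enorm x)) = `|x 1 0| / enorm x.
  rewrite sin_acos// -[RHS]ger0_norm ?divr_ge0 ?enorm_ge0//.
  rewrite -sqrtr_sqr; congr Num.sqrt.
  rewrite !expr_div_n real_normK ?num_real//.
  have -> : x 1 0 ^+ 2 = enorm x ^+ 2 - x 0 0 ^+ 2 by rewrite X; ring.
  by field.
rewrite /polar_arg; case: (leP 0 (x 1 0)) => s; apply: cV2P; rewrite !mxE/=.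
- by rewrite ca mulrC divfK.
- by rewrite sa (ger0_norm s) mulrC divfK.
- by rewrite cosN ca mulrC divfK.
- by rewrite sinN sa (ltr0_norm s) mulNr opprK mulrC divfK.
Qed.

(** * Uniqueness of worst trajectories *)

Section Worst.
Variables (R : realType) (E rA rB TA TB : R) (p1 p2 : 'cV[R]_2) (k : R).
Hypothesis Hf : frame E rA rB TA TB p1 p2 k.

Let E0 : 0 < E. Proof. by have := frame_E Hf; lra. Qed.
Let p10 : p1 != 0. Proof. exact: frame_p1 Hf. Qed.
Let p2E : p2 = jrot E TA *m p1. Proof. exact: frame_rotA Hf. Qed.
Let TA0 : 0 < TA < pi. Proof. exact: frame_TA Hf. Qed.
Let one0 : 0 < 1 :> R. Proof. exact: ltr01. Qed.
Let w0 : 0 < cross p1 p2.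
Proof. by rewrite p2E; exact: cross_rot_gt0. Qed.
Let p20 : p2 != 0.
Proof.
by apply/eqP => z; move: w0; rewrite z /cross !mxE !mulr0 subrr ltxx.
Qed.

Local Notation S := (nf E rA rB).
Local Notation side := (sector_side p1 p2).

Definition worst_at (v : R) (x : 'cV[R]_2) : Prop :=
  (v = 1 /\ abs_angle (S.1 *m x) x <= abs_angle (S.2 *m x) x) \/
  (v = 0 /\ abs_angle (S.2 *m x) x <= abs_angle (S.1 *m x) x).

Lemma worst_atP v x : x != 0 ->
  worst_at v x <-> (v = 1 /\ 0 <= side x) \/ (v = 0 /\ side x <= 0).
Proof.
move=> x0; have [c c0 fc] := frame_cross Hf.
have hA : 0 < cross x (S.1 *m x) by rewrite cross_nfA Jdot_gt0.
have hB : 0 < cross x (S.2 *m x) by rewrite /= nfBE cross_nfA Jdot_gt0.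
have q : cross (S.1 *m x) (S.2 *m x) = c * side x by rewrite /= nfBE fc.
by rewrite /worst_at !abs_angle_le// (crossC (S.2 *m x)) q oppr_ge0 pmulr_rge0// pmulr_rle0.
Qed.

Lemma trajectory_near u x t (P : 'cV[R]_2 -> Prop) :
  trajectory S u x -> 0 <= t -> (\forall z \near ball1 (x t), P z) ->
  exists2 d : R, 0 < d & forall s : R, t <= s < t + d -> P (x s).
Proof.
move=> tx t0 [e /= e0 He]; have [d d0 Hd] := trajectory_norm1 tx t0 e0.
exists d => // s /andP[ts st]; apply: He; apply: Hd; first lra.
by rewrite ger0_norm; lra.
Qed.

Lemma near_cross (p x : 'cV[R]_2) : 0 < cross p x ->
  \forall z \near ball1 x, 0 < cross p z.
Proof.
move=> c0; have FF := ball1_filter x.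
have cc : (fun z => cross p z) @ ball1 x --> cross p x.
  apply: (@cvg_cross _ _ _ FF (fun _ => p)) => i; first exact: cvg_cst.
  exact: ball1_coord.
exact: cvgr_gt cc _ c0.
Qed.

Lemma near_cross_mulmx (p x : 'cV[R]_2) (M : 'M[R]_2) (e : R) :
  e < cross p (M *m x) -> \forall z \near ball1 x, e < cross p (M *m z).
Proof.
move=> c0; have FF := ball1_filter x.
have cc : (fun z => cross p (M *m z)) @ ball1 x --> cross p (M *m x).
  apply: (@cvg_cross _ _ _ FF (fun _ => p) (fun z => M *m z)) => i.
    exact: cvg_cst.
  by apply: (@cvg_mulmx_coord _ _ _ FF id) => j; exact: ball1_coord.
exact: cvgr_gt cc _ c0.
Qed.

(** Both velocities at x t point to the positive side of the line of p, so the trajectory enters it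
    at once, whatever the signal does. *)
Lemma cross_leaves u x (t : R) (p : 'cV[R]_2) :
  switching_signal u -> trajectory S u x -> 0 <= t -> cross p (x t) = 0 ->
  0 < cross p (S.1 *m x t) -> 0 < cross p (S.2 *m x t) ->
  exists2 d : R, 0 < d & forall s : R, t < s < t + d -> 0 < cross p (x s).
Proof.
move=> su tx t0 z c1 c2.
pose e := Num.min (cross p (S.1 *m x t)) (cross p (S.2 *m x t)) / 2.
have m0 : 0 < Num.min (cross p (S.1 *m x t)) (cross p (S.2 *m x t)).
  by rewrite lt_min c1.
have e0 : 0 < e by rewrite divr_gt0.
have e1 : e < cross p (S.1 *m x t).
  by apply: (@lt_le_trans _ _ (Num.min (cross p (S.1 *m x t)) (cross p (S.2 *m x t))));
    [rewrite /e; lra|rewrite ge_min lexx].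
have e2 : e < cross p (S.2 *m x t).
  by apply: (@lt_le_trans _ _ (Num.min (cross p (S.1 *m x t)) (cross p (S.2 *m x t))));
    [rewrite /e; lra|rewrite ge_min lexx orbT].
have [d1 d10 H1] := trajectory_near tx t0 (near_cross_mulmx e1).
have [d2 d20 H2] := trajectory_near tx t0 (near_cross_mulmx e2).
exists (Num.min d1 d2); first by rewrite lt_min d10.
move=> s /andP[ts]; rewrite -ltrBlDl lt_min => /andP[s1 s2].
have pr := primitive_lin (- p 1 0) (p 0 0) (trajectory_primitive 0 su tx)
  (trajectory_primitive 1 su tx).
have ts' : 0 <= t <= s by rewrite t0 ltW.
have := primitive_ge (c := e) pr ts'.
have -> : - p 1 0 * x s 0 0 + p 0 0 * x s 1 0 - (- p 1 0 * x t 0 0 + p 0 0 * x t 1 0)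
    = cross p (x s) - cross p (x t) by rewrite /cross; ring.
rewrite z subr0 => H; apply: lt_le_trans (H _).
  by rewrite mulr_gt0// subr_gt0.
move=> r /andP[tr rs].
have /andP[u0 u1] : 0 <= u r <= 1 by apply: su.2; lra.
have h1 : e < cross p (S.1 *m x r) by apply: H1; lra.
have h2 : e < cross p (S.2 *m x r) by apply: H2; lra.
have -> : - p 1 0 * velocity S u x r 0 0 + p 0 0 * velocity S u x r 1 0 =
    u r * cross p (S.1 *m x r) + (1 - u r) * cross p (S.2 *m x r).
  by rewrite !velocityE /cross !(mulmx2E _ (x r)); ring.
have g1 : u r * e <= u r * cross p (S.1 *m x r) by rewrite ler_wpM2l// ltW.
have g2 : (1 - u r) * e <= (1 - u r) * cross p (S.2 *m x r).
  by rewrite ler_wpM2l ?subr_ge0// ltW.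
lra.
Qed.

(* From the line of p1 a trajectory enters the sector of A, from the line of p2
   that of B. *)
Definition next_signal (x : 'cV[R]_2) : R :=
  if 0 < side x then 1 else if side x < 0 then 0
  else if cross p1 x == 0 then 1 else 0.

Lemma sideN (x : 'cV[R]_2) : side (- x) = side x.
Proof. by rewrite -scaleN1r side_scale sqrrN expr1n mul1r. Qed.

(** The signal is ambiguous only on a switching line. Since both matrices turn counterclockwise,
    such a line is left at once into a known sector, so just after t the signal is a function of x t
    alone. *)
Lemma worst_next u x (t : R) : switching_signal u -> trajectory S u x ->
  (forall s : R, 0 <= s -> x s != 0) -> (forall s : R, 0 <= s -> worst_at (u s) (x s)) ->
  0 <= t ->
  exists2 d : R, 0 < d & forall s : R, t < s < t + d -> u s = next_signal (x t).
Proof.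
move=> su tx xn wu t0.
have u1 s : 0 <= s -> 0 < side (x s) -> u s = 1.
  move=> s0 ss; have /(worst_atP _ (xn s s0)) := wu s s0.
  by case=> [[]//|[_]]; rewrite leNgt ss.
have u0 s : 0 <= s -> side (x s) < 0 -> u s = 0.
  move=> s0 ss; have /(worst_atP _ (xn s s0)) := wu s s0.
  by case=> [[_]|[]//]; rewrite leNgt ss.
have FF := ball1_filter (x t).
have cs := @cvg_side _ p1 p2 _ _ FF id (x t) (@ball1_coord R (x t)).
have dec := cross_decomp p1 p2 (x t).
have wn : cross p1 p2 != 0 by rewrite gt_eqF.
have nfE1 v : cross v (S.1 *m v) = Jdot E v v by rewrite cross_nfA.
have nfE2 v : cross v (S.2 *m v) = Jdot 1 v v by rewrite /= nfBE cross_nfA.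
have crossZM p c v (M : 'M[R]_2) : cross p (M *m (c *: v)) = c * cross p (M *m v).
  by rewrite -scalemxAr crossZr.
rewrite /next_signal; case: (ltgtP (side (x t)) 0) => st.
- have st' : \forall z \near ball1 (x t), side z < 0 by exact: cvgr_lt cs _ st.
  have [d d0 Hd] := trajectory_near tx t0 st'.
  by exists d => // s sd; apply: u0; [lra|apply: Hd; lra].
- have st' : \forall z \near ball1 (x t), 0 < side z by exact: cvgr_gt cs _ st.
  have [d d0 Hd] := trajectory_near tx t0 st'.
  by exists d => // s sd; apply: u1; [lra|apply: Hd; lra].
- case: (eqVneq (cross p1 (x t)) 0) => b0.
  + move: dec; rewrite b0 scale0r addr0 => dec.
    pose c := cross (x t) p2 / cross p1 p2.
    have xE : x t = c *: p1 by apply: (scalerI wn); rewrite scalerA mulrC divfK.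
    have c0 : c != 0 by apply: contra_neq (xn t t0) => z; rewrite xE z scale0r.
    (* Testing against c p1 rather than p1 treats both signs of c together; the side gets multiplied
       by c ^ 2 only. *)
    have b0' : cross (c *: p1) (x t) = 0 by rewrite crossZl b0 mulr0.
    have c20 : 0 < c * c by rewrite -expr2 exprn_even_gt0.
    have l1 : 0 < cross (c *: p1) (S.1 *m x t).
      by rewrite xE crossZl crossZM mulrA nfE1 mulr_gt0// Jdot_gt0.
    have l2 : 0 < cross (c *: p1) (S.2 *m x t).
      by rewrite xE crossZl crossZM mulrA nfE2 mulr_gt0// Jdot_gt0.
    have [d1 d10 H1] := cross_leaves su tx t0 b0' l1 l2.
    have a0 : 0 < cross (- c *: p2) (x t).
      rewrite (_ : cross _ _ = c * c * cross p1 p2); first exact: mulr_gt0.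
      by rewrite crossZl xE crossZr (crossC p2); ring.
    have [d2 d20 H2] := trajectory_near tx t0 (near_cross a0).
    exists (Num.min d1 d2); first by rewrite lt_min d10.
    move=> s /andP[ts]; rewrite -ltrBlDl lt_min => /andP[s1 s2].
    apply: u1; first lra.
    have h1 : 0 < cross (c *: p1) (x s) by apply: H1; lra.
    have h2 : 0 < cross (- c *: p2) (x s) by apply: H2; lra.
    rewrite -(pmulr_rgt0 _ c20).
    have -> : c * c * side (x s) = cross (- c *: p2) (x s) * cross (c *: p1) (x s).
      by rewrite /sector_side !crossZl (crossC (x s)); ring.
    exact: mulr_gt0.
  + have a0 : cross (x t) p2 = 0.
      by move/eqP: st; rewrite mulf_eq0 (negbTE b0) orbF => /eqP.
    move: dec; rewrite a0 scale0r add0r => dec.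
    pose c := cross p1 (x t) / cross p1 p2.
    have xE : x t = c *: p2 by apply: (scalerI wn); rewrite scalerA mulrC divfK.
    have c0 : c != 0 by apply: contra_neq (xn t t0) => z; rewrite xE z scale0r.
    have a0' : cross (c *: p2) (x t) = 0 by rewrite crossZl crossC a0 oppr0 mulr0.
    have c20 : 0 < c * c by rewrite -expr2 exprn_even_gt0.
    have l1 : 0 < cross (c *: p2) (S.1 *m x t).
      by rewrite xE crossZl crossZM mulrA nfE1 mulr_gt0// Jdot_gt0.
    have l2 : 0 < cross (c *: p2) (S.2 *m x t).
      by rewrite xE crossZl crossZM mulrA nfE2 mulr_gt0// Jdot_gt0.
    have [d1 d10 H1] := cross_leaves su tx t0 a0' l1 l2.
    have b1 : 0 < cross (c *: p1) (x t).
      by rewrite crossZl xE crossZr mulrA mulr_gt0.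
    have [d2 d20 H2] := trajectory_near tx t0 (near_cross b1).
    exists (Num.min d1 d2); first by rewrite lt_min d10.
    move=> s /andP[ts]; rewrite -ltrBlDl lt_min => /andP[s1 s2].
    apply: u0; first lra.
    have h1 : 0 < cross (c *: p2) (x s) by apply: H1; lra.
    have h2 : 0 < cross (c *: p1) (x s) by apply: H2; lra.
    rewrite -oppr_gt0 -(pmulr_rgt0 _ c20).
    have -> : c * c * - side (x s) = cross (c *: p2) (x s) * cross (c *: p1) (x s).
      by rewrite /sector_side !crossZl (crossC (x s)); ring.
    exact: mulr_gt0.
Qed.

Lemma trajectory_nz u x : switching_signal u -> trajectory S u x -> x 0 != 0 ->
  forall s : R, 0 <= s -> x s != 0.
Proof.
move=> su tx x0 s s0; apply: contra_neq x0 => xs.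
exact: trajectory_zero su tx s0 xs (lexx 0).
Qed.

(** Continuity passes equality to limits. After a time of equality the two signals coincide by
    [worst_next], so the difference solves a single linear equation and [gronwall_zero] applies. *)
Lemma worst_unique (x y : R -> 'cV[R]_2) :
  worst_trajectory S x -> worst_trajectory S y -> x 0 = y 0 ->
  forall t : R, 0 <= t -> x t = y t.
Proof.
move=> [x0 [u [su tx wx]]] [y0 [v [sv ty wy]]] xy0 b b0.
have xn := trajectory_nz su tx x0; have yn := trajectory_nz sv ty y0.
apply: (@real_induction R (fun t => x t = y t) 0 b); last by rewrite b0 lexx.
- move=> t /andP[t0 tb] IH; have [t_0|tn0] := eqVneq t 0; first by rewrite t_0.
  have tp : 0 < t by rewrite lt_neqAle eq_sym tn0.
  apply/eqP; rewrite -subr_eq0; apply/eqP; apply: norm1_eq0.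
  apply/ler_addgt0Pr => e e0; rewrite add0r.
  have e20 : 0 < e / 2 by rewrite divr_gt0.
  have [d1 d10 H1] := trajectory_norm1 tx t0 e20.
  have [d2 d20 H2] := trajectory_norm1 ty t0 e20.
  pose s := Num.max 0 (t - Num.min d1 d2 / 2).
  have d0 : 0 < Num.min d1 d2 by rewrite lt_min d10.
  have s0 : 0 <= s by rewrite le_max lexx.
  have st : s < t by rewrite gt_max tp/=; lra.
  have sd : `|s - t| < Num.min d1 d2.
    rewrite ltr0_norm ?subr_lt0// opprB.
    have : t - Num.min d1 d2 / 2 <= s by rewrite le_max lexx orbT.
    lra.
  move: sd; rewrite lt_min => /andP[/(H1 s s0) h1 /(H2 s s0) h2].
  have xy := IH s s0 st; move: h1 h2; rewrite xy /norm1 !mxE => h1 h2.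
  have g0 := ler_distD (y s 0 0) (x t 0 0) (y t 0 0).
  have g1 := ler_distD (y s 1 0) (x t 1 0) (y t 1 0).
  rewrite (distrC (x t 0 0) (y s 0 0)) in g0; rewrite (distrC (x t 1 0) (y s 1 0)) in g1.
  lra.
- move=> t t0 tb IH; have xyt : x t = y t by apply: IH; rewrite t0 lexx.
  have [d1 d10 H1] := worst_next su tx xn wx t0.
  have [d2 d20 H2] := worst_next sv ty yn wy t0.
  pose L := entry_sum S + 1.
  have L0 : 0 < L by have := entry_sum_ge0 S; rewrite /L; lra.
  (* Half of the distance, because [worst_next] describes the signals on an open interval and
     [gronwall_zero] needs a closed one. *)
  pose eta := Num.min (Num.min d1 d2 / 2) (4 * L)^-1.
  have d0 : 0 < Num.min d1 d2 by rewrite lt_min d10.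
  have eta0 : 0 < eta by rewrite lt_min divr_gt0// invr_gt0 mulr_gt0.
  have etad : eta <= Num.min d1 d2 / 2 by rewrite ge_min lexx.
  exists eta => // r rt; apply/eqP; rewrite -subr_eq0; apply/eqP.
  apply: (@gronwall_zero _ (fun s => x s - y s)
    (fun s => velocity S u x s - velocity S v y s) L t (t + eta) t).
  + move=> i; have := primitive_lin 1 (-1) (trajectory_primitive i su tx)
      (trajectory_primitive i sv ty).
    rewrite [X in primitive_on X _ -> _](_ : _ = fun s => (x s - y s) i 0); last first.
      by apply/funext => s; rewrite !mxE; ring.
    rewrite [X in primitive_on _ X -> _](_ : _ = fun s => (velocity S u x s - velocity S v y s) i 0)//.
    by apply/funext => s; rewrite [in RHS]mxE [X in _ = _ + X]mxE; ring.
  + move=> i.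
    rewrite (_ : (fun s => _) = fun s => x s i 0 + - y s i 0); last first.
      by apply/funext => s; rewrite !mxE.
    apply: (cont_ge0D (within_coord tx.1 i)).
    exact: (cont_ge0N (within_coord ty.1 i)).
  + exact: t0.
  + by rewrite lexx; lra.
  + exact: ltW.
  + rewrite (_ : t + eta - t = eta); last by ring.
    have : eta <= (4 * L)^-1 by rewrite ge_min lexx orbT.
    have h : 0 < 4 * L by rewrite mulr_gt0.
    by move=> h'; rewrite -(@ler_pdivlMl _ (4 * L))// mulr1.
  + move=> s i /andP[ts st].
    have m1 : Num.min d1 d2 <= d1 by rewrite ge_min lexx.
    have m2 : Num.min d1 d2 <= d2 by rewrite ge_min lexx orbT.
    have us : u s = next_signal (x t) by apply: H1; lra.
    have vs : v s = next_signal (x t) by rewrite xyt; apply: H2; lra.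
    have -> : (velocity S u x s - velocity S v y s) i 0 =
        velocity S u (fun r => x r - y r) s i 0.
      by rewrite velocityB [LHS]mxE [X in _ + X]mxE !velocityE us vs.
    have u01 : 0 <= u s <= 1 by apply: su.2; lra.
    apply: (le_trans (velocity_le S (fun r => x r - y r) i u01)).
    by rewrite ler_wpM2r ?norm1_ge0// /L; lra.
  + by rewrite xyt subrr.
  + lra.
Qed.

End Worst.

Lemma flow_nfA (R : realType) (e r : R) : 0 < e ->
  is_flow (nfA e r) (fun t => expR (- r * t) *: jrot e t).
Proof.
move=> e0; have en0 : e != 0 by rewrite gt_eqF.
split.
  rewrite mulr0 expR0 scale1r; apply/matrixP => i j; rewrite !mxE.
  by case: (ord2P i) => ->; case: (ord2P j) => -> /=; rewrite ?sin0 ?cos0 ?mul0r ?mulr0 ?oppr0.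
move=> t i j.
have dw : is_derive t 1 (fun t => - r * t) (- r).
  by apply: is_derive_eq; rewrite /GRing.scale/= mulr1.
have de : is_derive t 1 (fun t => expR (- r * t)) (expR (- r * t) * - r).
  exact: is_derive1_comp (is_derive_expR (- r * t)) dw.
have dc := is_derive_cos t; have ds := is_derive_sin t.
rewrite mulmx22E !mxE; case: (ord2P i) => ->; case: (ord2P j) => -> /=.
- rewrite (_ : (fun t => _) = fun t => expR (- r * t) * cos t); last first.
    by apply/funext => s; rewrite !mxE.
  by apply: is_derive_eq; rewrite /GRing.scale/=; field.
- rewrite (_ : (fun t => _) = fun t => (- e^-1) * (expR (- r * t) * sin t)); last first.
    by apply/funext => s; rewrite !mxE/=; ring.
  by apply: is_derive_eq; rewrite /GRing.scale/=; field.
- rewrite (_ : (fun t => _) = fun t => e * (expR (- r * t) * sin t)); last first.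
    by apply/funext => s; rewrite !mxE/=; ring.
  by apply: is_derive_eq; rewrite /GRing.scale/=; field.
- rewrite (_ : (fun t => _) = fun t => expR (- r * t) * cos t); last first.
    by apply/funext => s; rewrite !mxE.
  by apply: is_derive_eq; rewrite /GRing.scale/=; field.
Qed.

Lemma velocityZ (R : realType) (S : system R) (u : R -> R) y c s i :
  velocity S u (fun r => c *: y r) s i 0 = c * velocity S u y s i 0.
Proof. by rewrite !velocityE !mxE; ring. Qed.

Lemma nice_scale (R : realType) (S : system R) u y (c : R) :
  nice_trajectory S u y -> nice_trajectory S u (fun t => c *: y t).
Proof.
case=> mu u01 ru cy dy; have k0 : 0 < `|c| + 1 by rewrite ltr_wpDl.
split => //.
- move=> i t t0 e e0; have e'0 : 0 < e / (`|c| + 1) by rewrite divr_gt0.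
  have [d d0 Hd] := cy i t t0 _ e'0; exists d => // s s0 sd.
  rewrite !mxE -mulrBr normrM; have := Hd s s0 sd; rewrite ltr_pdivlMr// => H.
  apply: le_lt_trans H; rewrite mulrC ler_wpM2l//; lra.
- move=> t i t0 e e0; have e'0 : 0 < e / (`|c| + 1) by rewrite divr_gt0.
  have [d d0 Hd] := dy t i t0 _ e'0; exists d => // h hd.
  rewrite velocityZ [(c *: y (t + h)) i 0]mxE [(c *: y t) i 0]mxE.
  rewrite (_ : _ - _ - _ = c * (y (t + h) i 0 - y t i 0 - h * velocity S u y t i 0)); last by ring.
  rewrite normrM; have h0 : 0 <= h by lra.
  apply: (@le_trans _ _ ((`|c| + 1) * (e / (`|c| + 1) * h))).
    by apply: ler_pM => //; [lra|exact: Hd].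
  by rewrite mulrA (mulrC (`|c| + 1)) divfK// gt_eqF.
Qed.

Lemma nice_shift (R : realType) (S : system R) u y (a : R) : 0 <= a ->
  nice_trajectory S u y ->
  nice_trajectory S (fun t => u (t + a)) (fun t => y (t + a)).
Proof.
move=> a0 [mu u01 ru cy dy]; split.
- by apply: (measurableT_comp mu); exact: measurable_funD.
- by move=> t t0; apply: u01; lra.
- move=> t t0; have [|d d0 Hd] := ru (t + a); first lra.
  by exists d => // h hd; rewrite addrAC Hd.
- move=> i; apply: (@cont_ge0_comp _ (fun t => y t i 0) (fun t => t + a)) => //.
    by move=> t t0; lra.
  by move=> s t; rewrite (_ : s + a - (t + a) = s - t)//; ring.
- move=> t i t0 e e0; have [|d d0 Hd] := dy (t + a) i _ e e0; first lra.
  by exists d => // h hd; rewrite (addrAC t h a); exact: Hd.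
Qed.

(** * The closed curve and the level sets of the gauge *)

Section ClosedCurve.
Variables (R : realType) (E rA rB TA TB : R) (p1 p2 : 'cV[R]_2) (k : R).

Hypothesis Hf : frame E rA rB TA TB p1 p2 k.
Hypothesis Hrho : rhoCC (kappa E) rA rB = 1.

Let E0 : 0 < E. Proof. by have := frame_E Hf; lra. Qed.
Let p10 : p1 != 0. Proof. exact: frame_p1 Hf. Qed.
Let p2E : p2 = jrot E TA *m p1. Proof. exact: frame_rotA Hf. Qed.
Let TA0 : 0 < TA < pi. Proof. exact: frame_TA Hf. Qed.
Let TB0 : 0 < TB < pi. Proof. exact: frame_TB Hf. Qed.
Let one0 : 0 < 1 :> R. Proof. exact: ltr01. Qed.
Let k0 : 0 < k. Proof. exact: frame_k Hf. Qed.
Let TAp : 0 < TA. Proof. by have := TA0; lra. Qed.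
Let TBp : 0 < TB. Proof. by have := TB0; lra. Qed.
Let w0 : 0 < cross p1 p2.
Proof. by rewrite p2E; exact: cross_rot_gt0. Qed.
Let p20 : p2 != 0.
Proof.
by apply/eqP => z; move: w0; rewrite z /cross !mxE !mulr0 subrr ltxx.
Qed.

Local Notation S := (nf E rA rB).
Local Notation side := (sector_side p1 p2).
Local Notation lg := (log_gauge E rA rB p1 p2 k).

Let FA (t : R) := expR (- rA * t) *: jrot E t.
Let FB (t : R) := expR (- rB * t) *: jrot 1 t.
Let fFA : is_flow S.1 FA. Proof. exact: flow_nfA. Qed.
Let fFB : is_flow S.2 FB. Proof. by rewrite /= nfBE; exact: flow_nfA. Qed.
Let q := FA TA *m p1.
Let Th := TA + TB.
Let Th0 : 0 < Th. Proof. by rewrite /Th addr_gt0. Qed.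

Let qE : q = expR (- rA * TA) *: p2. Proof. by rewrite /q -scalemxAl -p2E. Qed.

Let half_turn : FB TB *m q = - p1.
Proof.
rewrite qE -scalemxAr -scalemxAl (frame_rotB Hf) !scalerA -expRD.
have := frame_rho Hf; rewrite Hrho (_ : - (_ + _) = - rA * TA + - rB * TB); last by ring.
by rewrite mulrN => <-; rewrite scaleN1r.
Qed.

Let FA_neq0 (t : R) : FA t *m p1 != 0.
Proof.
rewrite -scalemxAl scaler_eq0 gt_eqF ?expR_gt0//=; apply/eqP => v0.
have := Jdot_gt0 E0 p10; have := Jdot_rot t t p1 (lt0r_neq0 E0).
by rewrite v0 subrr cos0 mul1r => <-; rewrite /Jdot !mxE !(mulr0, mul0r) addr0 ltxx.
Qed.

Let FB_neq0 (t : R) : FB t *m q != 0.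
Proof.
rewrite -scalemxAl scaler_eq0 gt_eqF ?expR_gt0//= qE -scalemxAr.
rewrite scaler_eq0 gt_eqF ?expR_gt0//=; apply/eqP => v0.
have := Jdot_gt0 one0 p20; have := Jdot_rot t t p2 (lt0r_neq0 one0).
by rewrite v0 subrr cos0 mul1r => <-; rewrite /Jdot !mxE !(mulr0, mul0r) addr0 ltxx.
Qed.

Let sideA (t : R) : 0 <= t <= TA -> 0 <= side (FA t *m p1).
Proof.
move=> tT; have [a0 b0] := rot_sector E0 TA0 p10 tT; rewrite -p2E in a0.
by rewrite -scalemxAl side_scale mulr_ge0 ?sqr_ge0//; exact: mulr_ge0.
Qed.

Let sideB (t : R) : 0 <= t <= TB -> side (FB t *m q) <= 0.
Proof.
move=> tT; have [a0 b0] := rot_sector one0 TB0 p20 tT.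
rewrite -scalemxAl side_scale mulr_ge0_le0 ?sqr_ge0//.
rewrite qE -scalemxAr side_scale mulr_ge0_le0 ?sqr_ge0//.
move: a0; rewrite (frame_rotB Hf) crossZr crossC mulrN mulNr opprK pmulr_rge0// => a0.
by rewrite /sector_side crossC mulNr oppr_le0 mulr_ge0.
Qed.

Let lgA (t : R) : 0 <= t <= TA -> lg (FA t *m p1) = lg p1.
Proof. by move=> tT; rewrite -scalemxAl (log_gauge_arcA Hf). Qed.

Let lgB (t : R) : 0 <= t <= TB -> lg (FB t *m q) = lg p1.
Proof.
move=> tT; rewrite -(lgA (t := TA)); last by rewrite lexx ltW.
rewrite -/q {2}qE qE -scalemxAr -scalemxAl.
have en : expR (- rA * TA) != 0 by rewrite gt_eqF// expR_gt0.
have v0 : expR (- rB * t) *: (jrot 1 t *m p2) != 0.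
  apply: contra_neq (FB_neq0 t) => z.
  by rewrite qE -scalemxAr -scalemxAl z scaler0.
rewrite (log_gauge_scale Hf en v0) (log_gauge_scale Hf en p20).
by rewrite (log_gauge_arcB Hf Hrho tT).
Qed.

(* n half turns, each followed by a change of sign, then an arc of A without
   end: a worst trajectory on [0, n Th[. *)
Fixpoint approx (n : nat) : (R -> R) * (R -> 'cV[R]_2) :=
  if n is n'.+1 then
    let uB t := if t < TB then false%:R else (approx n').1 (t - TB) in
    let yB t := if t < TB then FB t *m q else - 1 *: (approx n').2 (t - TB) in
    (fun t => if t < TA then true%:R else uB (t - TA),
     fun t => if t < TA then FA t *m p1 else yB (t - TA))
  else (fun=> true%:R, fun t => FA t *m p1).

Lemma approx_nice n :
  nice_trajectory S (approx n).1 (approx n).2 /\ (approx n).2 0 = p1.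
Proof.
elim: n => [|n [IH y0]] /=.
  split; first exact: (@nice_flow _ S true).
  by rewrite fFA.1 mul1mx.
split; last by rewrite TAp fFA.1 mul1mx.
have nB := @nice_prepend _ S false FB TB q _ _ fFB (ltW TBp) (nice_scale (-1) IH).
have {}nB := nB (etrans (congr1 _ y0) (etrans (scaleN1r p1) (esym half_turn))).
have nA := @nice_prepend _ S true FA TA p1 _ _ fFA (ltW TAp) nB.
by apply: nA; rewrite TBp fFB.1 mul1mx.
Qed.

Lemma approx_mono n m (t : R) : (n <= m)%N -> t < n%:R * Th ->
  (approx n).1 t = (approx m).1 t /\ (approx n).2 t = (approx m).2 t.
Proof.
elim: n m t => [|n IH] [|m] t //=.
  by rewrite mul0r => _ t0; rewrite (lt_trans t0 TAp).
rewrite ltnS => nm; rewrite -natr1 mulrDl mul1r => tn.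
case: (ltP t TA) => // tA; case: (ltP (t - TA) TB) => // tB.
have [|-> ->//] := IH m (t - TA - TB) nm.
by rewrite /Th in tn *; lra.
Qed.

(** A number of half turns that covers the time t; by [approx_mono] any larger number gives the same
    value at t. *)
Let num (t : R) : nat := (Num.Def.trunc (t / Th)).+1.

Let num_lt (t : R) : t < (num t)%:R * Th.
Proof. by rewrite -ltr_pdivrMr//; exact: truncnS_gt. Qed.

Definition curve (t : R) : 'cV[R]_2 := (approx (num t)).2 t.
Definition curve_signal (t : R) : R := (approx (num t)).1 t.

Lemma curveE n (t : R) : t < n%:R * Th ->
  curve_signal t = (approx n).1 t /\ curve t = (approx n).2 t.
Proof.
move=> tn; rewrite /curve /curve_signal.
have [nm|/ltnW mn] := leqP (num t) n; first exact: approx_mono.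
by have [-> ->] := approx_mono mn tn.
Qed.

Lemma curve_nice : nice_trajectory S curve_signal curve.
Proof.
have loc (t : R) : 0 <= t -> exists n, exists2 d : R, 0 < d & forall s : R, s < t + d ->
    curve_signal s = (approx n).1 s /\ curve s = (approx n).2 s.
  move=> t0; exists (num t), ((num t)%:R * Th - t).
    by rewrite subr_gt0.
  by move=> s st; apply: curveE; lra.
split.
(* The signal is the pointwise limit of the approximations, stationary at t from [num t] on. *)
- apply: (@measurable_fun_cvg _ _ R setT (fun n => (approx n).1)).
    by move=> n; case: (approx_nice n) => -[].
  move=> t _; apply/cvgrPdist_lt => e e0; exists (num t) => // n /= tn.
  have [-> _] := curveE (num_lt t).
  by have [-> _] := approx_mono tn (num_lt t); rewrite subrr normr0.
- by move=> t t0; case: (approx_nice (num t)) => -[_ + _ _ _] _; exact.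
- move=> t t0; have [n [d d0 Hd]] := loc t t0.
  have [[_ _ ru _ _] _] := approx_nice n; have [d' d'0 Hd'] := ru t t0.
  exists (Num.min d d'); first by rewrite lt_min d0.
  move=> h; rewrite lt_min => /and3P[h0 hd hd'].
  have [|-> _] := Hd (t + h); first lra.
  by have [|-> _] := Hd t; [lra|apply: Hd'; rewrite h0].
- move=> i t t0 e e0; have [n [d d0 Hd]] := loc t t0.
  have [[_ _ _ cy _] _] := approx_nice n; have [d' d'0 Hd'] := cy i t t0 e e0.
  exists (Num.min d d'); first by rewrite lt_min d0.
  move=> s s0; rewrite lt_min => /andP[sd sd'].
  have [|_ ->] := Hd s; first by move: sd; rewrite ltr_distl; lra.
  by have [|_ ->] := Hd t; [lra|exact: Hd'].
- move=> t i t0 e e0; have [n [d d0 Hd]] := loc t t0.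
  have [[_ _ _ _ dy] _] := approx_nice n; have [d' d'0 Hd'] := dy t i t0 e e0.
  exists (Num.min d d'); first by rewrite lt_min d0.
  move=> h; rewrite lt_min => /and3P[h0 hd hd'].
  have [|_ ->] := Hd (t + h); first lra.
  have [|ut yt] := Hd t; first lra.
  have := Hd' h; rewrite !velocityE ut yt h0 hd'; exact.
Qed.

Lemma approx_props n (t : R) : 0 <= t -> t < n%:R * Th ->
  [/\ ((approx n).1 t = 1 /\ 0 <= side ((approx n).2 t)) \/
      ((approx n).1 t = 0 /\ side ((approx n).2 t) <= 0),
      (approx n).2 t != 0 & lg ((approx n).2 t) = lg p1].
Proof.
elim: n t => [|n IH] t t0 /=; first by rewrite mul0r ltNge t0.
rewrite -natr1 mulrDl mul1r => tn.
case: (ltP t TA) => tA.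
  have tT : 0 <= t <= TA by lra.
  by split; [left; split => //; exact: sideA|exact: FA_neq0|exact: lgA].
case: (ltP (t - TA) TB) => tB.
  have tT : 0 <= t - TA <= TB by lra.
  by split; [right; split => //; exact: sideB|exact: FB_neq0|exact: lgB].
have [||h1 h2 h3] := IH (t - TA - TB); first lra.
  by rewrite /Th in tn *; lra.
rewrite scaleN1r sideN oppr_eq0; split => //.
by rewrite -scaleN1r (log_gauge_scale Hf)// normrN1 ln1 addr0.
Qed.

Lemma curve_props (t : R) : 0 <= t ->
  [/\ (curve_signal t = 1 /\ 0 <= side (curve t)) \/
      (curve_signal t = 0 /\ side (curve t) <= 0),
      curve t != 0 & lg (curve t) = lg p1].
Proof. by move=> t0; apply: approx_props. Qed.

Lemma approx_half n (t : R) : 0 <= t -> (approx n.+1).2 (t + Th) = - (approx n).2 t.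
Proof.
move=> t0; have -> : (approx n.+1).2 (t + Th) =
  if t + Th < TA then FA (t + Th) *m p1 else
  if t + Th - TA < TB then FB (t + Th - TA) *m q else
  -1 *: (approx n).2 (t + Th - TA - TB) by [].
have tA : TA <= t + Th by rewrite /Th; move: TBp; lra.
have tB : TB <= t + Th - TA by rewrite /Th; move: TAp TBp; lra.
rewrite ltNge tA ltNge tB /= scaleN1r; congr (- (approx _).2 _).
by rewrite /Th; ring.
Qed.

Lemma curve_half (t : R) : 0 <= t -> curve (t + Th) = - curve t.
Proof.
move=> t0; have tn := num_lt t; have [_ ->] := curveE tn.
have [|_ ->] := @curveE (num t).+1 (t + Th); last exact: approx_half.
by rewrite -natr1 mulrDl mul1r ltrD2r.
Qed.

Lemma curve_period n (t : R) : 0 <= t -> curve (t + n%:R * (2 * Th)) = curve t.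
Proof.
move=> t0; elim: n => [|n IH]; first by rewrite mul0r addr0.
have n0 : 0 <= n%:R * (2 * Th) by rewrite mulr_ge0// ltW// mulr_gt0.
rewrite -natr1 mulrDl mul1r (_ : t + _ = t + n%:R * (2 * Th) + Th + Th); last by ring.
by rewrite !curve_half ?opprK// ?addr_ge0// ltW.
Qed.

Lemma curve_arcA (t : R) : 0 <= t <= TA -> curve t = FA t *m p1.
Proof.
move=> /andP[t0 tA]; have [|_ ->] := @curveE 1 t; first by rewrite mul1r /Th; move: TBp; lra.
rewrite /=; case: (ltP t TA) => // At; have -> : t = TA by lra.
by rewrite subrr TBp fFB.1 mul1mx.
Qed.

Lemma curve_arcB (t : R) : 0 <= t <= TB -> curve (TA + t) = FB t *m q.
Proof.
move=> /andP[t0 tB].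
have [|_ ->] := @curveE 2 (TA + t); first by rewrite /Th; move: TAp TBp; lra.
rewrite /= ltNge lerDl t0/= addrAC subrr add0r; case: (ltP t TB) => // Bt.
have -> : t = TB by lra.
by rewrite subrr TAp fFA.1 mul1mx half_turn scaleN1r.
Qed.

(** Up to x -> - x, which a half turn of the curve realises, x lies in the cone of one of the two
    arcs, and [sector_rot] finds the point of the arc on its ray. *)
Lemma curve_hits (x : 'cV[R]_2) : x != 0 ->
  exists2 t, 0 <= t & exists2 c, 0 < c & x = c *: curve t.
Proof.
suff H (y : 'cV[R]_2) : y != 0 ->
    (0 <= cross y p2 /\ 0 <= cross p1 y) \/ (cross y p2 <= 0 /\ 0 <= cross p1 y) ->
    exists2 t, 0 <= t & exists2 c, 0 < c & y = c *: curve t.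
  move=> x0; have [b0|b0] := leP 0 (cross p1 x).
    by apply: H => //; case: (leP 0 (cross x p2)) => a0; [left|right; rewrite ltW].
  have xn0 : - x != 0 by rewrite oppr_eq0.
  have [t t0 [c c0 xE]] : exists2 t, 0 <= t & exists2 c, 0 < c & - x = c *: curve t.
    apply: H => //.
    rewrite -scaleN1r crossZl crossZr !mulN1r oppr_ge0 oppr_ge0 oppr_le0.
    by rewrite (ltW b0); case: (leP (cross x p2) 0) => a0; [left|right; rewrite ltW].
  exists (t + Th); first by rewrite addr_ge0// ltW.
  by exists c => //; rewrite curve_half// scalerN -xE opprK.
move=> y0 [[a0 b0]|[a0 b0]].
  rewrite p2E in a0; have [t tT [c c0 yE]] := sector_rot E0 TA0 p10 y0 a0 b0.
  exists t; first by case/andP: tT.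
  exists (c * expR (rA * t)); first by rewrite mulr_gt0// expR_gt0.
  rewrite curve_arcA// -scalemxAl scalerA -mulrA -expRD.
  by rewrite (_ : rA * t + - rA * t = 0) ?expR0 ?mulr1//; ring.
have a0' : 0 <= cross y (jrot 1 TB *m p2).
  by rewrite (frame_rotB Hf) crossZr crossC mulrN mulNr opprK mulr_ge0// ltW.
have b0' : 0 <= cross p2 y by rewrite crossC oppr_ge0.
have [t tT [c c0 yE]] := sector_rot one0 TB0 p20 y0 a0' b0'.
exists (TA + t); first by rewrite addr_ge0// ?(ltW TAp)//; case/andP: tT.
exists (c * (expR (rB * t) * expR (rA * TA))); first by rewrite !mulr_gt0// expR_gt0.
rewrite curve_arcB// qE -scalemxAr -scalemxAl !scalerA -!mulrA -!expRD.
by rewrite (_ : _ + _ = 0) ?expR0 ?mulr1//; ring.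
Qed.

Lemma shifted_curve_worst (c a : R) : 0 < c -> 0 <= a ->
  worst_trajectory S (fun t => c *: curve (t + a)).
Proof.
move=> c0 a0; split.
  by rewrite add0r scaler_eq0 gt_eqF//=; case: (curve_props a0).
have ny := nice_scale c (nice_shift a0 curve_nice).
exists (fun t => curve_signal (t + a)); split.
- exact: nice_switching ny.
- exact: nice_trajectoryP ny.
- move=> t t0; have ta : 0 <= t + a by rewrite addr_ge0.
  have [h1 h2 _] := curve_props ta.
  have cn : c *: curve (t + a) != 0 by rewrite scaler_eq0 gt_eqF.
  apply/(worst_atP Hf _ cn); rewrite side_scale.
  have c2 : 0 < c ^+ 2 by rewrite exprn_gt0.
  by rewrite pmulr_rge0// pmulr_rle0.
Qed.

(** A multiple of the curve, started where it meets the ray of gamma 0, is itself a worst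
    trajectory; uniqueness identifies it with gamma. *)
Lemma worst_is_curve gamma : worst_trajectory S gamma ->
  exists a c, [/\ 0 <= a, 0 < c & forall t, 0 <= t -> gamma t = c *: curve (t + a)].
Proof.
move=> wg; have [a a0 [c c0 gE]] := curve_hits wg.1.
exists a, c; split => // t t0.
have ws := shifted_curve_worst c0 a0.
by apply: (worst_unique Hf wg ws) => //; rewrite add0r.
Qed.

Lemma worst_exists (x0 : 'cV[R]_2) : x0 != 0 ->
  exists2 gamma, worst_trajectory S gamma & gamma 0 = x0.
Proof.
move=> xn; have [a a0 [c c0 xE]] := curve_hits xn.
by exists (fun t => c *: curve (t + a)); [exact: shifted_curve_worst|rewrite add0r].
Qed.

Lemma worst_closed gamma : worst_trajectory S gamma -> closed_trajectory gamma.
Proof.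
move=> /worst_is_curve[a [c [a0 c0 gE]]]; exists (2 * Th); first by rewrite mulr_gt0.
move=> t t0; have h0 : 0 <= 2 * Th by rewrite mulr_ge0// ltW.
rewrite !gE ?addr_ge0//; congr (_ *: _).
have := @curve_period 1 (t + a) (addr_ge0 t0 a0); rewrite mul1r => <-.
by congr curve; ring.
Qed.

Local Notation N := (gauge E rA rB p1 p2 k).

Lemma gauge_curve (t : R) : 0 <= t -> N (curve t) = expR (lg p1).
Proof.
by move=> t0; rewrite /gauge; case: (curve_props t0) => _ /negbTE -> ->.
Qed.

(** The curve has constant gauge and meets every ray, and by homogeneity a level set meets each ray
    once, so the orbit is a whole level set. *)
Lemma worst_level gamma : worst_trajectory S gamma ->
  exists2 n0, 0 < n0 & forall x : 'cV[R]_2, x != 0 ->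
    (exists2 t, 0 <= t & gamma t = x) <-> N x = n0.
Proof.
move=> /worst_is_curve[a [c [a0 c0 gE]]].
exists (c * expR (lg p1)); first by rewrite mulr_gt0// expR_gt0.
have gs := gauge_scale Hf.
move=> x xn; split=> [[t t0 <-]|Nx].
  by rewrite gE// gs gtr0_norm// gauge_curve// addr_ge0.
have [b b0 [c' c'0 xE]] := curve_hits xn.
have cc : c' = c.
  move: Nx; rewrite xE gs gtr0_norm// gauge_curve//.
  by apply: mulIf; rewrite gt_eqF// expR_gt0.
(* Enough periods for the time b + n (2 Th) - a to be nonnegative. *)
pose n := (Num.Def.trunc (a / (2 * Th))).+1.
have h0 : 0 < 2 * Th by rewrite mulr_gt0.
have an : a < n%:R * (2 * Th) by rewrite -ltr_pdivrMr//; exact: truncnS_gt.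
exists (b + n%:R * (2 * Th) - a); first lra.
rewrite gE; last lra.
by rewrite subrK curve_period// xE cc.
Qed.

Lemma worst_polar gamma : worst_trajectory S gamma ->
  exists rt, polar_equation gamma rt.
Proof.
move=> /worst_level[n0 n00 H].
have gs := gauge_scale Hf.
exists (fun al => n0 / N (polar 1 al)) => al.
have pn := polar1_neq0 al; have Np := gauge_gt0 E rA rB p1 p2 k pn.
split; first by rewrite divr_gt0.
move=> r r0; have rn : polar r al != 0.
  by rewrite polar_scale scaler_eq0 gt_eqF.
rewrite H// polar_scale gs gtr0_norm//; split=> [<-|->].
  by rewrite mulfK// gt_eqF.
by rewrite divfK// gt_eqF.
Qed.

(** The point of the curve on the ray of angle alpha has gauge n0, hence rt alpha = n0 / N (polar 1
    alpha). The ratio thus inherits the continuity that its definition through the discontinuous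
    [polar_arg] hides. *)
Lemma polar_ratio_gauge gamma rt : worst_trajectory S gamma ->
  polar_equation gamma rt ->
  exists2 c, 0 < c & polar_ratio rt = fun x => c * N x.
Proof.
move=> /worst_level[n0 n00 H] pe; exists n0^-1; first by rewrite invr_gt0.
have gs := gauge_scale Hf.
apply/funext => x; rewrite /polar_ratio; have [->|xn] := eqVneq x 0.
  rewrite /gauge eqxx mulr0 /enorm /dotv !mxE mulr0 addr0 sqrtr0 mul0r//.
set al := polar_arg x; have [r0 Hr] := pe al.
have pn := polar1_neq0 al.
have rn : polar (rt al) al != 0 by rewrite polar_scale scaler_eq0 gt_eqF.
have := (H _ rn).1 ((Hr _ r0).2 erefl); rewrite polar_scale gs gtr0_norm// => E1.
rewrite -{2}(polar_argK xn) -/al polar_scale gs gtr0_norm ?enorm_gt0// -E1.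
have Np := gauge_gt0 E rA rB p1 p2 k pn.
by field; rewrite (gt_eqF r0) (gt_eqF Np).
Qed.

End ClosedCurve.

(** * The level zeta *)

Lemma kappa_gt1 (R : realType) (E : R) : 1 < E -> 1 < kappa E.
Proof.
move=> E1; have E0 : 0 < E by lra.
rewrite /kappa ltr_pdivlMr// mul1r -subr_gt0.
rewrite (_ : E + E^-1 - 2 = (E - 1) ^+ 2 / E); last by field; rewrite gt_eqF.
by rewrite divr_gt0// exprn_gt0// subr_gt0.
Qed.

(** Equality forces E' = E or E' = 1 / E, and the latter is below 1. *)
Lemma kappa_inj (R : realType) (E E' : R) : 1 < E -> 1 < E' ->
  kappa E = kappa E' -> E = E'.
Proof.
move=> E1 E1'; have E0 : E != 0 by rewrite gt_eqF//; lra.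
have E0' : E' != 0 by rewrite gt_eqF//; lra.
move=> h; have : (E - E') * (E * E' - 1) = 0.
  transitivity (2 * (kappa E - kappa E') * (E * E')).
    by rewrite /kappa; field; rewrite E0 E0'.
  by rewrite h; ring.
move/eqP; rewrite mulf_eq0 subr_eq0 => /orP[/eqP//|].
have : 1 < E * E' by rewrite mulr_egt1.
by move=> h1; rewrite subr_eq0 gt_eqF.
Qed.

(** With s = a b + K and d the square root, (s - d) (s + d) = (1 + a ^ 2) (1 + b ^ 2); so the
    denominator in [rhoCC] is positive. *)
Lemma calD_sub_gt0 (R : realType) (K a b : R) : 1 < K -> 0 <= a -> 0 <= b ->
  0 < calD K a b -> 0 < a * b + K - Num.sqrt (calD K a b).
Proof.
move=> K1 a0 b0 D0; have ab : 0 <= a * b by rewrite mulr_ge0.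
have dd : Num.sqrt (calD K a b) ^+ 2 = calD K a b by rewrite sqr_sqrtr// ltW.
have d0 := sqrtr_ge0 (calD K a b); set d := Num.sqrt _ in dd d0 *.
have E : (a * b + K - d) * (a * b + K + d) = (1 + a ^+ 2) * (1 + b ^+ 2).
  by rewrite -subr_sqr dd /calD; ring.
have p : 0 < (a * b + K - d) * (a * b + K + d).
  by rewrite E mulr_gt0// ltr_pwDl// sqr_ge0.
by move: p; rewrite pmulr_lgt0//; lra.
Qed.

Lemma cvg_rhoCC (R : realType) (T : Type) (F : set_system T) (FF : Filter F)
    (a b : T -> R) (K a0 b0 : R) :
  0 < calD K a0 b0 -> 0 < a0 * b0 + K - Num.sqrt (calD K a0 b0) ->
  a @ F --> a0 -> b @ F --> b0 ->
  (fun t => rhoCC K (a t) (b t)) @ F --> rhoCC K a0 b0.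
Proof.
move=> D0 sd ca cb.
have cc (c : R) : (fun _ : T => c) @ F --> c by exact: cvg_cst.
have cab : (fun t => a t * b t + K) @ F --> a0 * b0 + K.
  by apply: cvgD => //; exact: cvgM.
have cD : (fun t => calD K (a t) (b t)) @ F --> calD K a0 b0.
  rewrite /calD; apply: cvgB.
    apply: cvgD => //; apply: cvgM => //; apply: cvgM => //; exact: cvgM.
  by apply: cvgD; [apply: cvgD => //|]; rewrite expr2; under eq_fun do rewrite expr2; exact: cvgM.
have cd : (fun t => Num.sqrt (calD K (a t) (b t))) @ F --> Num.sqrt (calD K a0 b0).
  by apply: (continuous_cvg _ _ cD); exact: sqrt_continuous.
have dn : Num.sqrt (calD K a0 b0) != 0 by rewrite gt_eqF// sqrtr_gt0.
have cdV := @cvgV _ _ _ FF _ _ dn cd.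
have at_ (z : T -> R) (z0 : R) : z @ F --> z0 -> (fun t => atan (z t)) @ F --> atan z0.
  by move=> cz; apply: (continuous_cvg _ _ cz); exact: continuous_atan.
rewrite /rhoCC; apply: cvgM.
  have ce (z : T -> R) (z0 : R) : z @ F --> z0 -> (fun t => expR (z t)) @ F --> expR z0.
    by move=> cz; apply: (continuous_cvg _ _ cz); exact: continuous_expR.
  apply: ce; apply: cvgB; last by apply: cvgM => //; exact: cvgD.
  apply: cvgB; apply: cvgM => //; first exact: cvgN.
    apply: at_; apply: cvgM => //; apply: cvgD => //; apply: cvgM => //; exact: cvgN.
  apply: at_; apply: cvgM => //; apply: cvgB => //; exact: cvgM.
have cs (z : T -> R) (z0 : R) : z @ F --> z0 -> (fun t => Num.sqrt (z t)) @ F --> Num.sqrt z0.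
  by move=> cz; apply: (continuous_cvg _ _ cz); exact: sqrt_continuous.
apply: cs; apply: cvgM; first exact: cvgD.
by apply: cvgV; [rewrite gt_eqF|exact: cvgB].
Qed.

Lemma zeta_exists (R : realType) (E rA rB : R) : nf_params E rA rB ->
  rhoCC (kappa E) rA rB < 1 ->
  exists zeta : R, [/\ 0 < zeta < 1, 0 < calD (kappa E) (zeta * rA) (zeta * rB) &
    rhoCC (kappa E) (zeta * rA) (zeta * rB) = 1].
Proof.
move=> [E1 rA0 rB0 D0] r1; have K1 := kappa_gt1 E1; set K := kappa E in K1 D0 r1 *.
have K20 : 0 < K ^+ 2 - 1 by rewrite subr_gt0 expr_gt1//; lra.
have Dz (z : R) : 0 <= z <= 1 -> 0 < calD K (z * rA) (z * rB).
  move=> /andP[z0 z1].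
  (* Along the segment from the origin [calD] interpolates between K ^ 2 - 1 and its value at z = 1,
     both positive. *)
  have -> : calD K (z * rA) (z * rB) =
      (K ^+ 2 - 1) * (1 - z ^+ 2) + z ^+ 2 * calD K rA rB by rewrite /calD; ring.
  have z20 : z ^+ 2 <= 1 by rewrite expr_le1.
  have [->|zn] := eqVneq z 0; first by rewrite expr0n/= mul0r addr0 subr0 mulr1.
  have h1 : 0 < z ^+ 2 * calD K rA rB by rewrite mulr_gt0// exprn_even_gt0.
  by rewrite ltr_wpDl// mulr_ge0 ?(ltW K20)// subr_ge0.
pose f (z : R) := rhoCC K (z * rA) (z * rB).
(* Without damping the exponential is 1 and the quotient (K + d) / (K - d) exceeds 1. *)
have f0 : 1 < f 0.
  rewrite /f !mul0r /rhoCC; set d := Num.sqrt _.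
  have d0 : 0 < d.
    rewrite sqrtr_gt0; have := Dz 0; rewrite !mul0r lexx ler01; exact.
  have sd : 0 < 0 * 0 + K - d.
    apply: calD_sub_gt0 => //; have := Dz 0; rewrite !mul0r lexx ler01; exact.
  rewrite oppr0 !mul0r addr0 mulr0 !subr0 expR0 mul1r add0r.
  rewrite mul0r add0r in sd.
  rewrite -[ltLHS]sqrtr1 ltr_sqrt ?divr_gt0//; last lra.
  by rewrite ltr_pdivlMr// mul1r; lra.
have fc : {within `[0, 1], continuous f}.
  apply: continuous_in_subspaceT => z; rewrite inE/= in_itv/= => z01.
  have z0 : 0 <= z by case/andP: z01.
  apply: cvg_rhoCC; first exact: Dz.
  - by apply: calD_sub_gt0 => //; [rewrite mulr_ge0// ltW|rewrite mulr_ge0// ltW|exact: Dz].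
  - exact: mulrr_continuous.
  - exact: mulrr_continuous.
have f1 : f 1 < 1 by rewrite /f !mul1r.
have [z] : exists2 z, z \in `[0, 1] & f z = 1.
  apply: IVT => //; apply/andP; split; first by rewrite ge_min (ltW f1) orbT.
  by rewrite le_max (ltW f0).
rewrite in_itv/= => z01 fz; exists z; split => //; last exact: Dz.
case/andP: z01 => z0 z1; apply/andP; split.
  by rewrite lt_neqAle z0 andbT eq_sym; apply: contra_ltN f0 => /eqP <-; rewrite fz.
by rewrite lt_neqAle z1 andbT; apply: contra_ltN f1 => /eqP <-; rewrite fz.
Qed.

(** * Linear changes of coordinates *)

Lemma cont_mulmx (R : realType) (P : 'M[R]_2) :
  continuous (fun x : 'cV[R]_2 => P *m x).
Proof.
move=> x; have FF := nbhs_filter x.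
have c0 := @coord_continuous R 2 1 0 0 x; have c1 := @coord_continuous R 2 1 1 0 x.
by apply: (@cvg_cV2 _ _ (nbhs x)); apply: (@cvg_mulmx_coord _ _ _ FF id) => i;
  exact: coord_continuous.
Qed.

Definition conj_system (R : realType) (P : 'M[R]_2) (S : system R) : system R :=
  (P *m S.1 *m invmx P, P *m S.2 *m invmx P).

Lemma velocity_conj (R : realType) (P : 'M[R]_2) (S : system R) u x s :
  P \in unitmx ->
  velocity (conj_system P S) u (fun t => P *m x t) s = P *m velocity S u x s.
Proof.
move=> Pu; rewrite /velocity /= mulmxDr -!scalemxAr.
by rewrite -!mulmxA !(mulmxA (invmx P)) mulVmx// !mul1mx.
Qed.

Lemma trajectory_conj (R : realType) (P : 'M[R]_2) (S : system R) u x :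
  P \in unitmx -> switching_signal u -> trajectory S u x ->
  trajectory (conj_system P S) u (fun t => P *m x t).
Proof.
move=> Pu su tx; split.
  apply: within_cV2 => i.
  have -> : (fun t => (P *m x t) i 0) = fun t => P i 0 * x t 0 0 + P i 1 * x t 1 0.
    by apply/funext => t; rewrite mulmx2E.
  apply/within_ge0P; exact: (within_comp (@continuous_lin2 R (P i 0) (P i 1)) tx.1).
move=> t i t0.
have [_] := primitive_lin (P i 0) (P i 1) (trajectory_primitive 0 su tx)
  (trajectory_primitive 1 su tx) t0.
rewrite -!mulmx2E => ->; congr (_ + _); apply: eq_Rintegral => s _.
by rewrite -mulmx2E -velocity_conj.
Qed.

Lemma clf_conj (R : realType) (P : 'M[R]_2) (S : system R) V : P \in unitmx ->
  clf (conj_system P S) V -> clf S (fun x => V (P *m x)).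
Proof.
move=> Pu [cV V0 Vp Vd].
have Pinj (x y : 'cV[R]_2) : P *m x = P *m y -> x = y.
  by move/(congr1 (mulmx (invmx P))); rewrite !mulKmx.
split.
- by move=> x; exact: (@continuous_comp _ _ _ (mulmx P) V x (@cont_mulmx _ P x) (cV _)).
- by rewrite mulmx0.
- by move=> x xn; apply: Vp; apply: contra_neq xn => Px; apply: Pinj; rewrite Px mulmx0.
- move=> u x su tx [t t0 nc] s r s0 sr.
  apply: (Vd u (fun t => P *m x t)) => //; first exact: trajectory_conj.
  by exists t => //; apply: contra_neq nc => /Pinj.
Qed.

Lemma clf_scale (R : realType) (S : system R) V (c : R) : 0 < c -> clf S V ->
  clf S (fun x => c * V x).
Proof.
move=> c0 [cV V0 Vp Vd]; split.
- move=> x; have FF := nbhs_filter x.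
  by apply: (@cvgM _ _ (nbhs x)); [exact: cvg_cst|exact: cV].
- by rewrite V0 mulr0.
- by move=> x xn; rewrite mulr_gt0// Vp.
- by move=> u x su tx nc s t s0 st; rewrite ltr_pM2l//; exact: (Vd u x).
Qed.

(** * What GUES imposes on the normal form *)

Lemma is_flow_scale (R : realType) (M : 'M[R]_2) F (c : R) :
  is_flow M F -> is_flow (c *: M) (fun t => F (c * t)).
Proof.
move=> [F0 dF]; split; first by rewrite mulr0.
move=> t i j.
have dw : is_derive t 1 (fun t => c * t) c.
  by apply: is_derive_eq; rewrite /GRing.scale/= mulr1.
have := @is_derive1_comp _ (fun t => F t i j) (fun t => c * t) t _ _ (dF (c * t) i j) dw.
by move=> h; apply: is_derive_eq h _; rewrite !mulmx22E !mxE; ring.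
Qed.

Lemma is_flow_conj (R : realType) (P M : 'M[R]_2) F : P \in unitmx ->
  is_flow M F ->
  is_flow (invmx P *m M *m P) (fun t => invmx P *m F t *m P).
Proof.
move=> Pu [F0 dF]; split; first by rewrite F0 mulmx1 mulVmx.
move=> t i j.
have -> : invmx P *m M *m P *m (invmx P *m F t *m P) = invmx P *m (M *m F t) *m P.
  by rewrite -!mulmxA (mulmxA P) mulmxV// mul1mx.
have d00 := dF t 0 0; have d01 := dF t 0 1; have d10 := dF t 1 0; have d11 := dF t 1 1.
rewrite (_ : (fun t => _) = fun t =>
   P 0 j * (invmx P i 0 * F t 0 0 + invmx P i 1 * F t 1 0) +
   P 1 j * (invmx P i 0 * F t 0 1 + invmx P i 1 * F t 1 1)); last first.
  by apply/funext => s; rewrite !mulmx22E; ring.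
apply: is_derive_eq; rewrite [RHS]mulmx22E !(mulmx22E (invmx P)) /GRing.scale/=; ring.
Qed.

(** Conjugated back by P, with times rescaled to a TA and b TB, the half turn is a transition matrix
    of S with eigenvector v = P^-1 p and eigenvalue - chi. With |chi| >= 1 its powers would not
    decay on v. *)
Lemma gues_contraction (R : realType) (S : system R) (P : 'M[R]_2)
    (E rA rB TA TB chi : R) (p : 'cV[R]_2) :
  gues S -> brings_to_nf S P E rA rB -> 0 < E -> 0 < TA -> 0 < TB -> p != 0 ->
  (expR (- rB * TB) *: jrot 1 TB) *m ((expR (- rA * TA) *: jrot E TA) *m p) =
    - chi *: p ->
  `|chi| < 1.
Proof.
move=> gS [Pu [a [b [a0 b0 SA SB]]]] E0 TA0 TB0 p0 H.
have [C [l [C0 l0 HC]]] := gues_reach gS.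
pose FA (t : R) := expR (- rA * t) *: jrot E t.
pose FB (t : R) := expR (- rB * t) *: jrot 1 t.
have an : a != 0 by rewrite gt_eqF.
have bn : b != 0 by rewrite gt_eqF.
have S1 : S.1 = invmx P *m (a^-1 *: nfA E rA) *m P.
  rewrite -SA scalerA mulVf// scale1r -!mulmxA mulVmx// mulmx1.
  by rewrite mulmxA mulVmx// mul1mx.
have S2 : S.2 = invmx P *m (b^-1 *: nfB rB) *m P.
  rewrite -SB scalerA mulVf// scale1r -!mulmxA mulVmx// mulmx1.
  by rewrite mulmxA mulVmx// mul1mx.
pose G1 (t : R) := invmx P *m FA (a^-1 * t) *m P.
pose G2 (t : R) := invmx P *m FB (b^-1 * t) *m P.
have f1 : is_flow S.1 G1.
  by rewrite S1; apply: is_flow_conj => //; apply: is_flow_scale; exact: flow_nfA.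
have f2 : is_flow S.2 G2.
  by rewrite S2 nfBE; apply: is_flow_conj => //; apply: is_flow_scale; exact: flow_nfA.
pose v := invmx P *m p; pose T := a * TA + b * TB.
have T0 : 0 < T by rewrite addr_gt0// mulr_gt0.
have vn : v != 0.
  apply: contra_neq p0 => v0; have := congr1 (mulmx P) v0.
  by rewrite /v mulmxA mulmxV// mul1mx mulmx0.
have step : G2 (b * TB) *m (G1 (a * TA) *m v) = - chi *: v.
  rewrite /G1 /G2 /v !mulKf// -!mulmxA (mulmxA P (invmx P) p) mulmxV// mul1mx.
  rewrite (mulmxA P (invmx P)) mulmxV// mul1mx H.
  by rewrite -scalemxAr.
have Rn n : exists2 Phi, reach S (n%:R * T) Phi & Phi *m v = (- chi) ^+ n *: v.
  elim: n => [|n [Phi rP Pv]].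
    by exists 1%:M; [rewrite mul0r; exact: reach0|rewrite mul1mx expr0 scale1r].
  exists (Phi *m G2 (b * TB) *m G1 (a * TA)).
    rewrite -natr1 mulrDl mul1r (_ : n%:R * T + T = a * TA + (b * TB + n%:R * T)).
      apply: (@reachS _ S _ _ true) => //; first by rewrite ltW// mulr_gt0.
      by apply: (@reachS _ S _ _ false) => //; rewrite ltW// mulr_gt0.
    by rewrite /T; ring.
  by rewrite -(mulmxA (Phi *m _)) -(mulmxA Phi) step -scalemxAr Pv scalerA exprS.
rewrite ltNge; apply/negP => chi1.
have nv : 0 < enorm v by exact: enorm_gt0.
have enZ (c : R) : enorm (c *: v) = `|c| * enorm v.
  rewrite /enorm -sqrtr_sqr -sqrtrM ?sqr_ge0//; congr Num.sqrt.
  by rewrite /dotv !mxE; ring.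
have B n : expR (l * (n%:R * T)) <= C.
  have [Phi rP Pv] := Rn n; have := HC _ _ v rP; rewrite Pv enZ ler_pM2r// => h.
  have h1 : 1 <= C * expR (- l * (n%:R * T)).
    by apply: le_trans h; rewrite normrX normrN exprn_ege1.
  rewrite mulNr expRN -ler_pdivrMr ?invr_gt0 ?expR_gt0// invrK mul1r in h1.
  exact: h1.
(* Enough turns for l n T to exceed C, which contradicts [B] since exp(x) >= 1 + x. *)
pose n := (Num.Def.trunc (C / (l * T))).+1.
have lT : 0 < l * T by exact: mulr_gt0.
have Cn : C < n%:R * (l * T) by rewrite -ltr_pdivrMr//; exact: truncnS_gt.
have := B n; have := expR_ge1Dx (l * (n%:R * T)).
rewrite (_ : l * (n%:R * T) = n%:R * (l * T)); last by ring.
lra.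
Qed.

(** The frame belongs to the dampings tA, tB while the arcs are run with rA, rB: only the scalar
    factor of the half turn changes. *)
Lemma frame_turn (R : realType) (E tA tB TA TB rA rB : R) (p1 p2 : 'cV[R]_2) (k : R) :
  frame E tA tB TA TB p1 p2 k ->
  (expR (- rB * TB) *: jrot 1 TB) *m ((expR (- rA * TA) *: jrot E TA) *m p1) =
    - (expR (- (rA * TA + rB * TB)) * k) *: p1.
Proof.
move=> Hf; rewrite -!scalemxAl -(frame_rotA Hf) -scalemxAr (frame_rotB Hf).
rewrite !scalerA -expRD mulrN (_ : - rB * TB + - rA * TA = - (rA * TA + rB * TB))//.
by ring.
Qed.

Lemma gues_rhoCC (R : realType) (S : system R) (P : 'M[R]_2) (E rA rB : R) :
  gues S -> nf_params E rA rB -> brings_to_nf S P E rA rB ->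
  rhoCC (kappa E) rA rB < 1.
Proof.
move=> gS np bS; have [TA [TB [p1 [p2 [k Hf]]]]] := frame_exists np.
have E0 : 0 < E by case: np; lra.
have TA0 : 0 < TA by have := frame_TA Hf; lra.
have TB0 : 0 < TB by have := frame_TB Hf; lra.
have := gues_contraction gS bS E0 TA0 TB0 (frame_p1 Hf) (frame_turn rA rB Hf).
by rewrite (frame_rho Hf) => /(le_lt_trans (ler_norm _)).
Qed.

(** Running the given dampings over the angles of the critical frame multiplies p1 by - exp((tA -
    rA) TA + (tB - rB) TB), whose modulus is below 1. At equal ratios tA - rA and tB - rB have the
    same sign, so both are negative. This compares the radii without any monotonicity of [rhoCC]. *)
Lemma gues_level (R : realType) (S : system R) (P : 'M[R]_2) (E rA rB tA tB : R) :
  gues S -> 0 < rA -> 0 < rB -> brings_to_nf S P E rA rB -> nf_params E tA tB ->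
  rhoCC (kappa E) tA tB = 1 -> tB / tA = rB / rA -> tA < rA /\ tB < rB.
Proof.
move=> gS rA0 rB0 bS np r1 tr; have [TA [TB [p1 [p2 [k Hf]]]]] := frame_exists np.
have E0 : 0 < E by case: np; lra.
have [tA0 tB0] : 0 < tA /\ 0 < tB by case: np.
have TA0 : 0 < TA by have := frame_TA Hf; lra.
have TB0 : 0 < TB by have := frame_TB Hf; lra.
have := gues_contraction gS bS E0 TA0 TB0 (frame_p1 Hf) (frame_turn rA rB Hf).
have -> : k = expR (tA * TA + tB * TB).
  have := frame_rho Hf; rewrite r1 expRN => h.
  by rewrite -[LHS](mulVKf (lt0r_neq0 (expR_gt0 (tA * TA + tB * TB)))) -h mulr1.
rewrite -expRD gtr0_norm ?expR_gt0// -expR0 ltr_expR => h.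
pose q := rB / rA; have q0 : 0 < q by exact: divr_gt0.
have eB : rB = q * rA by rewrite /q divfK// gt_eqF.
have etB : tB = q * tA by rewrite /q -tr divfK// gt_eqF.
have tAr : tA < rA.
  have : 0 < (rA - tA) * (TA + q * TB) by move: h; rewrite eB etB; lra.
  by rewrite pmulr_lgt0 ?subr_gt0// addr_gt0// mulr_gt0.
by split => //; rewrite eB etB ltr_pM2l.
Qed.

(** c and theta are the polar coordinates of the first column of P; b and a are the coordinates of
    the second column, divided by c, in the axes turned by theta. *)
Lemma QR_coord_change (R : realType) (P : 'M[R]_2) : P \in unitmx ->
  exists c theta a b : R, [/\ 0 < c, a != 0 & P = c *: coord_change theta a b].
Proof.
move=> Pu; pose v := vec2 (P 0 0) (P 1 0).
have v0 : v 0 0 = P 0 0 by rewrite mxE.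
have v1 : v 1 0 = P 1 0 by rewrite mxE.
have Pinj (x : 'cV[R]_2) : P *m x = 0 -> x = 0.
  by move/(congr1 (mulmx (invmx P))); rewrite mulKmx// mulmx0.
have vn : v != 0.
  apply/eqP => vz; have e0 : vec2 1 0 = 0 :> 'cV[R]_2.
    apply: Pinj; apply: cV2P; rewrite mulmx2E !mxE/= mulr1 mulr0 addr0.
      by rewrite -v0 vz mxE.
    by rewrite -v1 vz mxE.
  by have /eqP := congr1 (fun z : 'cV[R]_2 => z 0 0) e0; rewrite !mxE/= oner_eq0.
pose c := enorm v; pose th := polar_arg v.
have c0 : 0 < c by exact: enorm_gt0.
have cn : c != 0 by rewrite gt_eqF.
have pE := polar_argK vn; rewrite -/c -/th in pE.
have cc : c * cos th = P 0 0.
  by have := congr1 (fun z : 'cV[R]_2 => z 0 0) pE; rewrite !mxE.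
have cs : c * sin th = P 1 0.
  by have := congr1 (fun z : 'cV[R]_2 => z 1 0) pE; rewrite !mxE.
have cs1 := cos2Dsin2 th.
pose a := (P 1 1 * cos th - P 0 1 * sin th) / c.
pose b := (P 0 1 * cos th + P 1 1 * sin th) / c.
have e01 : c * (cos th * b - sin th * a) = P 0 1.
  transitivity (P 0 1 * (cos th ^+ 2 + sin th ^+ 2)); last by rewrite cs1 mulr1.
  by rewrite /a /b; field.
have e11 : c * (sin th * b + cos th * a) = P 1 1.
  transitivity (P 1 1 * (cos th ^+ 2 + sin th ^+ 2)); last by rewrite cs1 mulr1.
  by rewrite /a /b; field.
exists c, th, a, b; split => //.
- apply/eqP => a0; have e0 : vec2 (- b) 1 = 0 :> 'cV[R]_2.
    apply: Pinj; apply: cV2P; rewrite mulmx2E !mxE/= mulr1.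
      by rewrite -e01 -cc a0; ring.
    by rewrite -e11 -cs a0; ring.
  by have /eqP := congr1 (fun z : 'cV[R]_2 => z 1 0) e0; rewrite !mxE/= oner_eq0.
- apply/matrixP => i j; rewrite mxE /coord_change mulmx22E !mxE.
  case: (ord2P i) => ->; case: (ord2P j) => -> /=.
  + by rewrite -cc; ring.
  + by rewrite -e01; ring.
  + by rewrite -cs; ring.
  + by rewrite -e11; ring.
Qed.

Lemma gauge_clf_nf (R : realType) (E tA tB rA rB TA TB a b : R)
    (p1 p2 : 'cV[R]_2) (k : R) :
  frame E tA tB TA TB p1 p2 k -> rhoCC (kappa E) tA tB = 1 ->
  0 < tA < rA -> 0 < tB < rB -> 0 < a -> 0 < b ->
  clf (a *: nfA E rA, b *: nfB rB) (gauge E tA tB p1 p2 k).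
Proof.
move=> Hf Hrho /andP[tA0 tAr] /andP[tB0 tBr] a0 b0.
rewrite nfBE -(subrKC tA rA) -(subrKC tB rB).
by apply: (gauge_clf tA0 tB0 Hf Hrho) => //; rewrite subr_gt0.
Qed.

Lemma nf_worst (R : realType) (E rA rB : R) : nf_params E rA rB ->
  rhoCC (kappa E) rA rB < 1 ->
  exists zeta : R,
    [/\ 0 < zeta < 1,
        0 < calD (kappa E) (zeta * rA) (zeta * rB),
        rhoCC (kappa E) (zeta * rA) (zeta * rB) = 1,
        (forall x0 : 'cV[R]_2, x0 != 0 ->
           exists2 gamma,
             worst_trajectory (nf E (zeta * rA) (zeta * rB)) gamma &
             gamma 0 = x0) &
        (forall gamma : R -> 'cV[R]_2,
           worst_trajectory (nf E (zeta * rA) (zeta * rB)) gamma ->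
           [/\ closed_trajectory gamma,
               (exists rt : R -> R, polar_equation gamma rt) &
               (forall rt : R -> R, polar_equation gamma rt ->
                  clf (nf E rA rB) (polar_ratio rt))])].
Proof.
move=> np r1; have [z [/andP[z0 z1] zD zr]] := zeta_exists np r1.
have [E1 rA0 rB0 _] := np.
have nz : nf_params E (z * rA) (z * rB) by split => //; rewrite mulr_gt0.
have [TA [TB [p1 [p2 [k Hf]]]]] := frame_exists nz.
exists z; split => //; first by rewrite z0.
- by move=> x0 xn; exact: (worst_exists Hf zr xn).
- move=> gamma wg; split; first exact: (worst_closed Hf zr wg).
    exact: (worst_polar Hf zr wg).
  move=> rt pe; have [c c0 ->] := polar_ratio_gauge Hf zr wg pe.
  apply: clf_scale => //; rewrite /nf -(scale1r (nfA E rA)) -(scale1r (nfB rB)).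
  apply: (gauge_clf_nf Hf zr) => //; rewrite mulr_gt0//= gtr_pMl//.
Qed.

(** * The five-parameter family *)

Lemma explicit_gauge (R : realType) (K q : R) V : explicit_clf K q V ->
  exists E tA tB TA TB p1 p2 k c,
    [/\ nf_params E tA tB, rhoCC (kappa E) tA tB = 1, kappa E = K & tB / tA = q] /\
    [/\ frame E tA tB TA TB p1 p2 k, 0 < c &
      V = fun x : 'cV[R]_2 => c * gauge E tA tB p1 p2 k x].
Proof.
move=> [E [rA [rB [z [gamma [rt [[[E1 rA0 rB0 _] _ EK rq]]]]]]]].
move=> [/andP[z0 z1] [zD zr] wg pe ->].
have nz : nf_params E (z * rA) (z * rB) by split => //; rewrite mulr_gt0.
have [TA [TB [p1 [p2 [k Hf]]]]] := frame_exists nz.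
have [c c0 Vc] := polar_ratio_gauge Hf zr wg pe.
exists E, (z * rA), (z * rB), TA, TB, p1, p2, k, c; split; split => //.
(* zeta cancels in the ratio, so q is also an invariant of the critical pair. *)
by rewrite -rq; field; rewrite !gt_eqF.
Qed.

Lemma explicit_continuous (R : realType) (K q : R) V : explicit_clf K q V ->
  continuous V.
Proof.
move=> /explicit_gauge[E [tA [tB [TA [TB [p1 [p2 [k [c]]]]]]]]].
move=> [[np r1 _ _] [Hf c0 ->]]; have [_ tA0 tB0 _] := np.
move=> x; apply: (@cvgM _ _ (nbhs x) (nbhs_filter x)); first exact: cvg_cst.
exact: (gauge_continuous tA0 tB0 Hf r1).
Qed.

Lemma explicit_scale (R : realType) (K q : R) V (c : R) x : explicit_clf K q V ->
  V (c *: x) = `|c| * V x.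
Proof.
move=> /explicit_gauge[E [tA [tB [TA [TB [p1 [p2 [k [d [_ [Hf d0 ->]]]]]]]]]]].
by rewrite (gauge_scale Hf) mulrCA.
Qed.

(** V comes from some pair with the same kappa and ratio: [kappa_inj] identifies its E, and
    [gues_level] puts the critical radii behind V below rA and rB. Its gauge then decreases for the
    rescaled normal form, which is conjugate to S. *)
Lemma explicit_clf_conj (R : realType) (S : system R) (P : 'M[R]_2) (E rA rB : R) V :
  gues S -> nf_params E rA rB -> brings_to_nf S P E rA rB ->
  explicit_clf (kappa E) (rB / rA) V -> clf S (fun x => V (P *m x)).
Proof.
move=> gS np bS /explicit_gauge[E' [tA [tB [TA [TB [p1 [p2 [k [c]]]]]]]]].
move=> [[np' r1 EE tr] [Hf c0 ->]]; have [E1 rA0 rB0 _] := np.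
have [E1' tA0 tB0 _] := np'; have E'E := kappa_inj E1' E1 EE; subst E'.
have [tAr tBr] := gues_level gS rA0 rB0 bS np' r1 tr.
have [Pu [a [b [a0 b0 SA SB]]]] := bS.
apply: (@clf_conj _ P S (fun x => c * gauge E tA tB p1 p2 k x) Pu).
apply: clf_scale => //.
have -> : conj_system P S = (a^-1 *: nfA E rA, b^-1 *: nfB rB).
  by rewrite -SA -SB !scalerA !mulVf ?gt_eqF// !scale1r.
by apply: (gauge_clf_nf Hf r1); rewrite ?invr_gt0 ?tA0 ?tB0.
Qed.

(** Homogeneity of V turns the positive scalar c left over by the QR decomposition of P into a
    factor of the function. *)
Lemma clf_family_conj (R : realType) (V : R -> R -> 'cV[R]_2 -> R)
    (P : 'M[R]_2) (E rA rB : R) :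
  explicit_clf (kappa E) (rB / rA) (V (kappa E) (rB / rA)) ->
  P \in unitmx -> nf_params E rA rB -> rhoCC (kappa E) rA rB < 1 ->
  exists2 f, clf_family V f &
    exists2 c : R, 0 < c & forall x, V (kappa E) (rB / rA) (P *m x) = c * f x.
Proof.
move=> HV Pu np r1; have [c [th [a [b [c0 an ->]]]]] := QR_coord_change Pu.
pose w : 'rV[R]_5 := \row_i nth 0 [:: kappa E; rB / rA; th; a; b] i.
have w0 : w 0 0 = kappa E by rewrite mxE.
have w1 : w 0 1 = rB / rA by rewrite mxE.
have w2 : w 0 (inord 2) = th by rewrite mxE inordK.
have w3 : w 0 (inord 3) = a by rewrite mxE inordK.
have w4 : w 0 (inord 4) = b by rewrite mxE inordK.
exists (clf_of_params V w).
  by exists w => //; split; [rewrite w3|exists E, rA, rB].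
exists c => // x; rewrite /clf_of_params w0 w1 w2 w3 w4 -scalemxAl.
by rewrite (explicit_scale _ _ HV) gtr0_norm.
Qed.

Theorem mainTheorem5 (R : realType) :
  (* (a) *)
  (exists F : set ('cV[R]_2 -> R), finite_ssf 5 (@Xi R) F) /\
  (* (b), the explicit common Lyapunov functions *)
  (forall E rA rB : R,
     nf_params E rA rB -> rhoCC (kappa E) rA rB < 1 ->
     exists zeta : R,
       [/\ 0 < zeta < 1,
           0 < calD (kappa E) (zeta * rA) (zeta * rB),
           rhoCC (kappa E) (zeta * rA) (zeta * rB) = 1,
           (forall x0 : 'cV[R]_2, x0 != 0 ->
              exists2 gamma,
                worst_trajectory (nf E (zeta * rA) (zeta * rB)) gamma &
                gamma 0 = x0) &
           (forall gamma : R -> 'cV[R]_2,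
              worst_trajectory (nf E (zeta * rA) (zeta * rB)) gamma ->
              [/\ closed_trajectory gamma,
                  (exists rt : R -> R, polar_equation gamma rt) &
                  (forall rt : R -> R, polar_equation gamma rt ->
                     clf (nf E rA rB) (polar_ratio rt))])]) /\
  (* (b), the five-parameter family; V fixes one function for each (K, q) *)
  (forall V : R -> R -> 'cV[R]_2 -> R,
     (forall E rA rB : R,
        nf_params E rA rB -> rhoCC (kappa E) rA rB < 1 ->
        explicit_clf (kappa E) (rB / rA) (V (kappa E) (rB / rA))) ->
     [/\ finite_ssf 5 (@nf_class R) (clf_family V),
         (exists2 Omega : set 'rV[R]_5, Omega `<=` @clf_params R &
            set_bij Omega (clf_family V) (clf_of_params V)),
         (forall (S : system R) (P : 'M[R]_2) (E rA rB : R),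
            Xi S -> nf_params E rA rB -> brings_to_nf S P E rA rB -> gues S ->
            clf S (fun x => V (kappa E) (rB / rA) (P *m x))) &
         (forall (P : 'M[R]_2) (E rA rB : R),
            P \in unitmx -> nf_params E rA rB -> rhoCC (kappa E) rA rB < 1 ->
            exists2 f, clf_family V f &
              exists2 c : R, 0 < c &
                forall x, V (kappa E) (rB / rA) (P *m x) = c * f x)]).
Proof.
split; [exact: Xi_finite_ssf|split; first exact: nf_worst].
move=> V HV.
have clfP (S : system R) P (E rA rB : R) : nf_params E rA rB ->
    brings_to_nf S P E rA rB -> gues S ->
    clf S (fun x => V (kappa E) (rB / rA) (P *m x)).
  move=> np bS gS; apply: (explicit_clf_conj gS np bS).
  exact: HV np (gues_rhoCC gS np bS).
(* Different rows may give the same function, for instance when theta changes by 2 pi, so the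
   parameters are thinned to a set W on which the map is injective. *)
have [W WA bij] := image_section 0 (clf_of_params V) (@clf_params R).
split; [split| |by move=> S P E rA rB _; exact: clfP|].
- move=> _ [w [_ [E [rA [rB [np r1 w0 w1]]]]] <-] x.
  pose P := coord_change (w 0 (inord 2)) (w 0 (inord 3)) (w 0 (inord 4)).
  apply: (@continuous_comp _ _ _ (mulmx P) (V (w 0 0) (w 0 1)) x (@cont_mulmx _ P x)).
  by rewrite w0 w1; apply: explicit_continuous; exact: HV np r1.
- by exists W, (clf_of_params V).
- move=> S [_ [P [E [rA [rB [np bS]]]]]] gS.
  have r1 := gues_rhoCC gS np bS; have [Pu _] := bS.
  have [f Ff [c c0 fc]] := clf_family_conj (HV _ _ _ np r1) Pu np r1.
  exists f => //; have cV : 0 < c^-1 by rewrite invr_gt0.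
  have := clf_scale cV (clfP S P E rA rB np bS gS).
  congr (clf S _); apply/funext => x; rewrite fc mulKf// gt_eqF//.
- by exists W.
- move=> P E rA rB Pu np r1; exact: clf_family_conj (HV _ _ _ np r1) Pu np r1.
Qed.
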